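(* Let $\alpha>0$ be fixed, let $p=p_n=\alpha/n$, and let $d=d_n$ be positive integers with $d=\omega(\log n)$, i.e. $d/\log n\to\infty$ as $n\to\infty$. Let $A$ be the adjacency matrix of the spherical threshold random geometric graph $\mathcal G(n,d,p)$. Then the empirical spectral distribution $\mu_{A/\sqrt{np}}=\mu_{A/\sqrt\alpha}$ converges weakly in probability, as $n\to\infty$, to $\nu_\alpha$.
   Context: Let $X_1,\ldots,X_n$ be independent uniform random points on the unit sphere $S^{d-1}\subset\mathbb R^d$. For $p\in(0,1/2)$ (which holds for all large $n$), let $\tau=\tau_{d,p}$ be the threshold satisfying $\mathbb P\{\langle X_1,X_2\rangle\ge\tau\}=p$. The spherical threshold random geometric graph $\mathcal G(n,d,p)$ on $\{1,\dots,n\}$ has adjacency matrix $A$ given by $A_{ij}=\mathbf 1_{\{\langle X_i,X_j\rangle\ge\tau\}}$ for $i\ne j$ and $A_{ii}=0$. For an $n\times n$ real symmetric matrix $B$, $\mu_B=n^{-1}\sum_{i=1}^n\delta_{\lambda_i(B)}$ denotes its empirical spectral distribution, where $\lambda_1(B),\dots,\lambda_n(B)$ are its eigenvalues. $\nu_\alpha$ denotes the (deterministic) limiting empirical spectral distribution of $A_{\mathrm{ER}}/\sqrt\alpha$ as $n\to\infty$, where $A_{\mathrm{ER}}$ is the adjacency matrix of the Erdős–Rényi graph $\mathcal G(n,\alpha/n)$ (each edge present independently with probability $\alpha/n$); the existence of this limit is known. Weak convergence in probability of random probability measures $\mu_n$ to a deterministic $\mu$ means $\int f\,d\mu_n\to\int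 f\,d\mu$ in probability for every bounded continuous $f:\mathbb R\to\mathbb R$. *)

(* Defs.v *)
From HB Require Import structures.
From mathcomp Require Import all_boot all_order all_algebra.
From mathcomp Require Import complex.
From mathcomp Require Import all_classical all_reals all_analysis.

Set Implicit Arguments.
Unset Strict Implicit.
Unset Printing Implicit Defensive.

Import Order.TTheory GRing.Theory Num.Theory.
Import numFieldNormedType.Exports.

Local Open Scope classical_set_scope.
Local Open Scope ring_scope.

Section Spectrum.
Context {R : realType}.

(* Meaningful for symmetric B: the complexification is then normal, so
   [spectral_diag] lists its eigenvalues with multiplicity, and these are real
   ([char_poly_eigenvalues]). *)
Definition eigenvalues n (B : 'M[R]_n) : seq R :=
  [seq complex.Re (spectral_diag (map_mx (real_complex R) B) 0 i)
  | i <- enum 'I_n].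

Lemma char_poly_eigenvalues n (B : 'M[R]_n) :
  B^T = B -> char_poly B = \prod_(x <- eigenvalues B) ('X - x%:P).
Proof.
move=> symB; apply: (@map_poly_inj _ _ (real_complex R)).
rewrite map_char_poly big_map big_enum rmorph_prod /=.
set A := map_mx _ B; set D := spectral_diag A; set P := spectralmx A.
have hA : A \is hermsymmx.
  apply: realsym_hermsym.
    by rewrite qualifE /= expr0 scale1r map_mx_id // /A map_trmx symB.
  by apply/mxOverP => i j; rewrite mxE; rewrite /= complex_real.
have /mxOverP rD := hermitian_spectral_diag_real hA.
have /orthomx_spectralP eA := hermitian_normalmx hA.
rewrite -/P -/D in eA.
have uP : P \in unitmx by exact: spectral_unit.
have <- : char_poly (diag_mx D) = char_poly A.
  have eX : char_poly_mx A =
      map_mx polyC (invmx P) *m char_poly_mx (diag_mx D) *m map_mx polyC P.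
    rewrite /char_poly_mx mulmxBr mulmxBl -!map_mxM -eA; congr (_ - _).
    by rewrite mul_mx_scalar -scalemxAl -map_mxM mulVmx // map_mx1 scalemx1.
  rewrite /char_poly eX !det_mulmx mulrC mulrA -det_mulmx -map_mxM mulmxV //.
  by rewrite map_mx1 det1 mul1r.
rewrite char_poly_trig ?diag_mx_is_trig //; apply: eq_bigr => i _.
rewrite mxE eqxx mulr1n rmorphB /= map_polyX map_polyC /=; congr (_ - _%:P).
by rewrite RRe_real.
Qed.

Definition esd n (B : 'M[R]_n) : {measure set R -> \bar R} :=
  mscale (n%:R^-1 : R)%:nng (msum (fun k => \d_((eigenvalues B)`_k)) n).

(* The laws [P n] are mere set functions so that both probability measures and
   the finite laws of random graphs below are covered. *)
Definition esd_cvg_in_probability (T : nat -> Type)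
    (P : forall n, set (T n) -> \bar R) (M : forall n, T n -> 'M[R]_n)
    (nu : probability R R) : Prop :=
  forall f : R -> R, continuous f -> (exists C, forall x, `|f x| <= C) ->
  forall eps : R, 0 < eps ->
    P n [set w | eps <= `|\int[esd (M n w)]_x f x - \int[nu]_x f x|]
      @[n --> \oo] --> 0%E.

End Spectrum.

Section ErdosRenyi.
Context {R : realType}.

Definition potential_edges n : {set 'I_n * 'I_n} :=
  [set e : 'I_n * 'I_n | (e.1 < e.2)%N].

(* A graph on 'I_n is encoded by its set of edges, each edge {i, j} with i < j
   being represented by the pair (i, j). *)
Definition er_weight n (q : R) (E : {set 'I_n * 'I_n}) : R :=
  \prod_(e in potential_edges n) (if e \in E then q else 1 - q).

Definition er_law n (q : R) (S : set {set 'I_n * 'I_n}) : \bar R :=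
  (\sum_(E in powerset (potential_edges n) | `[< S E >]) er_weight q E)%:E.

Definition er_adjacency n (E : {set 'I_n * 'I_n}) : 'M[R]_n :=
  \matrix_(i, j) (((i, j) \in E) || ((j, i) \in E))%:R.

(* [nu] is the limiting spectral distribution nu_alpha. It is unique, since a
   Borel probability measure is determined by its integrals of bounded
   continuous functions. For n < alpha the weights are not probabilities, which
   does not affect the limit. *)
Definition is_er_limit (alpha : R) (nu : probability R R) : Prop :=
  esd_cvg_in_probability
    (fun n => @er_law n (alpha / n%:R))
    (fun n E => (Num.sqrt alpha)^-1 *: er_adjacency E)
    nu.

End ErdosRenyi.

Section SphericalGraph.
Context {R : realType}.

Definition borel_rV d : measurableType _ :=
  g_sigma_algebraType (@open 'rV[R]_d).

Definition dotv d (x y : 'rV[R]_d) : R := \sum_(k < d) x 0 k * y 0 k.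

Definition unit_sphere d : set (borel_rV d) := [set x | dotv x x = 1].

(* The uniform distribution on the sphere is the unique rotation-invariant
   Borel probability measure carried by it. *)
Definition uniform_on_sphere d (mu : set (borel_rV d) -> \bar R) : Prop :=
  mu (@unit_sphere d) = 1%E /\
  forall Q : 'M[R]_d, Q *m Q^T = 1%:M ->
  forall B : set (borel_rV d), measurable B ->
    mu [set x : borel_rV d | B (x *m Q)] = mu B.

(* Taking [B i] to be the whole space outside a subset of the indices gives the
   product rule for every subfamily. *)
Definition mutually_independent (disp : measure_display)
    (T : measurableType disp) (P : probability T R) d n
    (X : 'I_n -> {RV P >-> borel_rV d}) : Prop :=
  forall B : 'I_n -> set (borel_rV d), (forall i, measurable (B i)) ->
    P [set w | forall i, B i (X i w)] = (\prod_(i < n) P (X i @^-1` B i))%E.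

Definition iid_uniform_on_sphere (disp : measure_display)
    (T : measurableType disp) (P : probability T R) d n
    (X : 'I_n -> {RV P >-> borel_rV d}) : Prop :=
  mutually_independent X /\
  forall i, uniform_on_sphere (distribution P (X i)).

Definition is_threshold (disp : measure_display) (T : measurableType disp)
    (P : probability T R) d n (X : 'I_n -> {RV P >-> borel_rV d})
    (p tau : R) : Prop :=
  forall i j, i != j -> P [set w | tau <= dotv (X i w) (X j w)] = p%:E.

Definition rgg_adjacency d n (tau : R) (x : 'I_n -> 'rV[R]_d) : 'M[R]_n :=
  \matrix_(i, j) ((i != j) && (tau <= dotv (x i) (x j)))%:R.

End SphericalGraph.

(* Main.v *)
(*
  The two models are compared through mixed moments of traces. In both, a forest
  on given vertices is present with probability exactly p^(number of edges), and
  closing a cycle costs a further factor that tends to 0. For the sphere this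
  reduces to Phi(4 tau / 3) = o(Phi(tau)) and Phi(1/8) = o(1/n), where Phi(t) is
  the measure of the cap of height t: if <a, b> <= 1/8 then a point in the caps
  of height tau around a and b is in the cap of height 4 tau / 3 around the
  bisector. The first estimate holds because tau sqrt d tends to infinity, the
  second because d / log n does. Expanding tr A^k tr A^l over walks, the forests
  contribute equally in both models and the other walks contribute o(n^2).

  Instead of identifying nu by its moments, one transfers the convergence known
  for the Erdos-Renyi graph. Uniformly in n, E[n^-1 tr exp (t |A|)] is finite for
  every t, so functions approximable by polynomials up to delta exp (t |x|) can be
  transferred in L^2; these include the polynomials in sin (s x), which
  approximate every continuous function on a segment.
*)
Require Import Defs.
From HB Require Import structures.
From mathcomp Require Import all_boot all_order all_algebra.
From mathcomp Require Import ring lra complex.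
From mathcomp Require Import all_classical all_reals all_analysis.
From mathcomp Require Import measurable_realfun.

Set Implicit Arguments.
Unset Strict Implicit.
Unset Printing Implicit Defensive.

Import Order.TTheory GRing.Theory Num.Theory.
Import numFieldNormedType.Exports.

Local Open Scope classical_set_scope.
Local Open Scope ring_scope.

(** * Independence of the points *)

(** The cap estimates use no density: rotation invariance alone replaces a fixed direction by an
    average over sign vectors, or mixes two coordinates by a reflection. Conditioning uses only that
    a new point is independent of the others and that the measure of a cap does not depend on its
    centre, so a new leaf costs exactly p wherever the earlier points are. The obstacle at the end
    is that the hypothesis on [nu] concerns bounded continuous functions, whereas traces compare
    polynomials only, and no moment of [nu] is controlled. The link is a class of functions that are
    bounded, so that the Erdos-Renyi convergence holds for them in mean square, and are also close
    to polynomials with respect to the weight exp (t |x|). The comparison goes from such a function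
    to a polynomial, changes the model there, and returns to the same function; [nu] enters only
    through the constant to which the means converge. *)

Lemma measurable_coord (R : realType) d (k : 'I_d) :
  measurable_fun [set: borel_rV d] (fun x : borel_rV d => x 0 k : R).
Proof.
apply: (measurability _ (RGenOpens.measurableE R)).
move=> _ [_ [a [b ->]] <-]; rewrite setTI.
apply: sub_sigma_algebra.
have /continuousP := @coord_continuous R 1 d 0 k.
by apply; exact: interval_open.
Qed.

Section Sphere.
Context {R : realType}.

Lemma measurable_dotv disp (U : measurableType disp) d
    (f g : U -> borel_rV (R:=R) d) :
  measurable_fun setT f -> measurable_fun setT g ->
  measurable_fun setT (fun u => dotv (f u) (g u)).
Proof.
move=> mf mg; apply: measurable_sum => k; apply: measurable_funM.
- exact: (measurableT_comp (measurable_coord k) mf).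
- exact: (measurableT_comp (measurable_coord k) mg).
Qed.

Lemma measurable_le_dotv disp (U : measurableType disp) d
    (f g : U -> borel_rV (R:=R) d) (t : R) :
  measurable_fun setT f -> measurable_fun setT g ->
  measurable [set u | t <= dotv (f u) (g u)].
Proof.
move=> mf mg.
have -> : [set u | t <= dotv (f u) (g u)] =
    setT `&` (fun u => dotv (f u) (g u)) @^-1` `[t, +oo[.
  by rewrite setTI; apply/seteqP; split => u /=; rewrite in_itv/= andbT.
by apply: measurable_dotv.
Qed.

Lemma measurable_unit_sphere d : measurable (@unit_sphere R d).
Proof.
have -> : @unit_sphere R d =
    setT `&` (fun u : borel_rV d => dotv u u) @^-1` [set 1].
  by rewrite setTI.
by apply: measurable_dotv.
Qed.

End Sphere.

Section Independence.
Context {R : realType} (disp : measure_display) (T : measurableType disp)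
  (P : probability T R) (d n : nat) (X : 'I_n -> {RV P >-> @borel_rV R d}).
Hypothesis indepX : mutually_independent X.
Local Open Scope ereal_scope.

(** The condition [B v = setT] leaves the point v free while keeping families indexed by all of
    ['I_n], as in [mutually_independent]. These sets form a pi-system. *)
Definition cylinders_off (v : 'I_n) : set (set T) :=
  [set S | exists B : 'I_n -> set (borel_rV d),
     [/\ forall i, measurable (B i), B v = setT &
         S = [set w | forall i, B i (X i w)]]].

Lemma measurable_cylinder (B : 'I_n -> set (borel_rV d)) :
  (forall i, measurable (B i)) -> measurable [set w | forall i, B i (X i w)].
Proof.
move=> mB.
have -> : [set w | forall i, B i (X i w)] =
    \bigcap_(i in [set: 'I_n]) (X i @^-1` B i).
  by apply/seteqP; split => w /= H i; [move=> _; exact: H | exact: (H i)].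
apply: fin_bigcap_measurable => // i _.
by rewrite -[X in measurable X]setTI; exact: measurable_funP.
Qed.

Lemma cylinders_off_measurable v : cylinders_off v `<=` measurable.
Proof. by move=> _ [B [mB _ ->]]; exact: measurable_cylinder. Qed.

Lemma sigma_cylinders_off_measurable v :
  <<s cylinders_off v >> `<=` (measurable : set (set T)).
Proof.
exact: (smallest_sub (@sigma_algebra_measurable _ T)
  (@cylinders_off_measurable v)).
Qed.

(** Both sides are finite measures in S. They agree on cylinders, where the trivial factor [B v] can
    be replaced by C in the product rule, and cylinders are stable under intersection. *)
Lemma cylinder_off_indep v S (C : set (borel_rV d)) :
  measurable C -> <<s cylinders_off v >> S ->
  P (S `&` X v @^-1` C) = P S * P (X v @^-1` C).
Proof.
move=> mC.
have mXC : measurable (X v @^-1` C).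
  by rewrite -[Y in measurable Y]setTI; exact: measurable_funP.
have c0 : (0 <= fine (P (X v @^-1` C)))%R by rewrite fine_ge0.
pose m1 := mrestr P mXC.
pose m2 := mscale (NngNum c0) P.
have -> : P S * P (X v @^-1` C) = m2 S.
  by rewrite /m2 /mscale /= fineK ?fin_num_measure// muleC.
rewrite -[LHS]/(m1 S).
move: S; apply: (@g_sigma_algebra_measure_unique _ _ _
  (cylinders_off v) _ (fun=> setT)).
- exact: cylinders_off_measurable.
- move=> _; exists (fun=> setT); split => //.
  by apply/seteqP; split.
- by apply/seteqP; split => // x _; exists 0%N.
- move=> _ _ [B [mB Bv ->]] [B' [mB' Bv' ->]].
  exists (fun i => B i `&` B' i); split.
  + by move=> i; exact: measurableI.
  + by rewrite Bv Bv' setTI.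
  + by apply/seteqP; split => w /=;
      [move=> [H1 H2] i; split; [exact: H1|exact: H2]
      |move=> H; split => i; have [] := H i].
- move=> _ [B [mB Bv ->]]; rewrite /= /mrestr /mscale /= fineK ?fin_num_measure//.
  have -> : [set w | forall i, B i (X i w)] `&` X v @^-1` C =
      [set w | forall i : 'I_n, (if i == v then C else B i) (X i w)].
    apply/seteqP; split => w /=.
      by move=> [H Cv] i; case: eqP => [->|_]; [exact: Cv|exact: H].
    move=> H; split; last by have := H v; rewrite eqxx.
    by move=> i; have := H i; case: eqP => [-> _|//]; rewrite Bv.
  pose B' (i : 'I_n) := if i == v then C else B i.
  have mB' i : measurable (B' i) by rewrite /B'; case: (i == v).
  transitivity (\prod_(i < n) P (X i @^-1` B' i)); first exact: (indepX mB').
  transitivity (P (X v @^-1` C) * \prod_(i < n) P (X i @^-1` B i)); last first.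
    by congr (_ * _); exact/esym/(indepX mB).
  rewrite (bigD1 v)//= [in RHS](bigD1 v)//=.
  rewrite {1}/B' eqxx Bv preimage_setT probability_setT mul1e.
  by congr (_ * _); apply: eq_bigr => i /negbTE vi; rewrite /B' vi.
- move=> k; rewrite /= /mrestr setTI.
  by rewrite (le_lt_trans (probability_le1 P mXC))// ltry.
Qed.

(* The sample space with the sigma-algebra generated by the X i with i != v. *)
Definition off_type v := g_sigma_algebraType (cylinders_off v).

(** The identity, seen as a measurable map onto the coarser sigma-algebra; its law is the
    restriction of [P]. *)
Definition to_off v : T -> off_type v := id.

Lemma measurable_to_off v : measurable_fun setT (@to_off v).
Proof.
move=> _ B mB; rewrite setTI.
exact: sigma_cylinders_off_measurable mB.
Qed.

HB.instance Definition _ v :=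
  isMeasurableFun.Build _ _ _ _ (@to_off v) (@measurable_to_off v).

Definition pair_off v : T -> off_type v * borel_rV d :=
  fun w => (to_off v w, X v w).

Lemma measurable_pair_off v : measurable_fun setT (pair_off v).
Proof.
apply/measurable_fun_pairP; split; first exact: measurable_to_off.
exact: measurable_funP.
Qed.

HB.instance Definition _ v :=
  isMeasurableFun.Build _ _ _ _ (pair_off v) (@measurable_pair_off v).

(** Independence makes the law of [pair_off v] a product on rectangles, hence the product measure.
    Its first coordinate is the whole sample point, so that Q may involve all the other points at
    once. *)
Lemma fubini_off v (Q : set (off_type v * borel_rV d)) : measurable Q ->
  P [set w | Q (w, X v w)] =
  \int[distribution P (to_off v)]_w
     distribution P (X v) (xsection Q w).
Proof.
move=> mQ.
transitivity (distribution P (pair_off v) Q) => //.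
apply/esym.
apply: (@product_measure_unique _ _ (off_type v) (borel_rV d) R
  (distribution P (to_off v)) (distribution P (X v))
  (distribution P (pair_off v))) => // A B mA mB.
by rewrite /distribution /pushforward -(cylinder_off_indep mB mA).
Qed.

Lemma fubini_off_setI v S (Q : set (off_type v * borel_rV d)) :
  <<s cylinders_off v >> S -> measurable Q ->
  P (S `&` [set w | Q (w, X v w)]) =
  \int[distribution P (to_off v)]_(w in S)
     distribution P (X v) (xsection Q w).
Proof.
move=> mS mQ.
have mS' : measurable (S : set (off_type v)) by [].
have := @fubini_off v ((S `*` setT) `&` Q).
move=> /(_ (measurableI _ _ (measurableX mS' measurableT) mQ)) fub.
rewrite [RHS]integral_mkcond.
transitivity (P [set w | ((S `*` setT) `&` Q) (w, X v w)]).
  by congr (P _); apply/seteqP; split => w /= [] => [? ?|[? _] ?].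
rewrite fub; apply: eq_integral => w _.
rewrite patchE; case: ifPn => [/set_mem Sw|/negP wS].
- congr (distribution P (X v) _); apply/seteqP; split => z; rewrite /xsection /= !inE /=.
  + by case.
  + by move=> ?; split.
- rewrite (_ : xsection _ w = set0) ?measure0//.
  apply/seteqP; split => z //; rewrite /xsection /= inE /= => -[[Sw _] _].
  by apply: wS; exact/mem_set.
Qed.

Lemma fubini_off_le v S (Q : set (off_type v * borel_rV d)) (c : R) :
  <<s cylinders_off v >> S -> measurable Q -> (0 <= c)%R ->
  (forall w, S w -> distribution P (X v) (xsection Q w) <= c%:E) ->
  P (S `&` [set w | Q (w, X v w)]) <= c%:E * P S.
Proof.
move=> mS mQ c0 cS; rewrite fubini_off_setI//.
have mS' : measurable (S : set (off_type v)) by [].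
rewrite [leRHS](_ : _ = \int[distribution P (to_off v)]_(w in S) cst c%:E w).
  apply: ge0_le_integral => //.
  by apply: measurable_funTS; exact: measurable_fun_xsection.
by rewrite integral_cst.
Qed.

Lemma fubini_off_eq v S (Q : set (off_type v * borel_rV d)) (c : R) :
  <<s cylinders_off v >> S -> measurable Q ->
  (forall w, S w -> distribution P (X v) (xsection Q w) = c%:E) ->
  P (S `&` [set w | Q (w, X v w)]) = c%:E * P S.
Proof.
move=> mS mQ cS; rewrite fubini_off_setI//.
have mS' : measurable (S : set (off_type v)) by [].
transitivity (\int[distribution P (to_off v)]_(w in S) cst c%:E w).
  by apply: eq_integral => w /set_mem; exact: cS.
by rewrite integral_cst.
Qed.

Lemma measurable_off v i (iv : i != v) :
  measurable_fun setT (X i : off_type v -> borel_rV d).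
Proof.
move=> _ B mB; rewrite setTI; apply: sub_sigma_algebra.
exists (fun j => if j == i then B else setT); split.
- by move=> j; case: (j == i).
- by rewrite eq_sym (negbTE iv).
- apply/seteqP; split => w /=; first by move=> Bw j; case: eqP => // ->.
  by move=> /(_ i); rewrite eqxx.
Qed.

End Independence.

(** * The uniform distribution on the sphere *)

Section Dotv.
Context {R : realType} (d : nat).
Implicit Types x y z : 'rV[R]_d.

Lemma dotvE x y : dotv x y = (x *m y^T) 0 0.
Proof. by rewrite mxE; apply: eq_bigr => k _; rewrite mxE. Qed.

Lemma dotvC x y : dotv x y = dotv y x.
Proof. by apply: eq_bigr => k _; rewrite mulrC. Qed.

Lemma dotvDl x y z : dotv (x + y) z = dotv x z + dotv y z.
Proof. by rewrite !dotvE mulmxDl mxE. Qed.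

Lemma dotvZl (a : R) x z : dotv (a *: x) z = a * dotv x z.
Proof. by rewrite !dotvE -scalemxAl mxE. Qed.

Lemma dotvBl x y z : dotv (x - y) z = dotv x z - dotv y z.
Proof. by rewrite dotvDl -scaleN1r dotvZl mulN1r. Qed.

Lemma dotvDr x y z : dotv z (x + y) = dotv z x + dotv z y.
Proof. by rewrite dotvC dotvDl !(dotvC z). Qed.

Lemma dotvZr (a : R) x z : dotv z (a *: x) = a * dotv z x.
Proof. by rewrite dotvC dotvZl (dotvC z). Qed.

Lemma dotvBr x y z : dotv z (x - y) = dotv z x - dotv z y.
Proof. by rewrite dotvC dotvBl !(dotvC z). Qed.

Lemma dotv_mulmx x z (Q : 'M[R]_d) : dotv x (z *m Q) = dotv (x *m Q^T) z.
Proof. by rewrite !dotvE trmx_mul mulmxA. Qed.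

Lemma dotv_self x : dotv x x = \sum_k x 0 k ^+ 2.
Proof. by apply: eq_bigr => k _; rewrite expr2. Qed.

Lemma dotv_ge0 x : 0 <= dotv x x.
Proof. by rewrite dotv_self sumr_ge0// => k _; exact: sqr_ge0. Qed.

Lemma dotv_eq0 x : (dotv x x == 0) = (x == 0).
Proof.
rewrite dotv_self; apply/eqP/eqP => [/eqP|->]; last first.
  by rewrite big1// => k _; rewrite mxE expr0n.
rewrite psumr_eq0//; last by move=> k _; exact: sqr_ge0.
move=> /allP x0; apply/rowP => k; rewrite mxE; apply/eqP.
by have := x0 k (mem_index_enum _); rewrite sqrf_eq0.
Qed.

Lemma dotv_orth x (Q : 'M[R]_d) : Q *m Q^T = 1%:M ->
  dotv (x *m Q) (x *m Q) = dotv x x.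
Proof. by move=> QQ; rewrite dotv_mulmx -mulmxA QQ mulmx1. Qed.

Lemma dotv_delta (k : 'I_d) z : dotv (delta_mx 0 k) z = z 0 k.
Proof. by rewrite dotvC dotvE trmx_delta -colE mxE. Qed.

Lemma coord_sphere_le1 x k : dotv x x = 1 -> `|x 0 k| <= 1.
Proof.
rewrite dotv_self (bigD1 k)//= => x1.
rewrite -(@ler_pXn2r _ 2)// ?nnegrE// expr1n -x1 real_normK ?num_real//.
by rewrite lerDl sumr_ge0// => i _; exact: sqr_ge0.
Qed.

(* The Householder reflection exchanging [x] and [y]. *)
Lemma exists_rotation x y : dotv x x = 1 -> dotv y y = 1 ->
  exists Q : 'M[R]_d, Q *m Q^T = 1%:M /\ x *m Q^T = y.
Proof.
move=> x1 y1; have [->|xy] := eqVneq x y.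
  by exists 1%:M; rewrite trmx1; split; rewrite mulmx1.
have [w wE] : exists w, w = x - y by exists (x - y).
have w0 : dotv w w != 0 by rewrite dotv_eq0 wE subr_eq0.
pose c := 2 / dotv w w.
pose Q := 1%:M - c *: (w^T *m w).
have QT : Q^T = Q.
  by rewrite /Q linearB/= linearZ/= trmx_mul trmxK trmx1.
have wEl : w *m w^T = (dotv w w)%:M.
  by apply/matrixP => i j; rewrite !ord1 dotvE [RHS]mxE eqxx mulr1n.
exists Q; rewrite QT; split.
  rewrite /Q mulmxBl mul1mx mulmxBr mulmx1 -!scalemxAl -!scalemxAr.
  rewrite mulmxA -(mulmxA w^T) wEl -mulmxA mul_scalar_mx -scalemxAr.
  set W := w^T *m w; rewrite !scalerA -scalerBl.
  rewrite (_ : c - c * (c * dotv w w) = - c) ?scaleNr ?opprK ?subrK//.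
  by rewrite /c; field.
rewrite /Q mulmxBr mulmx1 -scalemxAr mulmxA.
have -> : x *m w^T = (dotv x w)%:M.
  by apply/matrixP => i j; rewrite !ord1 dotvE [RHS]mxE eqxx mulr1n.
rewrite mul_scalar_mx scalerA.
have -> : c * dotv x w = 1.
  rewrite /c; have : dotv w w = 2 * dotv x w.
    by rewrite wE !(dotvBl, dotvBr) x1 y1 (dotvC y x); ring.
  by move=> E; rewrite E in w0 *; field; apply: contra w0 => /eqP ->; rewrite mulr0.
by rewrite scale1r wE opprB addrC subrK.
Qed.

End Dotv.

(** * Means over the sphere and their rotation invariance *)

Section SphereExpectation.
Context {R : realType} (d : nat) (mu : probability (@borel_rV R d) R).
Hypothesis hmu : uniform_on_sphere mu.
Local Notation sph := (@unit_sphere R d).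

(** Boundedness is asked on the sphere only, so that polynomials in the coordinates are included;
    accordingly [sE] integrates over the sphere instead of the whole space. *)
Definition tame (f : borel_rV (R:=R) d -> R) : Prop :=
  measurable_fun setT f /\ exists M, forall z, sph z -> `|f z| <= M.

Definition sE (f : borel_rV (R:=R) d -> R) : R := \int[mu]_(z in sph) f z.

Lemma tame_integrable f : tame f -> mu.-integrable sph (EFin \o f).
Proof.
move=> [mf [M fM]]; apply: measurable_bounded_integrable => //.
- exact: measurable_unit_sphere.
- by rewrite (le_lt_trans (probability_le1 mu (@measurable_unit_sphere R d)))// ltry.
- exact: measurable_funTS.
- exists M; split; first exact: num_real.
  by move=> y My z /fM zM; exact: le_trans zM (ltW My).
Qed.

Lemma tame_cst c : tame (fun=> c).
Proof. by split => //; exists `|c|. Qed.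

Lemma tameD f g : tame f -> tame g -> tame (fun z => f z + g z).
Proof.
move=> [mf [M fM]] [mg [N gN]]; split; first exact: measurable_funD.
exists (M + N) => z sz; rewrite (le_trans (ler_normD _ _))// lerD ?fM ?gN//.
Qed.

Lemma tameM f g : tame f -> tame g -> tame (fun z => f z * g z).
Proof.
move=> [mf [M fM]] [mg [N gN]]; split; first exact: measurable_funM.
by exists (M * N) => z sz; rewrite normrM ler_pM ?fM ?gN.
Qed.

Lemma tameX f k : tame f -> tame (fun z => f z ^+ k).
Proof.
move=> tf; elim: k => [|k IHk]; first by under eq_fun do rewrite expr0; exact: tame_cst.
by under eq_fun do rewrite exprS; exact: tameM.
Qed.

Lemma tame_sum I (r : seq I) (Q : pred I) (F : I -> borel_rV (R:=R) d -> R) :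
  (forall i, tame (F i)) -> tame (fun z => \sum_(i <- r | Q i) F i z).
Proof.
move=> tF; elim: r => [|i r IHr].
  by under eq_fun do rewrite big_nil; exact: tame_cst.
under eq_fun do rewrite big_cons; case: (Q i) => //; exact: tameD.
Qed.

Lemma tame_indic A : measurable A -> tame (\1_A).
Proof.
move=> mA; split; first exact: measurable_indic.
by exists 1 => z _; rewrite indicE; case: (_ \in _); rewrite ?normr1// normr0.
Qed.

Lemma tame_coord k : tame (fun z => z 0 k).
Proof.
split; first exact: measurable_coord.
by exists 1 => z sz; exact: coord_sphere_le1.
Qed.

Lemma sE_cst c : sE (fun=> c) = c.
Proof.
rewrite /sE Rintegral_cst; last exact: measurable_unit_sphere.
by rewrite [X in fine X](_ : _ = 1%E) ?mulr1//; exact: hmu.1.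
Qed.

Lemma sED f g : tame f -> tame g -> sE (fun z => f z + g z) = sE f + sE g.
Proof.
move=> tf tg; apply: RintegralD; try exact: tame_integrable.
exact: measurable_unit_sphere.
Qed.

Lemma sEZ c f : tame f -> sE (fun z => c * f z) = c * sE f.
Proof.
move=> tf; apply: RintegralZl; last exact: tame_integrable.
exact: measurable_unit_sphere.
Qed.

Lemma sE_sum I (r : seq I) (Q : pred I) (F : I -> borel_rV (R:=R) d -> R) :
  (forall i, tame (F i)) ->
  sE (fun z => \sum_(i <- r | Q i) F i z) = \sum_(i <- r | Q i) sE (F i).
Proof.
move=> tF; elim: r => [|i r IHr].
  by rewrite big_nil; under eq_fun do rewrite big_nil; exact: sE_cst.
rewrite big_cons; under eq_fun do rewrite big_cons.
by case: (Q i) => //; rewrite sED ?IHr//; exact: tame_sum.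
Qed.

Lemma sE_le f g : tame f -> tame g -> (forall z, dotv z z = 1 -> f z <= g z) ->
  sE f <= sE g.
Proof.
move=> tf tg fg; apply: le_Rintegral; try exact: tame_integrable.
- exact: measurable_unit_sphere.
- exact: fg.
Qed.

Lemma sE_eq f g : (forall z, dotv z z = 1 -> f z = g z) -> sE f = sE g.
Proof. by move=> fg; apply: eq_Rintegral => z /set_mem; exact: fg. Qed.

Lemma sphere_setI A : measurable A -> mu (A `&` sph) = mu A.
Proof.
move=> mA; apply/eqP; rewrite eq_le le_measure ?inE//=; last first.
  by apply: measurableI => //; exact: measurable_unit_sphere.
have mS := @measurable_unit_sphere R d.
rewrite -[X in (mu X <= _)%E](setUIDK A sph).
have s0 : mu (~` sph) = 0%E.
  by rewrite probability_setC// [X in (_ - X)%E](_ : _ = 1%E) ?subee//; exact: hmu.1.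
apply: (le_trans (measureU2 _ _ _)).
- exact: measurableI.
- exact: measurableD.
have sD : mu (A `\` sph) = 0%E.
  apply/eqP; rewrite eq_le measure_ge0 andbT -s0 le_measure ?inE//.
  - exact: measurableD.
  - exact: measurableC.
by rewrite [X in (_ + X)%E]sD adde0.
Qed.

Lemma sE_indic A : measurable A -> sE (\1_A) = fine (mu A).
Proof.
move=> mA; rewrite /sE /Rintegral integral_indic//; last exact: measurable_unit_sphere.
by congr fine; exact: sphere_setI.
Qed.

Lemma near_fin_forall (U : Type) (F : set_system U) (I : finType)
    (Q : I -> U -> Prop) :
  Filter F -> (forall i, \forall u \near F, Q i u) ->
  \forall u \near F, forall i, Q i u.
Proof.
move=> FF H.
suff S (r : seq I) : \forall u \near F, forall i, i \in r -> Q i u.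
  by apply: filterS (S (enum I)) => u Qu i; apply: Qu; rewrite mem_enum.
elim: r => [|i r IHr]; first exact: nearW.
apply: filterS2 (H i) IHr => u Qi Qr j; rewrite inE => /predU1P[->//|].
exact: Qr.
Qed.

Lemma mulmx_continuous (Q : 'M[R]_d) : continuous (fun z : 'rV[R]_d => z *m Q).
Proof.
move=> z.
have Hc (j : 'I_d) : (fun w : 'rV[R]_d => (w *m Q) 0 j) @ z --> (z *m Q) 0 j.
  under eq_fun do rewrite mxE; rewrite mxE.
  apply: cvg_big => [||k _]; first exact: add_continuous.
    exact: (nbhs_filter (z : 'rV[R]_d)).
  apply: cvgM.
  - exact: (nbhs_filter (z : 'rV[R]_d)).
  - exact: (@coord_continuous R 1 d 0 k z).
  - exact: (@cvg_cst _ _ _ (nbhs (z : 'rV[R]_d)) (nbhs_filter (z : 'rV[R]_d))).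
move=> A [B nB BA].
have H (j : 'I_d) : \forall w \near z, B 0 j ((w *m Q) 0 j).
  by apply: (Hc j); exact: nB.
have := near_fin_forall (nbhs_filter (z : 'rV[R]_d)) H.
apply: filterS => w Bw; apply: BA => i j.
by rewrite ord1; exact: Bw.
Qed.

Lemma measurable_mulmx (Q : 'M[R]_d) :
  measurable_fun [set: borel_rV d] (fun z : @borel_rV R d => z *m Q : borel_rV d).
Proof.
have E : @measurable _ (@borel_rV R d) = <<s (@open 'rV[R]_d) >> by [].
apply: (measurability _ E) => _ [B oB <-]; rewrite setTI.
apply: sub_sigma_algebra.
by have /continuousP := mulmx_continuous (Q := Q); exact.
Qed.

Lemma tame_rot f (Q : 'M[R]_d) : Q *m Q^T = 1%:M -> tame f ->
  tame (fun z => f (z *m Q)).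
Proof.
move=> QQ [mf [M fM]]; split.
  exact: (measurableT_comp mf (measurable_mulmx Q)).
by exists M => z sz; apply: fM; rewrite /unit_sphere /= dotv_orth.
Qed.

Lemma sE_rot f (Q : 'M[R]_d) : Q *m Q^T = 1%:M -> tame f ->
  sE (fun z => f (z *m Q)) = sE f.
Proof.
move=> QQ tf; rewrite /sE /Rintegral; congr fine.
have mQ := measurable_mulmx Q.
transitivity (\int[pushforward mu
    (fun z : @borel_rV R d => z *m Q : borel_rV d)]_(z in sph) (f z)%:E)%E.
  rewrite integral_pushforward//.
  - have -> // : (fun z : @borel_rV R d => z *m Q : borel_rV d) @^-1` sph = sph.
    by apply/seteqP; split => z; rewrite /unit_sphere /= dotv_orth.
  - by apply/measurable_EFinP; have [] := tf.
  - have -> : (fun z : @borel_rV R d => z *m Q : borel_rV d) @^-1` sph = sph.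
      by apply/seteqP; split => z; rewrite /unit_sphere /= dotv_orth.
    exact: tame_integrable (tame_rot QQ tf).
  - exact: measurable_unit_sphere.
apply: eq_measure_integral => A mA _; exact: hmu.2.
Qed.

Definition cap (u : 'rV[R]_d) t := fine (mu [set z : @borel_rV R d | t <= dotv u z]).

Lemma measurable_cap u t : measurable [set z : @borel_rV R d | t <= dotv u z].
Proof. exact: measurable_le_dotv. Qed.

Lemma cap_ge0 u t : 0 <= cap u t. Proof. exact: fine_ge0. Qed.

Lemma cap_le u s t : s <= t -> cap u t <= cap u s.
Proof.
move=> st; rewrite /cap fine_le ?fin_num_measure//; try exact: measurable_cap.
rewrite le_measure ?inE//; try exact: measurable_cap.
by move=> z /=; exact: le_trans.
Qed.

(** A reflection carries one centre to the other. Hence the measure of a cap is a function of its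
    height alone, the Phi of the overview. *)
Lemma cap_rot u v t : dotv u u = 1 -> dotv v v = 1 -> cap u t = cap v t.
Proof.
move=> u1 v1; have [Q [QQ uQ]] := exists_rotation u1 v1.
rewrite /cap -(hmu.2 Q QQ) //; last exact: measurable_cap.
by congr (fine (mu _)); apply/seteqP; split => z /=; rewrite dotv_mulmx uQ.
Qed.

End SphereExpectation.

(** * Elementary real inequalities *)

Section RealBounds.
Context {R : realType}.
Implicit Types y : R.

(* [cosh y <= exp (y^2)]: the bound at y / 2 gives it at y, as
   [cosh y = 2 cosh (y / 2)^2 - 1] and [2 c^2 - 1 <= c^4]. *)
Lemma expR_addN_le y : expR y + expR (- y) <= 2 * expR (y ^+ 2).
Proof.
suff H n : `|y| <= 2 ^+ n / 3 -> expR y + expR (- y) <= 2 * expR (y ^+ 2).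
  apply: (H (Num.truncn (3 * `|y|)).+1).
  rewrite ler_pdivlMr// mulrC (le_trans (ltW (truncnS_gt _)))// -natrX ler_nat.
  exact: ltnW (ltn_expl _ _).
elim: n y => [|n IHn] y.
  rewrite expr0 ler_norml => /andP[y1 y2].
  (* From exp (x/2) <= 1 / (1 - x/2), squared. The comparison with 1 + x + x^2 comes down to 1 - 3x
     + x^2 >= 0, which is where the bound 1/3 comes from. *)
  have small x : - (1 / 3) <= x <= 1 / 3 -> expR x <= 1 + x + x ^+ 2 :> R.
    move=> /andP[x1 x2].
    have e1 : 1 - x / 2 <= expR (- (x / 2)) by exact: expR_ge1Dx.
    have e2 : expR (x / 2) * (1 - x / 2) <= 1.
      have E : expR (x / 2) * expR (- (x / 2)) = 1 :> R by rewrite -expRD subrr expR0.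
      by rewrite -[leRHS]E ler_pM2l// expR_gt0.
    have ee : expR x = expR (x / 2) ^+ 2 by rewrite expr2 -expRD; congr expR; field.
    rewrite ee.
    have p0 := expR_gt0 (x / 2).
    set e := expR (x / 2) in e2 p0 *.
    have q0 : 0 < 1 - x / 2 by lra.
    have sq : (e * (1 - x / 2)) ^+ 2 <= 1.
      by rewrite expr_le1// mulr_ge0// ltW.
    rewrite -(@ler_pM2r _ ((1 - x / 2) ^+ 2)) ?exprn_gt0//.
    rewrite -exprMn; apply: (le_trans sq).
    have -> : (1 + x + x ^+ 2) * (1 - x / 2) ^+ 2 =
        1 + x ^+ 2 / 4 * (1 - 3 * x + x ^+ 2) by field.
    by rewrite lerDl mulr_ge0// ?divr_ge0 ?sqr_ge0//; nra.
  have := expR_ge1Dx (y ^+ 2).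
  have := small y; have := small (- y); rewrite sqrrN.
  by rewrite lerNl opprK lerNl; move=> /(_ _)/[!(y1,y2)]; lra.
move=> yn.
have yn2 : `|y / 2| <= 2 ^+ n / 3.
  by rewrite normrM (ger0_norm (x:=2^-1)) ?invr_ge0// ler_pdivrMr// mulrAC -exprSr.
have h := IHn _ yn2.
have e1 : expR y = expR (y / 2) ^+ 2 by rewrite expr2 -expRD; congr expR; field.
have e2 : expR (- y) = expR (- (y / 2)) ^+ 2.
  by rewrite expr2 -expRD; congr expR; field.
have e3 : expR (y ^+ 2) = expR ((y / 2) ^+ 2) ^+ 4.
  by rewrite -expRM_natl; congr expR; field.
have e4 : expR (y / 2) * expR (- (y / 2)) = 1 by rewrite -expRD subrr expR0.
have p1 := expR_gt0 (y / 2); have p2 := expR_gt0 (- (y / 2)).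
rewrite e1 e2 e3.
set a := expR (y / 2) in h e4 p1 *; set b := expR (- (y / 2)) in h e4 p2 *.
set c := expR ((y / 2) ^+ 2) in h *.
have : (a + b) ^+ 2 <= (2 * c) ^+ 2.
  by rewrite ler_pXn2r// ?nnegrE; [lra|lra].
have -> : a ^+ 2 + b ^+ 2 = (a + b) ^+ 2 - 2 by rewrite sqrrD; lra.
have : 0 <= (c ^+ 2 - 1) ^+ 2 by exact: sqr_ge0.
nra.
Qed.

(** A minorant of |y| whose mean needs only the second and fourth moments; it bounds first absolute
    moments of coordinates from below in [cap_lower_bound]. *)
Lemma sub_quartic_le_norm y : y ^+ 2 - y ^+ 4 / 6 <= `|y|.
Proof.
have -> : y ^+ 2 - y ^+ 4 / 6 = `|y| ^+ 2 - `|y| ^+ 4 / 6.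
  by rewrite (_ : 4%N = (2 * 2)%N)// !exprM real_normK ?num_real.
have : 0 <= `|y| by []. set x := `|y|; move=> x0.
have -> : x ^+ 2 - x ^+ 4 / 6 = x * (x - x ^+ 3 / 6) by field.
rewrite -[leRHS]mulr1 ler_wpM2l//.
have [x1|x1] := lerP x 1.
  by rewrite (le_trans _ x1)// gerBl divr_ge0 ?exprn_ge0.
(* This says that x - x^3 / 6 <= (9 - x) / 8, which is at most 1 for x >= 1. *)
have : 0 <= (x - 3 / 2) ^+ 2 * (x + 3) by rewrite mulr_ge0 ?sqr_ge0//; lra.
have -> : (x - 3 / 2) ^+ 2 * (x + 3) = x ^+ 3 - 27 / 4 * x + 27 / 4 by field.
lra.
Qed.

End RealBounds.

(** * Reflections mixing two coordinates *)

Section PlaneReflection.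
Context {R : realType} (d : nat) (i j : 'I_d) (a b : R).
Hypotheses (ij : i != j) (ab : a ^+ 2 + b ^+ 2 = 1).

(** The block with rows (a, b) and (b, -a) on the coordinates i and j. It is taken with determinant
    -1 because it is then a symmetric involution, which gives orthogonality at once; (a, b) = (0, 1)
    swaps the two coordinates. *)
Definition plane_refl (z : 'rV[R]_d) : 'rV[R]_d :=
  \row_k (if k == i then a * z 0 i + b * z 0 j
          else if k == j then b * z 0 i - a * z 0 j else z 0 k).

Definition plane_refl_mx : 'M[R]_d :=
  \matrix_(l, k) plane_refl (delta_mx 0 l) 0 k.

Lemma sum_delta (z : 'rV[R]_d) k :
  \sum_l z 0 l * (delta_mx 0 l : 'rV[R]_d) 0 k = z 0 k.
Proof.
rewrite (bigD1 k)//= mxE !eqxx mulr1 big1 ?addr0// => l lk.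
by rewrite mxE eqxx eq_sym (negbTE lk) mulr0.
Qed.

Lemma mulmx_plane_refl z : z *m plane_refl_mx = plane_refl z.
Proof.
apply/rowP => k; rewrite !mxE.
transitivity (\sum_l z 0 l * plane_refl (delta_mx 0 l) 0 k).
  by apply: eq_bigr => l _; rewrite !mxE.
rewrite -(sum_delta z i) -(sum_delta z j) -(sum_delta z k) !mulr_sumr -sumrB -big_split/=.
case: ifPn => [/eqP ->|ki].
  by apply: eq_bigr => l _; rewrite !mxE !eqxx; ring.
case: ifPn => [/eqP ->|kj].
  by apply: eq_bigr => l _; rewrite !mxE !eqxx (eq_sym j) (negbTE ij); ring.
by apply: eq_bigr => l _; rewrite !mxE (negbTE ki) (negbTE kj).
Qed.

Lemma plane_reflK z : plane_refl (plane_refl z) = z.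
Proof.
apply/rowP => k; rewrite !mxE !eqxx (eq_sym j) (negbTE ij).
have [->|ki] := eqVneq k i.
  transitivity ((a ^+ 2 + b ^+ 2) * z 0 i); first by ring.
  by rewrite ab mul1r.
have [->|//] := eqVneq k j.
transitivity ((a ^+ 2 + b ^+ 2) * z 0 j); first by ring.
by rewrite ab mul1r.
Qed.

Lemma plane_refl_mx_sym : plane_refl_mx^T = plane_refl_mx.
Proof.
apply/matrixP => l k; rewrite !mxE !eqxx /=.
have [->|li] := eqVneq l i; have [->|ki] := eqVneq k i; rewrite ?eqxx ?(negbTE ij) //=.
- by have [kj|kj] := eqVneq k j; rewrite ?(eq_sym j) ?(negbTE ij) /=; ring.
- by have [lj|lj] := eqVneq l j; rewrite ?(eq_sym j) ?(negbTE ij) ?(negbTE li) /=; ring.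
- by have [lj|lj] := eqVneq l j; have [kj|kj] := eqVneq k j;
    rewrite ?lj ?kj ?eqxx ?(negbTE lj) ?(negbTE kj) ?(eq_sym l k) /=; ring.
Qed.

Lemma plane_refl_orth : plane_refl_mx *m plane_refl_mx^T = 1%:M.
Proof.
rewrite plane_refl_mx_sym; apply/row_matrixP => l.
by rewrite !rowE mulmxA !mulmx_plane_refl plane_reflK mulmx1.
Qed.

End PlaneReflection.

(** * Measures of spherical caps *)

Section CapEstimates.
Context {R : realType} (d : nat) (mu : probability (@borel_rV R d) R).
Hypothesis hmu : uniform_on_sphere mu.
Local Notation cap := (cap mu).
Local Notation sE := (sE mu).
Hint Resolve tame_cst tameD tameM tameX tame_indic tame_coord measurable_cap : core.

Lemma sE_refl (f : @borel_rV R d -> R) i j a b : i != j -> a ^+ 2 + b ^+ 2 = 1 :> R -> tame f ->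
  sE (fun z => f (plane_refl i j a b z)) = sE f.
Proof.
move=> ij ab tf; rewrite -(sE_rot hmu (plane_refl_orth ij ab) tf).
by under [in RHS]eq_fun do rewrite mulmx_plane_refl//.
Qed.

Lemma tame_refl (f : @borel_rV R d -> R) i j a b : i != j -> a ^+ 2 + b ^+ 2 = 1 :> R -> tame f ->
  tame (fun z => f (plane_refl i j a b z)).
Proof.
move=> ij ab tf; have := tame_rot (plane_refl_orth ij ab) tf.
by under eq_fun do rewrite mulmx_plane_refl//.
Qed.

(** The 2^d sign vectors divided by sqrt d are unit vectors, so their caps all have measure
    [cap u t], which is thus the mean proportion of sign vectors whose cap contains z. For each
    fixed z that proportion is bounded by Chernoff's method over random signs, with cosh y <= exp
    (y^2) and |z| = 1. *)
Lemma cap_expR_le (u : 'rV[R]_d) t : dotv u u = 1 -> 0 <= t ->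
  cap u t <= expR (- (t ^+ 2 * d%:R / 4)).
Proof.
move=> u1 t0.
have d0 : 0 < d%:R :> R.
  rewrite ltr0n lt0n; apply/eqP => d0; move: u1.
  rewrite /dotv big1 => [/eqP|k _]; first by rewrite eq_sym oner_eq0.
  by have := ltn_ord k; rewrite [X in (_ < X)%N]d0.
pose r := Num.sqrt (d%:R : R).
have r0 : 0 < r by rewrite sqrtr_gt0.
have rr : r ^+ 2 = d%:R by rewrite sqr_sqrtr// ltW.
pose v (e : {ffun 'I_d -> bool}) : 'rV[R]_d := \row_k ((-1) ^+ e k / r).
have v1 e : dotv (v e) (v e) = 1.
  rewrite dotv_self; under eq_bigr do rewrite mxE exprMn sqrr_sign mul1r exprVn rr.
  by rewrite sumr_const card_ord -[_ *+ d]mulr_natr mulVf// gt_eqF.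
pose A e := [set z : @borel_rV R d | t <= dotv (v e) z].
have mA e : measurable (A e) by exact: measurable_cap.
(* The minimiser of l^2 - l t r, with minimum - t^2 d / 4. *)
pose l := t * r / 2.
pose K : R := (2 ^ d)%:R * expR (- (t ^+ 2 * d%:R / 4)).
have card2 : #|{ffun 'I_d -> bool}| = (2 ^ d)%N by rewrite card_ffun card_bool card_ord.
have -> : cap u t = (\sum_(e : {ffun 'I_d -> bool}) sE (\1_(A e))) / (2 ^ d)%:R.
  have E e : sE (\1_(A e)) = cap u t by rewrite (sE_indic hmu (mA e)); exact: cap_rot.
  under eq_bigr do rewrite E.
  by rewrite sumr_const card2 -[_ *+ _]mulr_natr mulfK// pnatr_eq0 expn_eq0.
rewrite ler_pdivrMr ?ltr0n ?expn_gt0// [leRHS]mulrC -/K.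
have tA e : tame (\1_(A e)) by exact: tame_indic.
rewrite -(sE_sum hmu)// -(sE_cst hmu K).
apply: sE_le; [exact: tame_sum|exact: tame_cst|].
move=> z z1.
have step e : (\1_(A e) z : R) <=
    expR (- (l * (t * r))) * \prod_k expR ((-1) ^+ e k * (l * z 0 k)).
  have -> : \prod_k expR ((-1) ^+ e k * (l * z 0 k)) = expR (l * r * dotv (v e) z).
    rewrite -expR_sum; congr expR; rewrite /dotv mulr_sumr.
    by apply: eq_bigr => k _; rewrite mxE; field; rewrite gt_eqF.
  rewrite -expRD indicE; case: (boolP (z \in A e)) => [|_]; last exact: expR_ge0.
  rewrite inE /A /= => tz; rewrite -[leLHS]expR0 ler_expR.
  have -> : - (l * (t * r)) + l * r * dotv (v e) z = l * r * (dotv (v e) z - t) by ring.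
  by rewrite !mulr_ge0 ?subr_ge0// ?(ltW r0)// /l !mulr_ge0// ltW.
apply: (le_trans (ler_sum _ (fun e _ => step e))).
rewrite -mulr_sumr.
rewrite -(bigA_distr_bigA (fun k (s : bool) => expR ((-1) ^+ s * (l * z 0 k)))) /=.
have le2 : \prod_(k < d) \sum_(s : bool) expR ((-1) ^+ s * (l * z 0 k)) <=
    \prod_(k < d) (2 * expR ((l * z 0 k) ^+ 2)).
  apply: ler_prod => k _; rewrite sumr_ge0 => [|s _]; last exact: expR_ge0.
  by rewrite big_bool/= expr1 expr0 mulN1r mul1r addrC expR_addN_le.
apply: (le_trans (ler_wpM2l (expR_ge0 _) le2)).
rewrite big_split/= prodr_const card_ord -expR_sum.
rewrite mulrCA /K natrX ler_wpM2l ?exprn_ge0// -expRD ler_expR.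
under eq_bigr do rewrite exprMn.
rewrite -mulr_sumr -dotv_self z1 mulr1 /l -rr.
by rewrite le_eqVlt; apply/orP; left; apply/eqP; field.
Qed.

End CapEstimates.

Section CapRatio.
Context {R : realType} (d : nat) (mu : probability (@borel_rV R d) R).
Hypothesis hmu : uniform_on_sphere mu.
Local Notation cap := (cap mu).
Local Notation sE := (sE mu).
Local Notation vec := (@borel_rV R d).

Lemma tame_coordX k m : tame (fun z : vec => z 0 k ^+ m).
Proof. by apply: tameX; exact: tame_coord. Qed.

(** Swapping coordinates other than i shows that the d - 1 means of g (z_i) z_k^2, for k != i, are
    equal, and the squares z_k^2 add up to at most 1. *)
Lemma sE_coord_slice (g : R -> R) (i j : 'I_d) : i != j -> (forall x, 0 <= g x) ->
  tame (fun z : vec => g (z 0 i)) ->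
  (d.-1)%:R * sE (fun z => g (z 0 i) * z 0 j ^+ 2) <= sE (fun z => g (z 0 i)).
Proof.
move=> ij g0 tg.
have tgk k : tame (fun z : vec => g (z 0 i) * z 0 k ^+ 2).
  by apply: tameM => //; exact: tame_coordX.
have Ek k : k != i ->
    sE (fun z => g (z 0 i) * z 0 k ^+ 2) = sE (fun z => g (z 0 i) * z 0 j ^+ 2).
  have [->//|kj ki] := eqVneq k j.
  have jk : j != k by rewrite eq_sym.
  have e1 : 0 ^+ 2 + 1 ^+ 2 = 1 :> R by rewrite expr0n/= add0r expr1n.
  rewrite -(sE_refl hmu jk e1 (tgk j)); apply: sE_eq => z _.
  by rewrite !mxE eqxx (negbTE ij) eq_sym (negbTE ki) mul0r add0r mul1r.
have -> : (d.-1)%:R * sE (fun z => g (z 0 i) * z 0 j ^+ 2) =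
    \sum_(k | k != i) sE (fun z => g (z 0 i) * z 0 k ^+ 2).
  rewrite (eq_bigr _ Ek) sumr_const -[RHS]mulr_natl; congr (_%:R * _).
  by rewrite (cardC1 i) card_ord.
rewrite -(sE_sum hmu)//; apply: sE_le => //; first exact: tame_sum.
move=> z z1; rewrite -mulr_sumr -[leRHS]mulr1 ler_wpM2l//.
by rewrite -z1 dotv_self [leRHS](bigD1 i)//= lerDr sqr_ge0.
Qed.

Lemma delta_unit (k : 'I_d) : dotv (delta_mx 0 k) (delta_mx 0 k) = 1 :> R.
Proof. by rewrite dotv_delta mxE !eqxx. Qed.

(* Rotating by the angle with cosine 4/5, the cap of height 4t/3 around a
   vector is, up to a slice where some coordinate orthogonal to the vector
   exceeds t/9, contained in the part of the cap of height t where an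
   orthogonal coordinate exceeds t/2. *)
Lemma cap_four_thirds (u : 'rV[R]_d) t : dotv u u = 1 -> 0 < t -> (1 < d)%N ->
  (1 - 81 / (t ^+ 2 * d.-1%:R)) * cap u (4 / 3 * t) <=
  4 / (t ^+ 2 * d.-1%:R) * cap u t.
Proof.
move=> u1 t0 d1.
have [i [j ij]] : exists i j : 'I_d, i != j.
  by exists (Ordinal (ltnW d1)), (Ordinal d1).
have D0 : 0 < d.-1%:R :> R by rewrite ltr0n -ltnS prednK// ltnW.
rewrite !(cap_rot hmu _ u1 (delta_unit i)).
pose A s := [set z : vec | s <= dotv (delta_mx 0 i) z].
have mA s : measurable (A s) by exact: measurable_cap.
have tA s : tame (\1_(A s)) by exact: tame_indic.
have AE s (z : vec) : \1_(A s) z = (s <= z 0 i)%R%:R :> R.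
  by rewrite indicE; congr ((nat_of_bool _)%:R); apply/idP/idP; rewrite inE /A /= dotv_delta.
have cE s : cap (delta_mx 0 i) s = sE (\1_(A s)) by rewrite (sE_indic hmu).
have slice s : d.-1%:R * sE (fun z => \1_(A s) z * z 0 j ^+ 2) <= sE (\1_(A s)).
  have := sE_coord_slice (g := fun x => (s <= x)%R%:R) ij _ _.
  have E : (fun z : vec => (s <= z 0 i)%R%:R) = \1_(A s) :> (vec -> R).
    by apply/funext => z; rewrite AE.
  rewrite E; under eq_fun do rewrite -AE.
  by apply.
have ab : (4 / 5) ^+ 2 + (3 / 5) ^+ 2 = 1 :> R by field.
have tj : tame (fun z : vec => \1_(A t) z * z 0 j ^+ 2).
  by apply: tameM => //; exact: tame_coordX.
have tj' : tame (fun z : vec => \1_(A (4 / 3 * t)) z * z 0 j ^+ 2).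
  by apply: tameM => //; exact: tame_coordX.
(* Pointwise: if |b| >= t/9, the first term is at least 1. Otherwise the reflected point has i-th
   coordinate at least 16t/15 - t/15 = t and j-th coordinate at least 4t/5 - 4t/45 > t/2, so the
   second term is at least 1. *)
have key : sE (\1_(A (4 / 3 * t))) <=
    81 / t ^+ 2 * sE (fun z => \1_(A (4 / 3 * t)) z * z 0 j ^+ 2) +
    4 / t ^+ 2 * sE (fun z => \1_(A t) z * z 0 j ^+ 2).
  have tr := tame_refl ij ab tj.
  rewrite -(sE_refl hmu ij ab tj) -(sEZ mu _ tj') -(sEZ mu _ tr).
  rewrite -(sED mu); last 2 first.
  - by apply: tameM => //; exact: tame_cst.
  - by apply: tameM => //; exact: tame_cst.
  apply: sE_le => //.
    by apply: tameD; (apply: tameM; [exact: tame_cst|]).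
  move=> z _; rewrite !AE !mxE !eqxx (eq_sym j) (negbTE ij).
  set a := z 0 i; set b := z 0 j.
  have h1 : 0 <= 81 / t ^+ 2 * ((4 / 3 * t <= a)%R%:R * b ^+ 2).
    apply: mulr_ge0; [by rewrite divr_ge0 ?sqr_ge0|apply: mulr_ge0; [exact: ler0n|exact: sqr_ge0]].
  have h2 : 0 <= 4 / t ^+ 2 * ((t <= 4 / 5 * a + 3 / 5 * b)%R%:R *
     (3 / 5 * a - 4 / 5 * b) ^+ 2).
    apply: mulr_ge0; [by rewrite divr_ge0 ?sqr_ge0|apply: mulr_ge0; [exact: ler0n|exact: sqr_ge0]].
  have [ta|_] := boolP (4 / 3 * t <= a); last first.
    by rewrite addr_ge0// mul0r mulr0.
  rewrite mul1r; have [tb|bt] := lerP (t / 9) `|b|.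
    apply: ler_wpDr => //.
    rewrite mulrAC ler_pdivlMr ?exprn_gt0// mul1r.
    have : (t / 9) ^+ 2 <= `|b| ^+ 2 by rewrite ler_pXn2r// nnegrE// divr_ge0// ltW.
    by rewrite real_normK ?num_real//; lra.
  apply: ler_wpDl; first by rewrite mulr_ge0 ?divr_ge0 ?sqr_ge0.
  move: bt; rewrite ltr_norml => /andP[b1 b2].
  have -> : t <= 4 / 5 * a + 3 / 5 * b by lra.
  rewrite mul1r mulrAC ler_pdivlMr ?exprn_gt0// mul1r.
  have : (t / 2) ^+ 2 <= (3 / 5 * a - 4 / 5 * b) ^+ 2.
    by rewrite ler_pXn2r ?nnegrE//; lra.
  by lra.
rewrite !cE.
have s1 := slice (4 / 3 * t); have s2 := slice t.
set X := sE _ in key s1 *; set Y := sE _ in key s1 *.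
set Z := sE _ in key s2 *; set W := sE _ in s2 *.
have s1' : Y <= X / d.-1%:R by rewrite ler_pdivlMr// mulrC.
have s2' : Z <= W / d.-1%:R by rewrite ler_pdivlMr// mulrC.
have T2 : 0 < t ^+ 2 by rewrite exprn_gt0.
have k1 : 81 / t ^+ 2 * Y <= 81 / (t ^+ 2 * d.-1%:R) * X.
  have -> : 81 / (t ^+ 2 * d.-1%:R) * X = 81 / t ^+ 2 * (X / d.-1%:R).
    by field; rewrite (gt_eqF D0) (gt_eqF t0).
  by rewrite ler_wpM2l// divr_ge0// ltW.
have k2 : 4 / t ^+ 2 * Z <= 4 / (t ^+ 2 * d.-1%:R) * W.
  have -> : 4 / (t ^+ 2 * d.-1%:R) * W = 4 / t ^+ 2 * (W / d.-1%:R).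
    by field; rewrite (gt_eqF D0) (gt_eqF t0).
  by rewrite ler_wpM2l// divr_ge0// ltW.
rewrite mulrBl mul1r lerBlDl; apply: (le_trans key); exact: lerD.
Qed.

Lemma sE_coord2 (i : 'I_d) : sE (fun z => z 0 i ^+ 2) = d%:R^-1.
Proof.
have E k : sE (fun z => z 0 k ^+ 2) = sE (fun z => z 0 i ^+ 2).
  have [->//|ki] := eqVneq k i; have ik : i != k by rewrite eq_sym.
  have e1 : 0 ^+ 2 + 1 ^+ 2 = 1 :> R by rewrite expr0n/= add0r expr1n.
  rewrite -(sE_refl hmu ik e1 (tame_coordX i 2)); apply: sE_eq => z _.
  by rewrite !mxE eqxx mul0r add0r mul1r.
have d0 : d%:R != 0 :> R.
  by rewrite pnatr_eq0 -lt0n; exact: leq_ltn_trans (leq0n _) (ltn_ord i).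
apply: (mulfI d0); rewrite divff//.
transitivity (\sum_k sE (fun z => z 0 k ^+ 2)).
  by rewrite (eq_bigr _ (fun k _ => E k)) sumr_const card_ord mulr_natl.
rewrite -(sE_sum hmu) => [|k]; last exact: tame_coordX.
by rewrite -[RHS](sE_cst hmu 1); apply: sE_eq => z; rewrite dotv_self.
Qed.

(** The reflection with a = b = 1 / sqrt 2 turns z_i^4 + z_j^4 into ((z_i + z_j)^4 + (z_i - z_j)^4)
    / 4. Equating the means shows that the fourth moment is three times the mean of z_i^2 z_j^2, to
    which [sE_coord_slice] applies. *)
Lemma sE_coord4_le (i : 'I_d) : (1 < d)%N ->
  sE (fun z => z 0 i ^+ 4) <= 3 / (d%:R * d.-1%:R).
Proof.
move=> d1.
have [j ij] : exists j : 'I_d, i != j.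
  have [i0|i0] := eqVneq i (Ordinal (ltnW d1)); last by exists (Ordinal (ltnW d1)).
  by exists (Ordinal d1); rewrite i0.
have D0 : 0 < d.-1%:R :> R by rewrite ltr0n -ltnS prednK// ltnW.
pose r : R := Num.sqrt (1 / 2).
have rr : r ^+ 2 = 1 / 2 by rewrite sqr_sqrtr.
have ab : r ^+ 2 + r ^+ 2 = 1 by rewrite rr; field.
have t4 k := tame_coordX k 4.
have t22 : tame (fun z : vec => z 0 i ^+ 2 * z 0 j ^+ 2).
  by apply: tameM; exact: tame_coordX.
have E4 : sE (fun z => z 0 j ^+ 4) = sE (fun z => z 0 i ^+ 4).
  have e1 : 0 ^+ 2 + 1 ^+ 2 = 1 :> R by rewrite expr0n/= add0r expr1n.
  rewrite -(sE_refl hmu ij e1 (t4 i)); apply: sE_eq => z _.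
  by rewrite !mxE eqxx mul0r add0r mul1r.
have m4 : sE (fun z => z 0 i ^+ 4) = 3 * sE (fun z => z 0 i ^+ 2 * z 0 j ^+ 2).
  have : sE (fun z => z 0 i ^+ 4) + sE (fun z => z 0 j ^+ 4) =
      1 / 2 * sE (fun z => z 0 i ^+ 4) + (1 / 2 * sE (fun z => z 0 j ^+ 4) +
      3 * sE (fun z => z 0 i ^+ 2 * z 0 j ^+ 2)).
    have tt c k : tame (fun z : vec => c * z 0 k ^+ 4).
      by apply: tameM => //; exact: tame_cst.
    have tt2 : tame (fun z : vec => 3 * (z 0 i ^+ 2 * z 0 j ^+ 2)).
      by apply: tameM => //; exact: tame_cst.
    rewrite -!(sEZ mu)// -!(sED mu)//; last exact: tameD.
    have tD : tame (fun z : vec => z 0 i ^+ 4 + z 0 j ^+ 4) by exact: tameD.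
    rewrite -[LHS](sE_refl hmu ij ab tD).
    apply: sE_eq => z _; rewrite !mxE !eqxx (eq_sym j) (negbTE ij).
    set a := z 0 i; set b := z 0 j.
    have -> : (r * a + r * b) ^+ 4 + (r * a - r * b) ^+ 4 =
        (r ^+ 2) ^+ 2 * ((a + b) ^+ 4 + (a - b) ^+ 4) by ring.
    by rewrite rr; field.
  by rewrite E4; lra.
rewrite m4 invfM ler_pM2l// -(sE_coord2 i) ler_pdivlMr// mulrC.
apply: (sE_coord_slice (g := fun x => x ^+ 2)) => //.
- by move=> x; exact: sqr_ge0.
- exact: tame_coordX.
Qed.

End CapRatio.

Section CapLowerBound.
Context {R : realType} (d : nat) (mu : probability (@borel_rV R d) R).
Hypothesis hmu : uniform_on_sphere mu.
Local Notation cap := (cap mu).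
Local Notation sE := (sE mu).
Local Notation vec := (@borel_rV R d).

(** Since p tends to 0, for each fixed k this forces [tau] above sqrt (k / d) / 8, whence tau sqrt d
    tends to infinity. The 2^k sign vectors on the first k coordinates, divided by sqrt k, have a
    best inner product with z equal to (sum of the |z_i|) / sqrt k. Their caps therefore cover the
    event that this sum is at least k / (8 sqrt d), and the moments of orders 2 and 4 show that the
    event is not rare. *)
Lemma cap_lower_bound (u : 'rV[R]_d) k : dotv u u = 1 -> (0 < k)%N -> (k <= d)%N ->
  (2 < d)%N ->
  1 / (64 * 2 ^+ k) <= cap u (Num.sqrt (k%:R / d%:R) / 8).
Proof.
move=> u1 k0 kd d2.
have K0 : 0 < k%:R :> R by rewrite ltr0n.
have D0 : 0 < d%:R :> R by rewrite ltr0n (ltn_trans _ d2).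
have D1 : 0 < d.-1%:R :> R by rewrite ltr0n -ltnS prednK ?(ltn_trans _ d2).
pose w := widen_ord kd.
have wE i i' : (w i == w i') = (i == i').
  by apply/eqP/eqP => [/(congr1 val) /= /val_inj|->].
pose rk : R := Num.sqrt k%:R; pose rd : R := Num.sqrt d%:R.
have rk0 : 0 < rk by rewrite sqrtr_gt0.
have rd0 : 0 < rd by rewrite sqrtr_gt0.
have rk2 : rk ^+ 2 = k%:R by rewrite sqr_sqrtr// ltW.
have rd2 : rd ^+ 2 = d%:R by rewrite sqr_sqrtr// ltW.
set t := Num.sqrt _ / 8.
have tE : t = rk / rd / 8 by rewrite /t sqrtrM ?ler0n// sqrtrV ?ler0n.
pose v (e : {ffun 'I_k -> bool}) : 'rV[R]_d :=
  \sum_(i < k) ((-1) ^+ e i / rk) *: delta_mx 0 (w i).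
have dotvE e z : dotv (v e) z = \sum_(i < k) (-1) ^+ e i / rk * z 0 (w i).
  rewrite /v; elim/big_rec2: _ => [|i x y _ <-].
    by rewrite -(scale0r (delta_mx 0 (Ordinal (ltn_trans (ltn0Sn _) d2)))) dotvZl mul0r.
  by rewrite dotvDl dotvZl dotv_delta.
have v1 e : dotv (v e) (v e) = 1.
  rewrite dotvE.
  have vw i : v e 0 (w i) = (-1) ^+ e i / rk.
    rewrite /v summxE (bigD1 i)//= mxE mxE !eqxx mulr1 big1 ?addr0// => i' i'i.
    by rewrite mxE mxE eqxx /= eq_sym wE (negbTE i'i) mulr0.
  under eq_bigr do rewrite vw -expr2 exprMn sqrr_sign mul1r exprVn rk2.
  by rewrite sumr_const card_ord -[_ *+ k]mulr_natr mulVf// gt_eqF.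
pose A e := [set z : vec | t <= dotv (v e) z].
have mA e : measurable (A e) by exact: measurable_cap.
have tA e : tame (\1_(A e)) by exact: tame_indic.
have AE e : sE (\1_(A e)) = cap u t.
  by rewrite (sE_indic hmu (mA e)); exact: cap_rot.
have tc m i : tame (fun z : vec => z 0 (w i) ^+ m) by exact: tame_coordX.
have tcc (c : R) m i : tame (fun z : vec => c * z 0 (w i) ^+ m).
  by apply: tameM => //; exact: tame_cst.
pose L (z : vec) : R := \sum_(i < k) (15 / 16 * d%:R) * z 0 (w i) ^+ 2.
pose Q (z : vec) : R := \sum_(i < k) (d%:R ^+ 2 / 6) * z 0 (w i) ^+ 4.
pose N (z : vec) : R := \sum_(e : {ffun 'I_k -> bool}) \1_(A e) z.
have tL : tame L by exact: tame_sum.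
have tQ : tame Q by exact: tame_sum.
have tN : tame N by exact: tame_sum.
have t4N : tame (fun z => 4 * k%:R * N z) by apply: tameM => //; exact: tame_cst.
(* [N z] counts the caps that contain z. By [sub_quartic_le_norm], L - Q is at most the sum of |y_i|
   - y_i^2 / 16. This is below k/8 when W is, and never exceeds 4k, as |y| <= y^2 / 16 + 4; the
   latter bound is used when some cap contains z. *)
have pointwise z : L z <= Q z + (k%:R / 8 + 4 * k%:R * N z).
  have N0 : 0 <= N z by rewrite sumr_ge0// => e _; rewrite indicE.
  pose y i : R := rd * z 0 (w i).
  pose W := \sum_(i < k) `|y i|.
  have LE : L z = \sum_(i < k) (y i ^+ 2 - y i ^+ 2 / 16).
    by apply: eq_bigr => i _; rewrite /y exprMn rd2; field.
  have QE : Q z = \sum_(i < k) y i ^+ 4 / 6.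
    by apply: eq_bigr => i _; rewrite /y exprMn (exprM rd 2 2) rd2; field.
  have W0 : 0 <= W by exact: sumr_ge0.
  have h1 : L z - Q z <= W - \sum_(i < k) y i ^+ 2 / 16.
    rewrite LE QE -!sumrB; apply: ler_sum => i _.
    by have := sub_quartic_le_norm (y i); lra.
  have h2 : W <= \sum_(i < k) y i ^+ 2 / 16 + 4 * k%:R.
    have -> : 4 * k%:R = \sum_(i < k) 4 :> R.
      by rewrite sumr_const card_ord mulr_natr.
    rewrite -big_split/=; apply: ler_sum => i _.
    have : 0 <= (`|y i| - 8) ^+ 2 by exact: sqr_ge0.
    by rewrite sqrrB real_normK ?num_real//; lra.
  have h3 : 0 <= \sum_(i < k) y i ^+ 2 / 16.
    by apply: sumr_ge0 => i _; rewrite divr_ge0// sqr_ge0.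
  have [Wk|Wk] := ltrP W (k%:R / 8).
    by have := mulr_ge0 (mulr_ge0 (ler0n R 4) (ler0n R k)) N0; lra.
  suff N1 : 1 <= N z.
    have : 4 * k%:R * 1 <= 4 * k%:R * N z by rewrite ler_wpM2l// mulr_ge0.
    by lra.
  pose e := [ffun i => z 0 (w i) < 0].
  have dv : dotv (v e) z = W / (rd * rk).
    rewrite dotvE /W mulr_suml; apply: eq_bigr => i _.
    rewrite /y normrM (gtr0_norm rd0) ffunE.
    have -> : `|z 0 (w i)| = (-1) ^+ (z 0 (w i) < 0)%R * z 0 (w i).
      by case: ltrP => z0; [rewrite expr1 mulN1r ltr0_norm|rewrite expr0 mul1r ger0_norm].
    by field; rewrite (gt_eqF rd0) (gt_eqF rk0).
  have Aez : z \in A e.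
    rewrite inE /A /= dv tE ler_pdivlMr ?mulr_gt0//.
    apply: le_trans Wk; rewrite -rk2 le_eqVlt; apply/orP; left; apply/eqP.
    by field; rewrite gt_eqF.
  rewrite /N (bigD1 e)//= indicE Aez lerDl.
  by apply: sumr_ge0 => e' _; rewrite indicE.
have int : sE L <= sE Q + (k%:R / 8 + 4 * k%:R * (2 ^+ k * cap u t)).
  have EN : sE N = 2 ^+ k * cap u t.
    rewrite /N (sE_sum hmu)// (eq_bigr _ (fun e _ => AE e)) sumr_const.
    by rewrite card_ffun card_bool card_ord -[LHS]mulr_natl natrX.
  have tt : tame (fun z => k%:R / 8 + 4 * k%:R * N z).
    by apply: tameD => //; exact: tame_cst.
  rewrite -EN -(sEZ mu _ tN) -[in leRHS](sE_cst hmu (k%:R / 8)).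
  rewrite -(sED mu (tame_cst _ _) t4N) -(sED mu tQ tt).
  by apply: sE_le => //; exact: tameD.
have EL : sE L = 15 / 16 * k%:R.
  rewrite /L (sE_sum hmu) => [|i]; last exact: tcc.
  under eq_bigr => i _ do rewrite (sEZ mu _ (tc 2 i)) (sE_coord2 hmu).
  rewrite sumr_const card_ord -[LHS]mulr_natl; field.
  by rewrite gt_eqF.
have EQ : sE Q <= 3 / 4 * k%:R.
  rewrite /Q (sE_sum hmu) => [|i]; last exact: tcc.
  have -> : 3 / 4 * k%:R = \sum_(i < k) 3 / 4 :> R.
    by rewrite sumr_const card_ord mulr_natr.
  apply: ler_sum => i _; rewrite (sEZ mu _ (tc 4 i)).
  have c0 : 0 <= d%:R ^+ 2 / 6 :> R by rewrite divr_ge0// exprn_ge0// ltW.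
  apply: (le_trans (ler_wpM2l c0 (sE_coord4_le hmu (w i) (ltnW d2)))).
  have -> : d%:R ^+ 2 / 6 * (3 / (d%:R * d.-1%:R)) = d%:R / (2 * d.-1%:R) :> R.
    by field; rewrite !gt_eqF.
  rewrite ler_pdivrMr ?mulr_gt0//.
  have -> : d%:R = d.-1%:R + 1 :> R by rewrite natr1 prednK //; exact: ltnW (ltnW d2).
  have : 2 <= d.-1%:R :> R by rewrite ler_nat -ltnS prednK //; exact: ltnW (ltnW d2).
  by lra.
rewrite ler_pdivrMr ?mulr_gt0 ?exprn_gt0//.
(* 15/16 - 3/4 - 1/8 = 1/16, from the means of L and Q and the constant k/8. *)
have h : k%:R * (1 / 16) <= k%:R * (4 * (2 ^+ k * cap u t)) by rewrite EL in int; lra.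
rewrite ler_pM2l// in h; lra.
Qed.

End CapLowerBound.

(** * Trees in the spherical graph *)

Section Forest.
Context (V0 : eqType).

(* A forest on the vertices V with edges E, grown by adding isolated vertices and
   leaves; every edge is listed as (parent, child). *)
Inductive forest : seq (V0 * V0) -> seq V0 -> Prop :=
| forest_nil : forest [::] [::]
| forest_root E V y : forest E V -> y \notin V -> forest E (y :: V)
| forest_edge E V x y : forest E V -> x \in V -> y \notin V ->
    forest ((x, y) :: E) (y :: V).

Lemma forest_mem E V a b : forest E V -> (a, b) \in E ->
  [/\ a \in V, b \in V & a != b].
Proof.
elim=> {E V} // E V => [y _ IH yV /IH[aV bV ab]|x y _ IH xV yV].
  by rewrite !inE aV bV !orbT.
rewrite in_cons => /predU1P[[-> ->]|/IH[aV bV ab]].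
  by rewrite !inE eqxx xV !orbT; split => //; apply: contraNneq yV => <-.
by rewrite !inE aV bV !orbT.
Qed.

End Forest.

Section SphericalForest.
Context {R : realType} (disp : measure_display) (T : measurableType disp)
  (P : probability T R) (d n : nat) (X : 'I_n -> {RV P >-> @borel_rV R d}).
Hypothesis hX : iid_uniform_on_sphere X.
Variables (u0 : 'rV[R]_d) (tau p : R).
Hypotheses (u01 : dotv u0 u0 = 1) (htau : is_threshold X p tau).
Local Notation Phi v t := (cap (distribution P (X v)) u0 t).

Definition near_ev (t : R) (i j : 'I_n) : set T :=
  [set w | t <= dotv (X i w) (X j w)].

Definition edges_ev (E : seq ('I_n * 'I_n)) : set T :=
  [set w | forall e, e \in E -> tau <= dotv (X e.1 w) (X e.2 w)].

Lemma near_evC t i j : near_ev t i j = near_ev t j i.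
Proof. by apply/seteqP; split => w; rewrite /near_ev /= dotvC. Qed.

Lemma edges_ev_cons x y E : edges_ev ((x, y) :: E) = edges_ev E `&` near_ev tau x y.
Proof.
apply/seteqP; split => w /=.
  move=> H; split; first by move=> e eE; apply: H; rewrite inE eE orbT.
  by apply: (H (x, y)); rewrite mem_head.
by move=> [H xy] e; rewrite inE => /predU1P[->|/H].
Qed.

Lemma near_ev_off v t i j : i != v -> j != v ->
  <<s cylinders_off X v >> (near_ev t i j).
Proof.
move=> iv jv.
exact: (@measurable_le_dotv _ _ (off_type X v) _ _ _ t
  (measurable_off iv) (measurable_off jv)).
Qed.

Lemma edges_ev_off v E : (forall a b, (a, b) \in E -> a != v /\ b != v) ->
  <<s cylinders_off X v >> (edges_ev E).
Proof.
elim: E => [|[x y] E IH] H.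
  rewrite (_ : edges_ev [::] = setT); last by apply/seteqP; split.
  exact: (@measurableT _ (off_type X v)).
rewrite edges_ev_cons.
have [xv yv] : x != v /\ y != v by apply: H; rewrite mem_head.
apply: (@measurableI _ (off_type X v)); last exact: near_ev_off.
by apply: IH => a b abE; apply: H; rewrite inE abE orbT.
Qed.

Lemma measurable_near_ev t i j : measurable (near_ev t i j).
Proof. by apply: measurable_le_dotv; exact: measurable_funP. Qed.

Lemma measurable_edges_ev E : measurable (edges_ev E).
Proof.
elim: E => [|[x y] E IH].
  by rewrite (_ : edges_ev [::] = setT)//; apply/seteqP; split.
by rewrite edges_ev_cons; apply: measurableI => //; exact: measurable_near_ev.
Qed.

Definition pr (A : set T) : R := fine (P A).

Lemma pr_le A B : measurable A -> measurable B -> A `<=` B -> pr A <= pr B.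
Proof.
move=> mA mB AB; rewrite /pr fine_le ?fin_num_measure// le_measure ?inE//.
Qed.

(** [cap_rot] needs unit vectors, but the points lie on the sphere only almost surely. Conditional
    probabilities are computed on this event, which has probability 1 and involves only the points
    other than v. *)
Definition sphere_off v : set T := [set w | forall i, i != v -> unit_sphere (X i w)].

Lemma sphere_off_off v : <<s cylinders_off X v >> (sphere_off v).
Proof.
have -> : sphere_off v =
    \bigcap_(i in [set i : 'I_n | i != v]) (X i @^-1` (@unit_sphere R d)).
  by apply/seteqP; split.
apply: (@fin_bigcap_measurable _ (off_type X v)) => // i iv.
have := measurable_off (X := X) iv measurableT (@measurable_unit_sphere R d).
by rewrite setTI.
Qed.

Lemma probability_setI1 (A B : set T) : measurable A -> measurable B ->
  P B = 1%E -> P (A `&` B) = P A.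
Proof.
move=> mA mB B1.
have BC0 : P (~` B) = 0%E by rewrite probability_setC// B1 subee.
apply/eqP; rewrite eq_le le_measure ?inE//=; last exact: measurableI.
rewrite -[X in (P X <= _)%E](setUIDK A B).
apply: (le_trans (measureU2 _ (measurableI _ _ mA mB) (measurableD mA mB))).
have sD : P (A `\` B) = 0%E.
  apply/eqP; rewrite eq_le measure_ge0 andbT -BC0 le_measure ?inE//.
  - exact: measurableD.
  - exact: measurableC.
by rewrite [X in (_ + X)%E]sD adde0.
Qed.

Lemma sphere_off1 v : P (sphere_off v) = 1%E.
Proof.
pose B (i : 'I_n) := if i == v then setT else @unit_sphere R d.
have mB i : measurable (B i).
  by rewrite /B; case: (i == v) => //; exact: measurable_unit_sphere.
transitivity (P [set w | forall i, B i (X i w)]).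
  congr (P _); apply/seteqP; split => w /= H i.
    by rewrite /B; case: eqP => // /eqP; exact: H.
  by move=> /negbTE iv; have := H i; rewrite /B iv.
apply: etrans (hX.1 B mB) _; rewrite big1// => i _; rewrite /B; case: (i == v).
  by rewrite preimage_setT probability_setT.
exact: (hX.2 i).1.
Qed.

Lemma measurable_proj_off v x : x != v ->
  measurable_fun setT (fun wz : off_type X v * @borel_rV R d =>
    X x wz.1 : @borel_rV R d).
Proof.
move=> xv.
have h := @measurable_fst _ _ (off_type X v) (@borel_rV R d).
have h2 := measurable_off (X := X) xv.
exact (measurableT_comp h2 h).
Qed.

(** Given the other points, [X v] falls in the cap of height t around [X x] with a probability that
    does not depend on where [X x] is. *)
Lemma attach_edge v x t S : x != v -> <<s cylinders_off X v >> S ->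
  pr (S `&` near_ev t x v) = Phi v t * pr S.
Proof.
move=> xv mS.
have mS' := sigma_cylinders_off_measurable mS.
have mO := sigma_cylinders_off_measurable (@sphere_off_off v).
pose Q := [set wz : off_type X v * @borel_rV R d | t <= dotv (X x wz.1) wz.2].
have mQ : measurable Q.
  have mf := measurable_proj_off xv.
  exact: (measurable_le_dotv t mf measurable_snd).
have SO : <<s cylinders_off X v >> (S `&` sphere_off v).
  by apply: (@measurableI _ (off_type X v)) => //; exact: sphere_off_off.
have := fubini_off_eq hX.1 (c := Phi v t) SO mQ.
have -> : (S `&` sphere_off v) `&` [set w | Q (w, X v w)] =
    (S `&` near_ev t x v) `&` sphere_off v by rewrite setIAC.
have mSn : measurable (S `&` near_ev t x v).
  by apply: measurableI => //; exact: measurable_near_ev.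
rewrite (probability_setI1 mSn mO (sphere_off1 v)).
rewrite (probability_setI1 mS' mO (sphere_off1 v)) => H.
rewrite /pr H ?fineM ?fin_num_measure//.
move=> w [_ Ow].
have Xx1 : dotv (X x w) (X x w) = 1 by exact: Ow.
rewrite -(cap_rot (hX.2 v) t Xx1 u01) /cap fineK.
  by congr (distribution P (X v) _); apply/seteqP; split => z; rewrite /xsection /= inE.
by rewrite fin_num_measure//; exact: measurable_cap.
Qed.

(** For unit vectors a, b with <a, b> <= 1/8 one has |a + b|^2 <= 2 + 2/8 = (3/2)^2. A point of both
    caps has product at least 2 tau with a + b, hence at least 2 tau / (3/2) = 4 tau / 3 with its
    normalisation. *)
Lemma attach_two_edges v x y S : x != v -> y != v -> 0 < tau ->
  <<s cylinders_off X v >> S -> S `<=` [set w | dotv (X x w) (X y w) <= 1 / 8] ->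
  pr (S `&` near_ev tau x v `&` near_ev tau y v) <= Phi v (4 / 3 * tau) * pr S.
Proof.
move=> xv yv tau0 mS Sxy.
have mS' := sigma_cylinders_off_measurable mS.
have mO := sigma_cylinders_off_measurable (@sphere_off_off v).
pose Q := [set wz : off_type X v * @borel_rV R d | tau <= dotv (X x wz.1) wz.2] `&`
  [set wz : off_type X v * @borel_rV R d | tau <= dotv (X y wz.1) wz.2].
have mQ : measurable Q.
  apply: measurableI.
    exact: (measurable_le_dotv tau (measurable_proj_off xv) measurable_snd).
  exact: (measurable_le_dotv tau (measurable_proj_off yv) measurable_snd).
have SO : <<s cylinders_off X v >> (S `&` sphere_off v).
  by apply: (@measurableI _ (off_type X v)) => //; exact: sphere_off_off.
have := fubini_off_le hX.1 SO mQ
  (cap_ge0 (distribution P (X v)) u0 (4 / 3 * tau)).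
have -> : (S `&` sphere_off v) `&` [set w | Q (w, X v w)] =
    (S `&` near_ev tau x v `&` near_ev tau y v) `&` sphere_off v.
  by rewrite setIAC -!setIA.
have mSS : measurable (S `&` near_ev tau x v `&` near_ev tau y v).
  by do 2?[apply: measurableI => //]; exact: measurable_near_ev.
rewrite (probability_setI1 mSS mO (sphere_off1 v)).
rewrite (probability_setI1 mS' mO (sphere_off1 v)).
move=> H; rewrite /pr -lee_fin EFinM [leLHS]fineK ?fin_num_measure//.
rewrite [X in (_ * X)%E]fineK ?fin_num_measure//; apply: H.
move=> w [Sw Ow].
have x1 : dotv (X x w) (X x w) = 1 by exact: Ow.
have y1 : dotv (X y w) (X y w) = 1 by exact: Ow.
have xy8 := Sxy _ Sw; rewrite /= in xy8.
have mQw : measurable (xsection Q w) by exact: measurable_xsection.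
have QwE z : xsection Q w z -> tau <= dotv (X x w) z /\ tau <= dotv (X y w) z.
  by rewrite /xsection /= inE.
pose s := dotv (X x w) (X y w).
have n2 : dotv (X x w + X y w) (X x w + X y w) = 2 + 2 * s.
  by rewrite !(dotvDl, dotvDr) x1 y1 (dotvC (X y w)) /s; ring.
(* Antipodal points have no bisector, but then no z has product at least tau > 0 with both. *)
have [n0|n0] := eqVneq (dotv (X x w + X y w) (X x w + X y w)) 0.
  rewrite (_ : xsection Q w = set0) ?measure0 ?lee_fin ?cap_ge0//.
  apply/seteqP; split => z // /QwE [h1 h2].
  move/eqP: n0; rewrite dotv_eq0 => /eqP n0.
  have : dotv (X x w) z + dotv (X y w) z = 0.
    by rewrite -dotvDl n0 -(scale0r (X x w)) dotvZl mul0r.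
  by lra.
pose r := Num.sqrt (2 + 2 * s).
have npos : 0 < 2 + 2 * s by rewrite -n2 lt_neqAle eq_sym n0 dotv_ge0.
have r0 : 0 < r by rewrite sqrtr_gt0.
have rr : r ^+ 2 = 2 + 2 * s by rewrite sqr_sqrtr// ltW.
have r32 : r <= 3 / 2.
  rewrite -(@ler_pXn2r _ 2)// ?nnegrE ?(ltW r0)// rr.
  by move: xy8; rewrite -/s; lra.
pose u := r^-1 *: (X x w + X y w).
have u1 : dotv u u = 1.
  by rewrite /u dotvZl dotvZr n2 -rr; field; rewrite gt_eqF.
rewrite -(cap_rot (hX.2 v) _ u1 u01) /cap fineK; last first.
  by rewrite fin_num_measure//; exact: measurable_cap.
apply: le_measure; rewrite ?inE//; first exact: measurable_cap.
move=> z /QwE [h1 h2] /=.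
rewrite /u dotvZl dotvDl [leRHS]mulrC ler_pdivlMr//.
by have : 4 / 3 * tau * r <= 4 / 3 * tau * (3 / 2); [rewrite ler_wpM2l// ; lra|lra].
Qed.

Lemma Phi_tau v x : x != v -> Phi v tau = p.
Proof.
move=> xv; have := @attach_edge v x tau setT xv (@measurableT _ (off_type X v)).
by rewrite setTI /pr probability_setT mulr1 => <-; rewrite /near_ev htau.
Qed.

Lemma pr_forest E V : forest E V -> pr (edges_ev E) = p ^+ size E.
Proof.
elim=> [|//|{}E {}V x y fE IH xV yV].
  by rewrite (_ : edges_ev [::] = setT) /pr ?probability_setT//; apply/seteqP; split.
have xy : x != y by apply: contraNneq yV => <-.
rewrite edges_ev_cons attach_edge//.
  by rewrite (Phi_tau xy) IH exprS.
apply: edges_ev_off => a b /(forest_mem fE)[aV bV _].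
by split; apply: contraNneq yV => <-.
Qed.

Lemma forest_off E V v : forest E V -> v \notin V ->
  <<s cylinders_off X v >> (edges_ev E).
Proof.
move=> fE vV; apply: edges_ev_off => a b /(forest_mem fE)[aV bV _].
by split; apply: contraNneq vV => <-.
Qed.

Variables (beta gamma : R).
Hypotheses (p0 : 0 <= p) (p1 : p <= 1) (tau0 : 0 < tau).
Hypotheses (hbeta : forall v, Phi v (1 / 8) <= beta * p)
  (hgamma : forall v, Phi v (4 / 3 * tau) <= gamma * p)
  (beta0 : 0 <= beta) (gamma0 : 0 <= gamma).

(** A last leaf outside {x, y} is integrated out and gives p. If it is x or y, its edge to the
    parent is dropped and closeness to the other endpoint is used instead: the lost factor p is
    recovered because Phi (1/8) is at most beta p, and not merely beta. *)
Lemma pr_forest_close E V x y : forest E V -> x \in V -> y \in V -> x != y ->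
  pr (edges_ev E `&` near_ev (1 / 8) x y) <= beta * p ^+ size E.
Proof.
move=> fE; elim: fE x y => // {}E {}V.
- move=> v fE IH vV x y; rewrite !inE.
  have [->|xv] /= := eqVneq x v; have [->|yv] /= := eqVneq y v; rewrite ?eqxx//.
  + move=> _ yV _; rewrite near_evC attach_edge//; last exact: forest_off vV.
    rewrite (pr_forest fE) ler_wpM2r ?exprn_ge0//.
    by rewrite (le_trans (hbeta v))// ler_piMr.
  + move=> xV _ _; rewrite attach_edge//; last exact: forest_off vV.
    rewrite (pr_forest fE) ler_wpM2r ?exprn_ge0//.
    by rewrite (le_trans (hbeta v))// ler_piMr.
  + exact: IH.
- move=> a v fE IH aV vV x y; rewrite !inE edges_ev_cons.
  have av : a != v by apply: contraNneq vV => <-.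
  have last_case z : z != v ->
      pr (edges_ev E `&` near_ev tau a v `&` near_ev (1 / 8) z v) <=
      beta * p ^+ (size E).+1.
    move=> zv; apply: (@le_trans _ _ (pr (edges_ev E `&` near_ev (1 / 8) z v))).
      apply: pr_le.
      * by do 2?apply: measurableI;
          [exact: measurable_edges_ev|exact: measurable_near_ev|exact: measurable_near_ev].
      * by apply: measurableI; [exact: measurable_edges_ev|exact: measurable_near_ev].
      * by move=> w [[]].
    rewrite attach_edge//; last exact: forest_off vV.
    by rewrite (pr_forest fE) exprS mulrA ler_wpM2r ?exprn_ge0.
  have [->|xv] /= := eqVneq x v; have [->|yv] /= := eqVneq y v; rewrite ?eqxx//.
  + by move=> _ yV _; rewrite (near_evC _ v y); exact: last_case.
  + by move=> xV _ _; exact: last_case.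
  + move=> xV yV xy; rewrite setIAC attach_edge//; last first.
      by apply: (@measurableI _ (off_type X v)); [exact: forest_off vV|exact: near_ev_off].
    by rewrite (Phi_tau av) exprS mulrCA ler_wpM2l// IH.
Qed.

(* A leaf outside {x, y} is integrated out. If the last leaf is x or y, say with
   parent a and other endpoint z, either <X_a, X_z> >= 1/8, which
   [pr_forest_close] excludes, or the leaf is in the cap of height 4 tau / 3
   around the bisector of X_a and X_z. *)
Lemma pr_forest_cycle E V x y : forest E V -> x \in V -> y \in V -> x != y ->
  (x, y) \notin E -> (y, x) \notin E ->
  pr (edges_ev E `&` near_ev tau x y) <= (p + beta + gamma) * p ^+ size E.
Proof.
move=> fE; elim: fE x y => // {}E {}V.
- move=> v fE IH vV x y; rewrite !inE.
  (* An isolated last vertex meets the extra edge with probability exactly p, which accounts for the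
     summand p of the constant. *)
  have root_case z : z != v ->
      pr (edges_ev E `&` near_ev tau z v) <= (p + beta + gamma) * p ^+ size E.
    move=> zv; rewrite attach_edge//; last exact: forest_off vV.
    by rewrite (pr_forest fE) (Phi_tau zv) ler_wpM2r ?exprn_ge0// -addrA lerDl addr_ge0.
  have [->|xv] /= := eqVneq x v; have [->|yv] /= := eqVneq y v; rewrite ?eqxx//.
  + by move=> _ yV _ _ _; rewrite (near_evC _ v y); exact: root_case.
  + by move=> xV _ _ _ _; exact: root_case.
  + exact: IH.
- move=> a v fE IH aV vV x y; rewrite !inE edges_ev_cons /=.
  have av : a != v by apply: contraNneq vV => <-.
  have last_case z : z \in V -> z != a ->
      pr (edges_ev E `&` near_ev tau a v `&` near_ev tau z v) <=
      (p + beta + gamma) * p ^+ (size E).+1.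
    move=> zV za.
    have zv : z != v by apply: contraNneq vV => <-.
    pose S1 := edges_ev E `&` near_ev (1 / 8) a z.
    pose S2 := edges_ev E `\` near_ev (1 / 8) a z.
    have oE : <<s cylinders_off X v >> (edges_ev E) by exact: forest_off vV.
    have oN : <<s cylinders_off X v >> (near_ev (1 / 8) a z) by exact: near_ev_off.
    have o1 : <<s cylinders_off X v >> S1 by exact: (@measurableI _ (off_type X v)).
    have o2 : <<s cylinders_off X v >> S2 by exact: (@measurableD _ (off_type X v)).
    have mE := measurable_edges_ev E.
    have mN := measurable_near_ev.
    have m1 := sigma_cylinders_off_measurable o1.
    have m2 := sigma_cylinders_off_measurable o2.
    (* The edge between z and v is dropped: the closeness of a and z alone provides beta. *)
    have b1 : pr (S1 `&` near_ev tau a v `&` near_ev tau z v) <= beta * p ^+ (size E).+1.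
      apply: (@le_trans _ _ (pr (S1 `&` near_ev tau a v))).
        apply: pr_le; [by do 2?apply: measurableI|exact: measurableI|by move=> w []].
      rewrite attach_edge// (Phi_tau av) exprS mulrCA ler_wpM2l//.
      by apply: (pr_forest_close fE aV zV); rewrite eq_sym.
    have b2 : pr (S2 `&` near_ev tau a v `&` near_ev tau z v) <= gamma * p ^+ (size E).+1.
      apply: (le_trans (attach_two_edges av zv tau0 o2 _)).
        move=> w [_] /=; rewrite /near_ev /= => /negP; rewrite -ltNge; exact: ltW.
      apply: (@le_trans _ _ (gamma * p * p ^+ size E)).
        apply: ler_pM => //; [exact: cap_ge0|exact: fine_ge0|].
        rewrite -(pr_forest fE); apply: pr_le => // w [] //.
      by rewrite exprS mulrA.
    apply: (@le_trans _ _ (pr (S1 `&` near_ev tau a v `&` near_ev tau z v) +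
                     pr (S2 `&` near_ev tau a v `&` near_ev tau z v))).
      have e : edges_ev E `&` near_ev tau a v `&` near_ev tau z v =
        (S1 `&` near_ev tau a v `&` near_ev tau z v) `|`
        (S2 `&` near_ev tau a v `&` near_ev tau z v).
        by rewrite -!setIUl setUIDK.
      rewrite e /pr -fineD ?fin_num_measure//; try by do 2?apply: measurableI.
      rewrite fine_le ?fin_numD ?fin_num_measure//; try by do 2?apply: measurableI.
        by apply: measurableU; do 2?apply: measurableI.
      by apply: measureU2; do 2?apply: measurableI.
    rewrite (le_trans (lerD b1 b2))// -mulrDl ler_wpM2r ?exprn_ge0//.
    by rewrite -addrA lerDr.
  have [->|xv] /= := eqVneq x v; have [->|yv] /= := eqVneq y v; rewrite ?eqxx//.
  + move=> _ yV _ _; rewrite negb_or xpair_eqE eqxx andbT => /andP[ya _].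
    by rewrite (near_evC _ v y); exact: last_case.
  + move=> xV _ _; rewrite negb_or xpair_eqE eqxx andbT => /andP[xa _] _.
    exact: last_case.
  + move=> xV yV xy; rewrite !negb_or => /andP[_ xyE] /andP[_ yxE].
    rewrite setIAC attach_edge//; last first.
      by apply: (@measurableI _ (off_type X v)); [exact: forest_off vV|exact: near_ev_off].
    by rewrite (Phi_tau av) exprS mulrCA ler_wpM2l// IH.
Qed.

End SphericalForest.

(** * Sums over walks *)

Section WalkSums.
Context {R : realType} (n : nat).
Local Notation vertex := 'I_n.
Local Notation edges := (seq ('I_n * 'I_n)).
Implicit Types (F L : edges) (V : seq vertex).

(* A list of instructions describes a sum over the walks of a walker who may jump
   to a new root (Root), move along an edge (Step) or require an edge from the
   current vertex to the root (Close); [walk_sum] applies [pi] to the list of the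
   edges met. For [pi] the probability that given edges are present, it is the
   mean of a product of traces of powers of the adjacency matrix. *)
Inductive instr := Root | Step | Close.

Fixpoint walk_sum (pi : edges -> R) (s : seq instr) (r c : vertex) L : R :=
  match s with
  | [::] => pi L
  | Root :: s => \sum_y walk_sum pi s y y L
  | Step :: s => \sum_y walk_sum pi s r y ((c, y) :: L)
  | Close :: s => walk_sum pi s r c ((c, r) :: L)
  end.

(** Counts the continuations of a walk that has visited v vertices, after taking out one factor n
    per [Root]: a step leads to one of v old vertices, or to a new one with total weight n p = a. No
    other dependence on n remains, so the constant is fixed when n p = alpha. *)
Fixpoint walk_const (a : R) (s : seq instr) (v : nat) : R :=
  match s with
  | [::] => 1
  | Root :: s => v%:R * walk_const a s v + walk_const a s v.+1
  | Step :: s => v%:R * walk_const a s v + a * walk_const a s v.+1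
  | Close :: s => walk_const a s v
  end.

Definition is_root i := if i is Root then true else false.

(** Walks may repeat an edge or run it backwards, so lists of edges are compared as sets and up to
    orientation. *)
Definition lsub L1 L2 :=
  forall x y, (x, y) \in L1 -> (x, y) \in L2 \/ (y, x) \in L2.

Record tree_like (p eps : R) (pi : edges -> R) : Prop := {
  tl_ge0 : forall L, 0 <= pi L ;
  tl_mono : forall L1 L2, lsub L1 L2 -> pi L2 <= pi L1 ;
  tl_loop : forall x L, (x, x) \in L -> pi L = 0 ;
  tl_forest : forall F V, forest F V -> pi F = p ^+ size F ;
  tl_cycle : forall F V x y, forest F V -> x \in V -> y \in V -> x != y ->
    (x, y) \notin F -> (y, x) \notin F -> pi ((x, y) :: F) <= eps * p ^+ size F }.

Lemma lsub_cons x y L1 L2 : lsub L1 L2 -> lsub ((x, y) :: L1) ((x, y) :: L2).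
Proof.
move=> s a b; rewrite !in_cons => /orP[ab|/s[]ab]; [left|left|right].
- by rewrite ab.
- by rewrite ab orbT.
- by rewrite ab orbT.
Qed.

Lemma lsub_consr e L1 L2 : lsub L1 L2 -> lsub L1 (e :: L2).
Proof. by move=> s a b /s[]ab; [left|right]; rewrite in_cons ab orbT. Qed.

Lemma walk_const_ge0 a s v : 0 <= a -> 0 <= walk_const a s v.
Proof.
move=> a0; elim: s v => [//|[] s IH] v /=.
- by rewrite addr_ge0// mulr_ge0.
- by rewrite addr_ge0 ?mulr_ge0.
- exact: IH.
Qed.

Lemma forest_uniq F V : forest F V -> uniq V.
Proof. by elim=> //= {F V} ? V => [? _ -> ->|? ? _ -> _ ->]. Qed.

Lemma sum_split_le (V : seq vertex) (f : vertex -> R) M N : uniq V ->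
  0 <= N -> (forall y, y \in V -> f y <= M) -> (forall y, y \notin V -> f y <= N) ->
  \sum_y f y <= (size V)%:R * M + n%:R * N.
Proof.
move=> uV N0 fM fN; rewrite (bigID (mem V))/=; apply: lerD.
  apply: (@le_trans _ _ (\sum_(y in V) M)); first exact: ler_sum.
  by rewrite sumr_const (card_uniqP uV) mulr_natl.
apply: (@le_trans _ _ (\sum_(y | y \notin V) N)); first exact: ler_sum.
rewrite sumr_const -[leLHS]mulr_natl ler_wpM2r// ler_nat.
by rewrite -[leqRHS]card_ord max_card.
Qed.

Section OneLaw.
Variables (p eps : R) (pi : edges -> R).
Hypotheses (tl : tree_like p eps pi) (p0 : 0 <= p) (eps0 : 0 <= eps).
Local Notation a := (n%:R * p).

Lemma walk_sum_ge0 s r c L : 0 <= walk_sum pi s r c L.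
Proof.
elim: s r c L => [|[] s IH] r c L /=; first exact: tl_ge0 tl _.
- by apply: sumr_ge0.
- by apply: sumr_ge0.
- exact: IH.
Qed.

Lemma walk_sum_loop s r c x L : (x, x) \in L -> walk_sum pi s r c L = 0.
Proof.
elim: s r c L => [|[] s IH] r c L xL /=; first exact: tl_loop tl _ _ xL.
- by rewrite big1// => y _; exact: IH.
- by rewrite big1// => y _; apply: IH; rewrite in_cons xL orbT.
- by apply: IH; rewrite in_cons xL orbT.
Qed.

Lemma n_ge1 (x : vertex) : 1 <= n%:R :> R.
Proof. by rewrite ler1n; exact: leq_ltn_trans (leq0n x) (ltn_ord x). Qed.

(* A step to one of the at most [size V] visited vertices only adds a constraint;
   a step to one of the at most n new ones costs a factor p. *)
Lemma walk_sum_cycle_le s r c F V L x y : forest F V -> lsub ((x, y) :: F) L ->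
  x \in V -> y \in V -> x != y -> (x, y) \notin F -> (y, x) \notin F ->
  r \in V -> c \in V ->
  walk_sum pi s r c L <=
    eps * p ^+ size F * n%:R ^+ count is_root s * walk_const a s (size V).
Proof.
have a0 : 0 <= a by rewrite mulr_ge0.
elim: s r c F V L => [|[] s IH] r c F V L fF FL xV yV xy xyF yxF rV cV /=.
- rewrite expr0 !mulr1; apply: le_trans (tl_mono tl FL) _.
  exact: (tl_cycle tl fF).
- set B := fun v => eps * p ^+ size F * n%:R ^+ count is_root s * walk_const a s v.
  have B0 v : 0 <= B v by rewrite !mulr_ge0 ?exprn_ge0// walk_const_ge0.
  apply: (@le_trans _ _ ((size V)%:R * B (size V) + n%:R * B (size V).+1)).
    apply: sum_split_le => //; first exact: forest_uniq fF.
    + by move=> z zV; exact: IH.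
    + move=> z zV; apply: (IH _ _ _ (z :: V)) => //; rewrite ?in_cons ?eqxx ?xV ?yV ?orbT//.
      exact: forest_root.
  (* A jump to an already visited root is charged a factor n as well, so that every [Root] costs
     n. *)
  have n1 := n_ge1 x; have Bv := B0 (size V).
  apply: (@le_trans _ _ (n%:R * ((size V)%:R * B (size V)) + n%:R * B (size V).+1)).
    by rewrite lerD2r ler_peMl// mulr_ge0.
  by rewrite /B exprS le_eqVlt; apply/orP; left; apply/eqP; ring.
- set B := fun v => eps * p ^+ size F * n%:R ^+ count is_root s * walk_const a s v.
  have B0 v : 0 <= B v by rewrite !mulr_ge0 ?exprn_ge0// walk_const_ge0.
  apply: (@le_trans _ _ ((size V)%:R * B (size V) + n%:R * (p * B (size V).+1))).
    apply: sum_split_le => //; [exact: forest_uniq fF|by rewrite mulr_ge0| |].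
    + by move=> z zV; apply: IH => //; exact: lsub_consr.
    + move=> z zV.
      have -> : p * B (size V).+1 = eps * p ^+ (size ((c, z) :: F)) *
          n%:R ^+ count is_root s * walk_const a s (size (z :: V)).
        by rewrite /B /= exprS; ring.
      have xz : x != z by apply: contraNneq zV => <-.
      have yz : y != z by apply: contraNneq zV => <-.
      apply: IH; rewrite ?in_cons ?eqxx ?xV ?yV ?rV ?cV ?orbT//.
      * exact: forest_edge.
      * move=> a' b'; rewrite !in_cons => /or3P[/eqP[-> ->]|/eqP[-> ->]|ab].
        - by case: (FL x y (mem_head _ _)) => ->; [left|right]; rewrite orbT.
        - by left; rewrite eqxx.
        - by case: (FL a' b'); rewrite ?in_cons ?ab ?orbT// => ->; [left|right]; rewrite orbT.
      * by rewrite !xpair_eqE (negbTE yz) andbF.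
      * by rewrite !xpair_eqE (negbTE xz) andbF.
  by rewrite /B le_eqVlt; apply/orP; left; apply/eqP; ring.
- apply: IH => //; exact: lsub_consr.
Qed.

End OneLaw.

Section TwoLaws.
Variables (p eps : R) (pi1 pi2 : edges -> R).
Hypotheses (tl1 : tree_like p eps pi1) (tl2 : tree_like p eps pi2).
Hypotheses (p0 : 0 <= p) (eps0 : 0 <= eps).
Local Notation a := (n%:R * p).

(** F is a forest with the same unoriented edges as L. While the walk stays in a forest both models
    give p^(size F) and the difference vanishes. A loop gives 0 in both, a repeated edge leaves F
    unchanged, and at the first edge closing a cycle both sums lie between 0 and the bound of
    [walk_sum_cycle_le]. *)
Lemma walk_sum_diff_le s r c F V L : forest F V -> lsub F L -> lsub L F ->
  r \in V -> c \in V ->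
  `|walk_sum pi1 s r c L - walk_sum pi2 s r c L| <=
    eps * p ^+ size F * n%:R ^+ count is_root s * walk_const a s (size V).
Proof.
have a0 : 0 <= a by rewrite mulr_ge0.
elim: s r c F V L => [|i s IH] r c F V L fF FL LF rV cV.
  have e pi : tree_like p eps pi -> pi L = p ^+ size F.
    move=> tl; rewrite -(tl_forest tl fF); apply/eqP.
    by rewrite eq_le !(tl_mono tl).
  by rewrite /= (e _ tl1) (e _ tl2) subrr normr0 !mulr_ge0 ?exprn_ge0.
set B := fun v => eps * p ^+ size F * n%:R ^+ count is_root s * walk_const a s v.
have B0 v : 0 <= B v by rewrite !mulr_ge0 ?exprn_ge0// walk_const_ge0.
have old z r' c' : z \in V -> r' \in V -> c' \in V ->
    `|walk_sum pi1 s r' c' ((c, z) :: L) - walk_sum pi2 s r' c' ((c, z) :: L)|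
    <= B (size V).
  move=> zV r'V c'V; have [zc|zc] := eqVneq c z.
    have zL : (z, z) \in (c, z) :: L by rewrite zc mem_head.
    by rewrite (walk_sum_loop tl1 _ _ _ zL) (walk_sum_loop tl2 _ _ _ zL) subrr normr0.
  have [czF|czF] := boolP (((c, z) \in F) || ((z, c) \in F)).
    apply: IH => //; first exact: lsub_consr.
    move=> x y; rewrite in_cons => /predU1P[[-> ->]|/LF//].
    by case/orP: czF; [left|right].
  move: czF; rewrite negb_or => /andP[czF zcF].
  have b pi : tree_like p eps pi -> 0 <= walk_sum pi s r' c' ((c, z) :: L) <= B (size V).
    move=> tl; rewrite (walk_sum_ge0 tl)/=.
    exact: (walk_sum_cycle_le tl p0 eps0 s fF (@lsub_cons c z _ _ FL) cV zV zc czF zcF).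
  by have := b _ tl1; have := b _ tl2; rewrite ler_norml; lra.
case: i => /=.
- apply: (@le_trans _ _ ((size V)%:R * B (size V) + n%:R * B (size V).+1)).
    rewrite -sumrB; apply: (le_trans (ler_norm_sum _ _ _)).
    apply: sum_split_le => //; first exact: forest_uniq fF.
    + by move=> z zV; exact: IH.
    + move=> z zV; apply: (IH _ _ _ (z :: V)) => //; rewrite ?in_cons ?eqxx//.
      exact: forest_root.
  have n1 := n_ge1 r; have Bv := B0 (size V).
  apply: (@le_trans _ _ (n%:R * ((size V)%:R * B (size V)) + n%:R * B (size V).+1)).
    by rewrite lerD2r ler_peMl// mulr_ge0.
  by rewrite /B exprS le_eqVlt; apply/orP; left; apply/eqP; ring.
- apply: (@le_trans _ _ ((size V)%:R * B (size V) + n%:R * (p * B (size V).+1))).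
    rewrite -sumrB; apply: (le_trans (ler_norm_sum _ _ _)).
    apply: sum_split_le => //; [exact: forest_uniq fF|by rewrite mulr_ge0| |].
    + by move=> z zV; exact: old.
    + move=> z zV.
      have -> : p * B (size V).+1 = eps * p ^+ (size ((c, z) :: F)) *
          n%:R ^+ count is_root s * walk_const a s (size (z :: V)).
        by rewrite /B /= exprS; ring.
      apply: IH; rewrite ?in_cons ?eqxx ?rV ?orbT//.
      * exact: forest_edge.
      * exact: lsub_cons.
      * exact: lsub_cons.
  by rewrite /B le_eqVlt; apply/orP; left; apply/eqP; ring.
- exact: old.
Qed.

Lemma walk_sum_diff_root s r c :
  `|walk_sum pi1 (Root :: s) r c [::] - walk_sum pi2 (Root :: s) r c [::]| <=
    eps * n%:R ^+ count is_root (Root :: s) * walk_const a s 1.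
Proof.
rewrite /= -sumrB; apply: (le_trans (ler_norm_sum _ _ _)).
apply: (@le_trans _ _ (\sum_(y < n) eps * n%:R ^+ count is_root s * walk_const a s 1)).
  apply: ler_sum => y _.
  have fy : forest [::] [:: y] by apply: forest_root; [exact: forest_nil|].
  have yy : y \in [:: y] by rewrite mem_head.
  have ls : lsub (@nil ('I_n * 'I_n)) [::] by [].
  by have := walk_sum_diff_le s fy ls ls yy yy; rewrite expr0 mulr1.
rewrite sumr_const card_ord -[leLHS]mulr_natl exprS.
by rewrite le_eqVlt; apply/orP; left; apply/eqP; ring.
Qed.

End TwoLaws.

End WalkSums.

(** * Moments of the size of a random set of vertices *)

Section RandomSubset.
Context {R : realType} (n : nat) (p : R).
Implicit Types V : seq 'I_n.

(* The weight of S as the union of V and a p-random set. The sum of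
   p^(number of distinct entries) over all k-tuples of vertices is a k-th moment
   of |S|, which bounds the exponential moments of the spectrum. *)
Definition subset_weight V (S : {set 'I_n}) : R :=
  \prod_x (if x \in S then (if x \in V then 1 else p)
           else (if x \in V then 0 else 1 - p)).

Definition card_moment k V : R := \sum_(S : {set 'I_n}) subset_weight V S * #|S|%:R ^+ k.

Lemma sum_subset_weight V (f g : 'I_n -> R) :
  \sum_(S : {set 'I_n}) subset_weight V S * \prod_x (if x \in S then f x else g x) =
  \prod_x ((if x \in V then 1 else p) * f x + (if x \in V then 0 else 1 - p) * g x).
Proof.
rewrite bigA_distr; apply: eq_bigr => S _; rewrite -big_split/=.
by apply: eq_bigr => x _; case: ifP.
Qed.

Lemma card_moment0 V : card_moment 0 V = 1.
Proof.
rewrite /card_moment; transitivity (\sum_(S : {set 'I_n}) subset_weight V S *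
    \prod_x (if x \in S then 1 else 1)).
  by apply: eq_bigr => S _; rewrite expr0 big1// => x _; case: ifP.
rewrite sum_subset_weight big1// => x _; case: ifP => _; ring.
Qed.

(** One factor |S| is written as the sum over y of the indicator of y in S. For y outside V this
    event has probability p, and conditioning on it adds y to V: the same recursion as for a walk
    choosing its next vertex. *)
Lemma card_momentS k V : card_moment k.+1 V =
  \sum_y (if y \in V then card_moment k V else p * card_moment k (y :: V)).
Proof.
have E (S : {set 'I_n}) : #|S|%:R = \sum_y (y \in S)%:R :> R.
  by rewrite -sum1_card natr_sum big_mkcond; apply: eq_bigr => y _; case: ifP.
rewrite /card_moment.
under eq_bigr do rewrite exprSr [X in _ * (_ * X)]E mulrA mulr_sumr.
rewrite exchange_big/=; apply: eq_bigr => y _.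
case: ifPn => yV; last rewrite mulr_sumr; apply: eq_bigr => S _.
  have [yS|yS] := boolP (y \in S); first by rewrite mulr1.
  by rewrite /subset_weight (bigD1 y)//= yV (negbTE yS) !mul0r.
rewrite mulrA mulrAC; congr (_ * _).
rewrite /subset_weight (bigD1 y)//= [in RHS](bigD1 y)//= mem_head (negbTE yV).
have [yS|yS] := boolP (y \in S); last by rewrite mulr0 mul0r mulr0.
rewrite mulr1 mul1r; congr (_ * _); apply: eq_bigr => x xy.
by rewrite in_cons (negbTE xy).
Qed.

Lemma sum_exp_coeff_le (z : R) K : 0 <= z -> \sum_(k < K) z ^+ k / k`!%:R <= expR z.
Proof.
move=> z0.
have nd : nondecreasing_seq (series (exp_coeff z)).
  by apply: nondecreasing_series => k _ _; exact: exp_coeff_ge0.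
have := nondecreasing_cvgn_le nd (is_cvg_series_exp_coeff z) K.
by rewrite /series /= big_mkord.
Qed.

(** The left side is a partial sum of the mean of exp (t |S|), which factors over the vertices: y
    contributes exp t, any other vertex 1 - p + p exp t <= exp (p exp t). *)
Lemma sum_card_moment_le (t : R) y K : 0 <= t -> 0 <= p -> p <= 1 ->
  \sum_(k < K) t ^+ k / k`!%:R * card_moment k [:: y] <=
  expR (t + n%:R * p * expR t).
Proof.
move=> t0 p0 p1.
have w0 S : 0 <= subset_weight [:: y] S.
  by apply: prodr_ge0 => x _; do 2!case: ifP => //; rewrite subr_ge0.
apply: (@le_trans _ _ (\sum_(S : {set 'I_n}) subset_weight [:: y] S *
    \prod_x (if x \in S then expR t else 1))).
  rewrite /card_moment; under eq_bigr do rewrite mulr_sumr.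
  rewrite exchange_big/=; apply: ler_sum => S _.
  under eq_bigr do rewrite mulrCA.
  rewrite -mulr_sumr ler_wpM2l//.
  rewrite -big_mkcond/= prodr_const -expRM_natl.
  under eq_bigr do rewrite mulrAC -exprMn mulrC.
  rewrite mulrC; apply: le_trans (sum_exp_coeff_le K _); last by rewrite mulr_ge0.
  by apply: ler_sum => k _; rewrite mulrC.
rewrite sum_subset_weight.
apply: (@le_trans _ _ (\prod_(x : 'I_n) expR ((if x == y then t else 0) + p * expR t))).
  apply: ler_prod => x _; rewrite mem_seq1.
  have e0 := expR_gt0 t; have pe : 0 <= p * expR t by rewrite mulr_ge0// ltW.
  case: ifP => _; rewrite ?mul1r ?mul0r ?addr0 ?add0r ?mulr1.
    by rewrite ltW//= ler_expR lerDl.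
  rewrite addr_ge0 ?subr_ge0//=.
  by have := expR_ge1Dx (p * expR t); lra.
rewrite -expR_sum ler_expR big_split/= sumr_const card_ord.
by rewrite -big_mkcond/= big_pred1_eq -mulrA mulr_natl.
Qed.

End RandomSubset.

(** * Traces of powers as walk sums *)

Section TraceWalks.
Context {R : realType} (n : nat).
Local Notation edges := (seq ('I_n * 'I_n)).
Implicit Types (F L : edges) (V : seq 'I_n).

(** Every constraint that does not reach a new vertex is dropped, the closing edge included. What
    remains is the recursion [card_momentS]. *)
Lemma walk_sum_steps_le (p eps : R) (pi : edges -> R) k r c F V L :
  tree_like p eps pi -> 0 <= p -> forest F V -> lsub F L -> c \in V ->
  walk_sum pi (nseq k Step ++ [:: Close]) r c L <= p ^+ size F * card_moment p k V.
Proof.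
move=> tl p0; elim: k r c F V L => [|k IH] r c F V L fF FL cV /=.
  rewrite card_moment0 mulr1 -(tl_forest tl fF); apply: (tl_mono tl).
  exact: lsub_consr.
rewrite card_momentS mulr_sumr; apply: ler_sum => y _.
case: ifPn => yV; first by apply: IH => //; exact: lsub_consr.
rewrite mulrCA mulrA -exprS.
apply: (IH _ _ ((c, y) :: F) (y :: V)); rewrite ?mem_head//.
- exact: forest_edge.
- exact: lsub_cons.
Qed.

(** [Close] is the last of the k edges, hence k - 1 steps. For k = 0 the lone [Root] gives n, the
    trace of the identity. *)
Definition trace_walk k := if k is k'.+1 then Root :: nseq k' Step ++ [:: Close]
  else [:: Root].

Definition entry_prod (A : 'M[R]_n) L := \prod_(e <- L) A e.1 e.2.

(** The instructions s that follow, of value q, are arbitrary, so that the lemma can be iterated to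
    produce products of traces. *)
Lemma walk_sum_trace (A : 'M[R]_n) k s q r c L :
  (forall r c L, walk_sum (entry_prod A) s r c L = q * entry_prod A L) ->
  walk_sum (entry_prod A) (trace_walk k ++ s) r c L =
    \tr (A ^+ k) * q * entry_prod A L.
Proof.
move=> sq; case: k => [|k] /=.
  by under eq_bigr do rewrite sq; rewrite sumr_const card_ord expr0 mxtrace1
    -[LHS]mulr_natl mulrA.
have walk j r' c' L' : walk_sum (entry_prod A) ((nseq j Step ++ [:: Close]) ++ s) r' c' L' =
    (A ^+ j.+1) c' r' * q * entry_prod A L'.
  elim: j r' c' L' => [|j IH] r' c' L' /=.
    by rewrite sq /entry_prod big_cons /= expr1 mulrCA mulrA.
  under eq_bigr do rewrite IH /entry_prod big_cons /=.
  rewrite (exprS A j.+1) -[in RHS]mulmxE mxE !mulr_suml; apply: eq_bigr => y _.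
  by rewrite -/(entry_prod A L'); ring.
under eq_bigr do rewrite walk.
by rewrite -mulr_suml -mulr_suml.
Qed.

Definition graph_mean (u : {set 'I_n * 'I_n} -> R) (f : {set 'I_n * 'I_n} -> R) :=
  \sum_E u E * f E.

Definition graph_pi u L := graph_mean u (fun E => entry_prod (er_adjacency E) L).

Lemma walk_sum_mean u s r c L : walk_sum (graph_pi u) s r c L =
  graph_mean u (fun E => walk_sum (entry_prod (er_adjacency E)) s r c L).
Proof.
elim: s r c L => [|[] s IH] r c L //=.
- rewrite /graph_mean; under [in RHS]eq_bigr do rewrite mulr_sumr.
  by rewrite exchange_big; apply: eq_bigr => y _; exact: IH.
- rewrite /graph_mean; under [in RHS]eq_bigr do rewrite mulr_sumr.
  by rewrite exchange_big; apply: eq_bigr => y _; exact: IH.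
Qed.

Lemma mean_trace_exp_le (p eps t : R) u K : tree_like p eps (graph_pi u) ->
  0 <= p -> p <= 1 -> 0 <= t ->
  \sum_(k < K) t ^+ k / k`!%:R * graph_mean u (fun E => \tr (er_adjacency E ^+ k))
  <= n%:R * expR (t + n%:R * p * expR t).
Proof.
move=> tl p0 p1 t0.
have w0 y (S : {set 'I_n}) : 0 <= subset_weight p [:: y] S.
  by apply: prodr_ge0 => x _; do 2!case: ifP => //; rewrite subr_ge0.
have mle k : graph_mean u (fun E => \tr (er_adjacency E ^+ k)) <=
    \sum_(y < n) card_moment p k [:: y].
  have fy (y : 'I_n) : forest [::] [:: y] by apply: forest_root; [exact: forest_nil|].
  case: k => [|k].
    have -> : graph_mean u (fun E => \tr (er_adjacency E ^+ 0)) =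
        n%:R * graph_pi u [::].
      rewrite /graph_pi /graph_mean mulr_sumr; apply: eq_bigr => E _.
      by rewrite expr0 mxtrace1 /entry_prod big_nil mulr1 mulrC.
    rewrite (tl_forest tl (forest_nil _)) expr0 mulr1.
    rewrite (eq_bigr (fun=> 1)) => [|y _]; last exact: card_moment0.
    by rewrite sumr_const card_ord.
  (* A closed walk of length k + 1 has only k free steps, so the k-th moment suffices. It is at most
     the next one, as |S| >= 1 wherever the weight is nonzero. *)
  apply: (@le_trans _ _ (\sum_(y < n) card_moment p k [:: y])); last first.
    apply: ler_sum => y _; apply: ler_sum => S _.
    have [->|S0] := eqVneq S finset.set0.
      by rewrite /subset_weight (bigD1 y)//= inE mem_head mul0r !mul0r.
    by rewrite ler_wpM2l// exprS ler_peMl ?exprn_ge0// ler1n card_gt0.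
  have [n0|n0] := posnP n.
    have no (i : 'I_n) : False by have := ltn_ord i; rewrite [X in (_ < X)%N]n0.
    rewrite [leRHS]big1 => [|y _]; last by case: (no y).
    have tr0 (A : 'M[R]_n) : \tr A = 0 by rewrite /mxtrace big1// => y; case: (no y).
    by rewrite /graph_mean big1// => E _; rewrite tr0 mulr0.
  have x0 := Ordinal n0.
  have -> : graph_mean u (fun E => \tr (er_adjacency E ^+ k.+1)) =
      walk_sum (graph_pi u) (trace_walk k.+1) x0 x0 [::].
    rewrite walk_sum_mean; apply: eq_bigr => E _; congr (_ * _).
    rewrite -[trace_walk _]cats0 (@walk_sum_trace _ _ _ 1).
      by rewrite /entry_prod big_nil !mulr1.
    by move=> r c L; rewrite mul1r.
  rewrite /=; apply: ler_sum => y _.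
  have yy : y \in [:: y] by rewrite mem_head.
  have ls : lsub (@nil ('I_n * 'I_n)) [::] by [].
  by have := walk_sum_steps_le k y tl p0 (fy y) ls yy; rewrite expr0 mul1r.
apply: (@le_trans _ _ (\sum_(y < n) \sum_(k < K) t ^+ k / k`!%:R * card_moment p k [:: y])).
  rewrite exchange_big/=; apply: ler_sum => k _; rewrite -mulr_sumr.
  by rewrite ler_wpM2l ?mle// divr_ge0// exprn_ge0.
apply: (@le_trans _ _ (\sum_(y < n) expR (t + n%:R * p * expR t))).
  by apply: ler_sum => y _; exact: sum_card_moment_le.
by rewrite sumr_const card_ord -[leLHS]mulr_natl.
Qed.

Lemma count_root_trace k : count is_root (trace_walk k) = 1%N.
Proof. by case: k => [|k]//=; rewrite count_cat count_nseq mul0n. Qed.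

Lemma walk_sum_trace2 u k l (x0 : 'I_n) :
  walk_sum (graph_pi u) (trace_walk k ++ trace_walk l) x0 x0 [::] =
  graph_mean u (fun E => \tr (er_adjacency E ^+ k) * \tr (er_adjacency E ^+ l)).
Proof.
rewrite walk_sum_mean; apply: eq_bigr => E _; congr (_ * _).
rewrite (@walk_sum_trace _ _ _ (\tr (er_adjacency E ^+ l))).
  by rewrite /entry_prod big_nil mulr1.
move=> r c L; rewrite -[trace_walk _]cats0 (@walk_sum_trace _ _ _ 1) ?mulr1//.
by move=> *; rewrite mul1r.
Qed.

(** Two traces have two roots, whence n^2, which is exactly what the normalisation of two spectral
    means removes. [walk_sum_diff_root] uses up the first root; this explains [behead] and the start
    with one visited vertex. *)
Lemma mean_trace2_diff_le (p eps : R) u1 u2 k l :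
  tree_like p eps (graph_pi u1) -> tree_like p eps (graph_pi u2) ->
  0 <= p -> 0 <= eps -> (0 < n)%N ->
  `|graph_mean u1 (fun E => \tr (er_adjacency E ^+ k) * \tr (er_adjacency E ^+ l)) -
    graph_mean u2 (fun E => \tr (er_adjacency E ^+ k) * \tr (er_adjacency E ^+ l))|
  <= eps * n%:R ^+ 2 *
     walk_const (n%:R * p) (behead (trace_walk k ++ trace_walk l)) 1.
Proof.
move=> tl1 tl2 p0 eps0 n0; pose x0 := Ordinal n0.
rewrite -!(walk_sum_trace2 _ _ _ x0).
have [s sE] : exists s, trace_walk k ++ trace_walk l = Root :: s.
  by case: k => [|k] /=; eexists.
have c2 : count is_root (Root :: s) = 2%N.
  by rewrite -sE count_cat !count_root_trace.
by rewrite sE -[X in _ ^+ X]c2; exact: walk_sum_diff_root.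
Qed.

End TraceWalks.

(** * The two random graphs *)

Section GraphLaws.
Context {R : realType} (n : nat).
Local Notation edges := (seq ('I_n * 'I_n)).
Implicit Types (E : {set 'I_n * 'I_n}) (F L : edges).

Definition adjacent E (e : 'I_n * 'I_n) : bool := (e \in E) || ((e.2, e.1) \in E).

Lemma entry_prod_adj E L :
  entry_prod (er_adjacency E : 'M[R]_n) L = (all (adjacent E) L)%:R.
Proof.
rewrite /entry_prod; elim: L => [|[x y] L IH]; first by rewrite big_nil.
by rewrite big_cons IH mxE -natrM mulnb.
Qed.

Lemma lsub_adjacent E L1 L2 : lsub L1 L2 -> all (adjacent E) L2 -> all (adjacent E) L1.
Proof.
move=> s /allP a2; apply/allP => -[x y] /s[] /a2 //.
by rewrite /adjacent /= orbC.
Qed.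

Section Generic.
Variable u : {set 'I_n * 'I_n} -> R.
Hypotheses (u_ge0 : forall E, 0 <= u E)
  (u_simple : forall E, ~~ (E \subset potential_edges n) -> u E = 0).

Lemma graph_pi_ge0 L : 0 <= graph_pi u L.
Proof. by apply: sumr_ge0 => E _; rewrite mulr_ge0// entry_prod_adj. Qed.

Lemma graph_pi_mono L1 L2 : lsub L1 L2 -> graph_pi u L2 <= graph_pi u L1.
Proof.
move=> s; apply: ler_sum => E _; rewrite ler_wpM2l// !entry_prod_adj ler_nat.
by case: (boolP (all _ L2)) => // /(lsub_adjacent s) ->.
Qed.

Lemma graph_pi_loop x L : (x, x) \in L -> graph_pi u L = 0.
Proof.
move=> xL; apply: big1 => E _.
have [sE|/u_simple ->] := boolP (E \subset potential_edges n); last by rewrite mul0r.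
rewrite entry_prod_adj; case: allP => [/(_ _ xL)|_]; last by rewrite mulr0.
by rewrite /adjacent /= orbb => /(fintype.subsetP sE); rewrite inE ltnn.
Qed.

End Generic.

Definition norm_edge (e : 'I_n * 'I_n) := if (e.1 < e.2)%N then e else (e.2, e.1).

Definition norm_edges L : {set 'I_n * 'I_n} := [set norm_edge e | e in L].

Lemma norm_edge_inj e1 e2 : norm_edge e1 = norm_edge e2 -> e1 = e2 \/ e1 = (e2.2, e2.1).
Proof.
case: e1 e2 => [x y] [x' y']; rewrite /norm_edge /=.
by case: ifP => _; case: ifP => _ [-> ->]; auto.
Qed.

Lemma norm_edges_potential L : (forall x, (x, x) \notin L) ->
  norm_edges L \subset potential_edges n.
Proof.
move=> nl; apply/fintype.subsetP => _ /imsetP[[x y] xyL ->]; rewrite inE /norm_edge /=.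
have xy : x != y by apply: contraTneq xyL => ->; exact: nl.
case: (ltnP x y) => [//|yx] /=.
by rewrite ltn_neqAle yx andbT val_eqE eq_sym.
Qed.

Lemma adjacent_norm_edges E L : E \subset potential_edges n ->
  all (adjacent E) L = (norm_edges L \subset E).
Proof.
move=> sE; apply/allP/fintype.subsetP => [a _ /imsetP[[x y] /a xyE ->]|a [x y] xyL].
  case/orP: xyE => /= xyE; have := fintype.subsetP sE _ xyE; rewrite inE /norm_edge /= => lt.
    by rewrite lt.
  by rewrite ltnNge ltnW.
have : norm_edge (x, y) \in E by apply: a; apply/imsetP; exists (x, y).
by rewrite /norm_edge /adjacent /=; case: ifP => _ -> //; rewrite orbT.
Qed.

Lemma norm_edges_cons x y F : norm_edges ((x, y) :: F) = norm_edge (x, y) |: norm_edges F.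
Proof.
apply/setP => e; rewrite !inE; apply/imsetP/orP => [[f]|[/eqP ->|/imsetP[f fF ->]]].
- rewrite in_cons => /predU1P[->|fF] ->; first by rewrite eqxx; left.
  by right; apply/imsetP; exists f.
- by exists (x, y); rewrite ?mem_head.
- by exists f => //; rewrite in_cons fF orbT.
Qed.

Lemma norm_edge_notin x y F : (x, y) \notin F -> (y, x) \notin F ->
  norm_edge (x, y) \notin norm_edges F.
Proof.
move=> xyF yxF; apply/negP => /imsetP[[x' y'] fF] /norm_edge_inj [] [ex ey].
  by rewrite ex ey fF in xyF.
by rewrite /= in ex ey; rewrite ex ey fF in yxF.
Qed.

Lemma card_norm_forest F V : forest F V -> #|norm_edges F| = size F.
Proof.
elim=> // {F V} [|F V x y fF IH xV yV].
  by apply/eqP; rewrite cards_eq0; apply/eqP/setP => e; rewrite inE; apply/imsetP => -[].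
rewrite norm_edges_cons cardsU1 IH norm_edge_notin//.
  by apply/negP => /(forest_mem fF)[_ yV' _]; rewrite yV' in yV.
by apply/negP => /(forest_mem fF)[yV' _ _]; rewrite yV' in yV.
Qed.

Lemma forest_loopless F V x : forest F V -> (x, x) \notin F.
Proof. by move=> fF; apply/negP => /(forest_mem fF)[_ _ /eqP]. Qed.

Section ErdosRenyi.
Variable q : R.
Hypotheses (q0 : 0 <= q) (q1 : q <= 1).

Definition er_mass E : R := (E \subset potential_edges n)%:R * er_weight q E.

Lemma er_mass_ge0 E : 0 <= er_mass E.
Proof.
rewrite mulr_ge0// prodr_ge0// => e _; by case: ifP => _ //; rewrite subr_ge0.
Qed.

Lemma er_mass_simple E : ~~ (E \subset potential_edges n) -> er_mass E = 0.
Proof. by rewrite /er_mass => /negbTE ->; rewrite mul0r. Qed.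

Lemma er_massE E : er_mass E = \prod_e
  (if e \in E then (if e \in potential_edges n then q else 0)
   else (if e \in potential_edges n then 1 - q else 1)).
Proof.
rewrite /er_mass; have [sE|nsE] := boolP (E \subset _).
  rewrite mul1r /er_weight big_mkcond/=; apply: eq_bigr => e _.
  by have [eE|eE] := boolP (e \in E); rewrite ?(fintype.subsetP sE _ eE).
have /fintype.subsetPn [e eE ep] := nsE.
by rewrite mul0r (bigD1 e)//= eE (negbTE ep) mul0r.
Qed.

(** The indicator that the edges of L are present is absorbed into the factors, an absent edge of L
    getting weight 0. The sum over E is then a product over pairs: q for an edge of L, 1 for every
    other pair. *)
Lemma er_pi_loopless L : (forall x, (x, x) \notin L) ->
  graph_pi er_mass L = q ^+ #|norm_edges L|.
Proof.
move=> nl; have sL := norm_edges_potential nl.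
transitivity (\sum_(E in {set ('I_n * 'I_n)%type}) \prod_(e : 'I_n * 'I_n)
  (if e \in E then (if e \in potential_edges n then q else 0)
   else (if e \in norm_edges L then 0 else if e \in potential_edges n then 1 - q else 1))).
  apply: eq_bigr => E _.
  have [sE|nsE] := boolP (E \subset potential_edges n); last first.
    rewrite er_mass_simple// mul0r; have /fintype.subsetPn [e eE ep] := nsE.
    by rewrite (bigD1 e)//= eE (negbTE ep) mul0r.
  rewrite entry_prod_adj adjacent_norm_edges//.
  have [LE|nLE] := boolP (norm_edges L \subset E).
    rewrite mulr1 er_massE; apply: eq_bigr => e _; case: ifPn => // eE.
    have [eL|//] := boolP (e \in norm_edges L).
    by rewrite (fintype.subsetP LE _ eL) in eE.
  rewrite mulr0; have /fintype.subsetPn [e eL eE] := nLE.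
  by rewrite (bigD1 e)//= (negbTE eE) eL mul0r.
rewrite -bigA_distr -prodr_const [RHS]big_mkcond/=; apply: eq_bigr => e _.
have [eL|eL] := boolP (e \in norm_edges L).
  by rewrite (fintype.subsetP sL _ eL) addr0.
by case: ifP => _; rewrite ?add0r// addrC subrK.
Qed.

Lemma er_tree_like eps : q <= eps -> tree_like q eps (graph_pi er_mass).
Proof.
move=> qe; split.
- exact: graph_pi_ge0 er_mass_ge0.
- exact: graph_pi_mono er_mass_ge0.
- exact: graph_pi_loop er_mass_simple.
- move=> F V fF; rewrite er_pi_loopless ?(card_norm_forest fF)// => x.
  exact: forest_loopless fF.
- move=> F V x y fF xV yV xy xyF yxF.
  rewrite er_pi_loopless => [|z].
    rewrite norm_edges_cons cardsU1 norm_edge_notin// (card_norm_forest fF).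
    by rewrite exprD expr1 ler_wpM2r// exprn_ge0.
  rewrite in_cons negb_or (forest_loopless _ fF) andbT.
  by apply: contraNneq xy => -[-> ->].
Qed.

Lemma er_lawE (S : set {set 'I_n * 'I_n}) :
  er_law q S = (\sum_E er_mass E * `[< S E >]%:R)%:E.
Proof.
rewrite /er_law; congr EFin; rewrite big_mkcond; apply: eq_bigr => E _.
rewrite inE /er_mass; case: (E \subset _); rewrite ?mul0r//= mul1r.
by case: asboolP => _; rewrite ?mulr1 ?mulr0.
Qed.

Lemma er_mass_sum1 : \sum_E er_mass E = 1.
Proof.
have := er_pi_loopless (L := [::]) (fun=> isT).
have -> : norm_edges [::] = finset.set0.
  by apply/setP => e; rewrite inE; apply/imsetP => -[].
rewrite cards0 expr0 => <-; apply: eq_bigr => E _.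
by rewrite /entry_prod big_nil mulr1.
Qed.

End ErdosRenyi.

End GraphLaws.

Section SphericalLaw.
Context {R : realType} (disp : measure_display) (T : measurableType disp)
  (P : probability T R).

Lemma probability_partition (I : finType) (g : T -> I) (Q : set I) :
  (forall i, measurable [set w | g w = i]) ->
  P [set w | Q (g w)] = (\sum_i fine (P [set w | g w = i]) * `[< Q i >]%:R)%:E.
Proof.
move=> mg.
have -> : [set w | Q (g w)] = \bigcup_(i in Q) [set w | g w = i].
  by apply/seteqP; split => w /= => [Qw|[i Qi gi]]; [exists (g w)|rewrite gi].
rewrite measure_fin_bigcup//=; last first.
  by apply/trivIsetP => i j _ _ /eqP ij; apply/seteqP; split => w //= [] -> /ij.
rewrite (fsbigE [seq i <- index_enum I | i \in Q]).
- rewrite big_filter_cond -sumEFin big_mkcond; apply: eq_bigr => i _ /=.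
  have [Qi|Qi] := boolP (i \in Q).
    by move/set_mem: Qi => Qi; rewrite asboolT// mulr1 fineK// fin_num_measure.
  rewrite asboolF ?mulr0// => /mem_set; exact/negP.
- by rewrite filter_uniq// index_enum_uniq.
- by move=> i /=; rewrite mem_filter => /andP[/set_mem].
- by move=> i Qi; rewrite mem_filter mem_index_enum (mem_set Qi).
Qed.

Context (d n : nat) (X : 'I_n -> {RV P >-> @borel_rV R d}) (tau : R).

(** The same encoding of graphs as for [er_law], so that both models become weights on one finite
    type. *)
Definition rgg (w : T) : {set 'I_n * 'I_n} :=
  [set e : 'I_n * 'I_n | (e.1 < e.2)%N && (tau <= dotv (X e.1 w) (X e.2 w))].

Lemma rgg_simple w : rgg w \subset potential_edges n.
Proof. by apply/fintype.subsetP => e; rewrite !inE => /andP[]. Qed.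

Lemma adjacent_rgg w x y : adjacent (rgg w) (x, y) =
  (x != y) && (tau <= dotv (X x w) (X y w)).
Proof.
rewrite /adjacent !inE /= (dotvC (X y w)) -andb_orl -neq_ltn.
by rewrite val_eqE.
Qed.

Lemma rgg_adjacencyE w : rgg_adjacency tau (fun i => X i w) = er_adjacency (rgg w).
Proof.
apply/matrixP => i j; rewrite !mxE -adjacent_rgg //.
Qed.

Lemma measurable_rgg E : measurable [set w | rgg w = E].
Proof.
have -> : [set w | rgg w = E] = \bigcap_(e in [set: 'I_n * 'I_n])
    [set w | (e \in rgg w) = (e \in E)].
  apply/seteqP; split => w /= => [wE e _ /=|H]; first by rewrite wE.
  by apply/setP => e; exact: H.
apply: fin_bigcap_measurable => // -[x y] _.
have mxy := @measurable_near_ev R disp T P d n X tau x y.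
rewrite (_ : [set w | _] =
   if (x < y)%N then if (x, y) \in E then near_ev X tau x y
                     else ~` near_ev X tau x y
   else if (x, y) \in E then set0 else setT); last first.
  apply/seteqP; split => w /=; rewrite inE /=; case: ltnP => _ /=;
    case: ((x, y) \in E) => //=; rewrite /near_ev /=.
  - by move=> /negbT/negP.
  - by move=> /negP/negbTE.
by case: ifP => _; case: ifP => _ //; exact: measurableC.
Qed.

Definition rgg_mass E : R := fine (P [set w | rgg w = E]).

Lemma rgg_mass_simple (E : {set 'I_n * 'I_n}) : ~~ (E \subset potential_edges n) -> rgg_mass E = 0.
Proof.
move=> nE; rewrite /rgg_mass (_ : [set w | _] = set0) ?measure0//.
by apply/seteqP; split => w //= wE; rewrite -wE rgg_simple in nE.
Qed.

Lemma rgg_pi_loopless (L : seq ('I_n * 'I_n)) : (forall x, (x, x) \notin L) ->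
  graph_pi rgg_mass L = pr P (edges_ev X tau L).
Proof.
move=> nl.
have := probability_partition
  (fun E : {set 'I_n * 'I_n} => is_true (all (adjacent E) L)) measurable_rgg.
rewrite /pr.
have -> : [set w | all (adjacent (rgg w)) L] = edges_ev X tau L.
  apply/seteqP; split => w /= => [/allP aL [x y] xyL|H].
    by have := aL _ xyL; rewrite adjacent_rgg => /andP[].
  apply/allP => -[x y] xyL; rewrite adjacent_rgg (H _ xyL) andbT.
  by apply: contraTneq xyL => ->; exact: nl.
move=> ->; rewrite /=; apply: eq_bigr => E _.
by rewrite entry_prod_adj asboolb.
Qed.

End SphericalLaw.

Section SphericalTreeLike.
Context {R : realType} (disp : measure_display) (T : measurableType disp)
  (P : probability T R) (d n : nat) (X : 'I_n -> {RV P >-> @borel_rV R d}).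
Hypothesis hX : iid_uniform_on_sphere X.
Variables (u0 : 'rV[R]_d) (tau p : R).
Hypotheses (u01 : dotv u0 u0 = 1) (htau : is_threshold X p tau).

Lemma rgg_tree_like (beta gamma eps : R) : 0 <= p -> p <= 1 -> 0 < tau ->
  (forall v, cap (distribution P (X v)) u0 (1 / 8) <= beta * p) ->
  (forall v, cap (distribution P (X v)) u0 (4 / 3 * tau) <= gamma * p) ->
  0 <= beta -> 0 <= gamma -> p + beta + gamma <= eps ->
  tree_like p eps (graph_pi (rgg_mass X tau)).
Proof.
move=> p0 p1 tau0 hb hg b0 g0 le_eps.
have m0 E : 0 <= rgg_mass X tau E by exact: fine_ge0.
split.
- exact: graph_pi_ge0.
- exact: graph_pi_mono.
- by apply: graph_pi_loop => E; exact: rgg_mass_simple.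
- move=> F V fF; rewrite rgg_pi_loopless => [|x]; last exact: forest_loopless fF.
  exact: (pr_forest hX u01 htau fF).
- move=> F V x y fF xV yV xy xyF yxF.
  rewrite rgg_pi_loopless => [|z]; last first.
    rewrite in_cons negb_or (forest_loopless _ fF) andbT.
    by apply: contraNneq xy => -[-> ->].
  rewrite edges_ev_cons.
  apply: (le_trans (pr_forest_cycle hX u01 htau p0 p1 tau0 hb hg b0 g0 fF xV yV xy xyF yxF)).
  by rewrite ler_wpM2r// exprn_ge0.
Qed.

(** The budget eps is split into thirds for p, beta and gamma. The bound on p and [cap_lower_bound]
    give tau^2 >= k / (64 d), and (d - 1) / d >= 1/2 turns this into [kap <= 128 / k]. The two
    conditions on 128 / k then read 81 kap <= 1/2 and 4 kap <= eps / 6, as [cap_four_thirds]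
    requires. The exponential is the bound of [cap_expR_le] at height 1/8. *)
Lemma rgg_tree_like_eps (eps : R) (k : nat) : 0 < eps -> (1 < n)%N ->
  (0 < k)%N -> 128 / k%:R <= 1 / 162 :> R -> 128 / k%:R <= eps / 24 ->
  (k <= d)%N -> (2 < d)%N ->
  0 < p -> p <= 1 -> p <= eps / 3 -> p < 1 / (64 * 2 ^+ k) ->
  expR (- (d%:R / 256)) <= eps / 3 * p ->
  tree_like p eps (graph_pi (rgg_mass X tau)).
Proof.
move=> e0 n1 k0 k1 k2 kd d2 p0 p1 pe pk ed.
have D0 : 0 < d%:R :> R by rewrite ltr0n (ltn_trans _ d2).
have K0 : 0 < k%:R :> R by rewrite ltr0n.
have Pt v : cap (distribution P (X v)) u0 tau = p.
  have [x xv] : exists x : 'I_n, x != v.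
    have [v0|v0] := eqVneq v (Ordinal (ltnW n1)).
      by exists (Ordinal n1); rewrite v0.
    by exists (Ordinal (ltnW n1)); rewrite eq_sym.
  exact: (Phi_tau hX u01 htau xv).
pose v0 : 'I_n := Ordinal (ltnW n1).
have tau_lb : Num.sqrt (k%:R / d%:R) / 8 < tau.
  rewrite ltNge; apply/negP => le_tau.
  have := cap_lower_bound (hX.2 v0) u01 k0 kd d2.
  move=> /le_trans /(_ (cap_le _ _ le_tau)); rewrite (Pt v0).
  by rewrite leNgt pk.
have s0 : 0 < Num.sqrt (k%:R / d%:R) :> R by rewrite sqrtr_gt0 divr_gt0.
have tau0 : 0 < tau by rewrite (lt_trans _ tau_lb)// divr_gt0.
have tau2 : k%:R / d%:R / 64 <= tau ^+ 2.
  have : (Num.sqrt (k%:R / d%:R) / 8) ^+ 2 <= tau ^+ 2.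
    by rewrite ler_pXn2r ?nnegrE//; exact: ltW.
  rewrite exprMn sqr_sqrtr; last by rewrite divr_ge0// ltW.
  by move=> h; apply: le_trans h; lra.
have dd : d%:R = d.-1%:R + 1 :> R.
  by rewrite natr1 prednK//; exact: ltnW (ltnW d2).
have D1 : 2 <= d.-1%:R :> R.
  by rewrite ler_nat -ltnS prednK//; exact: ltnW (ltnW d2).
have D10 : 0 < d.-1%:R :> R by lra.
have tD : k%:R / 128 <= tau ^+ 2 * d.-1%:R.
  apply: (@le_trans _ _ (k%:R / d%:R / 64 * d.-1%:R)); last by rewrite ler_wpM2r// ltW.
  have -> : k%:R / d%:R / 64 * d.-1%:R = k%:R * (d.-1%:R / d%:R / 64) :> R by ring.
  rewrite ler_pM2l// ler_pdivlMr// ler_pdivlMr//; lra.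
have tD0 : 0 < tau ^+ 2 * d.-1%:R by rewrite mulr_gt0// exprn_gt0.
pose kap := 1 / (tau ^+ 2 * d.-1%:R).
have kap_le : kap <= 128 / k%:R.
  rewrite /kap ler_pdivrMr// mulrAC ler_pdivlMr// mul1r.
  by move: tD; rewrite ler_pdivrMr// mulrC.
have kap0 : 0 <= kap by rewrite divr_ge0// ltW.
apply: (@rgg_tree_like (eps / 3) (eps / 3)); rewrite ?(ltW p0)//; last first.
- by lra.
- by rewrite divr_ge0// ltW.
- by rewrite divr_ge0// ltW.
- move=> v; have := cap_four_thirds (hX.2 v) u01 tau0 (ltnW d2).
  rewrite (Pt v).
  have -> : 81 / (tau ^+ 2 * d.-1%:R) = 81 * kap by rewrite /kap mulrA mulr1.
  have -> : 4 / (tau ^+ 2 * d.-1%:R) = 4 * kap by rewrite /kap mulrA mulr1.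
  set C := cap _ _ _ => h.
  have C0 : 0 <= C by exact: cap_ge0.
  have h1 : 1 / 2 * C <= (1 - 81 * kap) * C by rewrite ler_wpM2r//; lra.
  have h2 : 4 * kap * p <= eps / 6 * p by rewrite ler_wpM2r ?(ltW p0)//; lra.
  by lra.
- move=> v; have t8 : 0 <= 1 / 8 :> R by [].
  apply: (le_trans (cap_expR_le (hX.2 v) u01 t8)).
  apply: le_trans ed; rewrite ler_expR lerN2.
  have -> : (1 / 8) ^+ 2 * d%:R / 4 = d%:R / 256 :> R by field.
  by [].
Qed.

End SphericalTreeLike.

Lemma rgg_tree_like_near (R : realType) (alpha : R) (halpha : 0 < alpha)
    (p : nat -> R) (hp : forall n, p n = alpha / n%:R)
    (d : nat -> nat) (hd : forall n, (0 < d n)%N)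
    (hdlog : (d n)%:R / ln n%:R @[n --> \oo] --> (+oo : set_system R))
    (disp : nat -> measure_display) (T : forall n, measurableType (disp n))
    (P : forall n, probability (T n) R)
    (X : forall n, 'I_n -> {RV P n >-> @borel_rV R (d n)})
    (hX : forall n, iid_uniform_on_sphere (X n))
    (tau : nat -> R)
    (htau : \forall n \near \oo, is_threshold (X n) (p n) (tau n))
    (eps : R) : 0 < eps ->
  \forall n \near \oo, tree_like (p n) eps (graph_pi (rgg_mass (X n) (tau n))).
Proof.
move=> e0.
have [k [k0 k1 k2]] : exists k, [/\ (0 < k)%N, 128 / k%:R <= 1 / 162 :> R &
    128 / k%:R <= eps / 24].
  pose c : R := 128 * 24 / eps; have c0 : 0 < c by rewrite divr_gt0.
  pose m := (Num.truncn (c + 128 * 162)).+1.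
  have mc : c + 128 * 162 <= m%:R by exact: ltW (truncnS_gt _).
  have m0 : 0 < m%:R :> R by lra.
  have ce : c * eps = 128 * 24 by rewrite /c mulfVK// gt_eqF.
  exists m; split => //; rewrite ler_pdivrMr//; first by lra.
  have : c * eps <= m%:R * eps by rewrite ler_pM2r//; lra.
  by lra.
near=> n.
(* Makes ln n at least k + 3, so that d, being at least 512 ln n, exceeds both k and 2. *)
have nbig : expR (k%:R + 3) <= n%:R :> R by near: n; exact: nbhs_infty_ger.
have npos : 0 < n%:R :> R by rewrite (lt_le_trans _ nbig)// expR_gt0.
have lnk : k%:R + 3 <= ln n%:R :> R by rewrite -ler_expR lnK// posrE.
have ln0 : 0 < ln n%:R :> R by have : 0 <= k%:R :> R by []; lra.
(* With 512 = 2 times 256, exp (- d / 256) is at most n^-2, which is o(p). *)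
have dn : 512 <= (d n)%:R / ln n%:R :> R.
  by near: n; move/cvgryPge : hdlog; exact.
have dln : 512 * ln n%:R <= (d n)%:R :> R by rewrite -ler_pdivlMr.
have dk : k%:R + 3 <= (d n)%:R :> R by lra.
have p0 : 0 < p n by rewrite hp divr_gt0.
have u01 := delta_unit (R := R) (Ordinal (hd n)).
have n1 : (1 < n)%N by near: n; exact: nbhs_infty_gt.
have th : is_threshold (X n) (p n) (tau n) by near: n.
apply: (rgg_tree_like_eps (hX n) u01 th e0 n1 k0 k1 k2) => //.
- by rewrite -(ler_nat R); lra.
- by rewrite -(ltr_nat R); have : 0 <= k%:R :> R by []; lra.
- rewrite hp ler_pdivrMr// mul1r.
  by near: n; exact: nbhs_infty_ger.
- rewrite hp ler_pdivrMr// mulrC -ler_pdivrMr ?divr_gt0//.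
  by near: n; exact: nbhs_infty_ger.
- rewrite hp ltr_pdivrMr// mulrC -ltr_pdivrMr ?divr_gt0 ?mulr_gt0 ?exprn_gt0//.
  by near: n; exact: nbhs_infty_gtr.
- apply: (@le_trans _ _ (expR (- (2 * ln n%:R)))).
    by rewrite ler_expR; lra.
  have -> : expR (- (2 * ln n%:R)) = n%:R^-1 * n%:R^-1 :> R.
    rewrite expRN (_ : 2 * ln n%:R = ln n%:R + ln n%:R :> R); last by ring.
    by rewrite expRD lnK ?posrE// invfM.
  rewrite hp mulrA; apply: ler_wpM2r; first by rewrite invr_ge0 ltW.
  rewrite -[leLHS]mul1r ler_pdivrMr// mulrC -ler_pdivrMr ?mulr_gt0 ?divr_gt0//.
  by near: n; exact: nbhs_infty_ger.
Unshelve. all: by end_near.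
Qed.

(** * Spectral means *)

Section EmpiricalSpectrum.
Context {R : realType} (n : nat).
Implicit Types B : 'M[R]_n.

Definition spectral_mean B (f : R -> R) : R :=
  n%:R^-1 * \sum_(i < n) f (eigenvalues B)`_i.

Lemma ge0_integral_esd B (g : R -> R) : measurable_fun setT g -> (forall x, 0 <= g x) ->
  (\int[esd B]_x (g x)%:E = (spectral_mean B g)%:E)%E.
Proof.
move=> mg g0.
have mg' : measurable_fun setT (EFin \o g) by exact/measurable_EFinP.
have g0' x : setT x -> (0 <= (EFin \o g) x)%E by move=> _; rewrite lee_fin.
rewrite /esd ge0_integral_mscale//=.
rewrite ge0_integral_measure_sum//=.
rewrite /spectral_mean EFinM -sumEFin; congr (_ * _)%E.
apply: eq_bigr => i _; rewrite integral_dirac//=.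
by rewrite diracT mul1e.
Qed.

Lemma Rintegral_esd B (f : R -> R) : measurable_fun setT f ->
  \int[esd B]_x f x = spectral_mean B f.
Proof.
move=> mf.
pose fp x := Num.max (f x) 0; pose fn x := Num.max (- f x) 0.
have mfp : measurable_fun setT fp by apply: measurable_maxr.
have mfn : measurable_fun setT fn.
  by apply: measurable_maxr => //; exact: measurableT_comp.
have fp0 x : 0 <= fp x by rewrite le_max lexx orbT.
have fn0 x : 0 <= fn x by rewrite le_max lexx orbT.
have ip (g : R -> R) : measurable_fun setT g -> (forall x, 0 <= g x) ->
    (esd B).-integrable setT (EFin \o g).
  move=> mg g0; apply/integrableP; split; first exact/measurable_EFinP.
  rewrite (_ : (fun x => `|(EFin \o g) x|%E) = (fun x => (g x)%:E)).
    by rewrite ge0_integral_esd// ltry.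
  by apply/funext => x /=; rewrite ger0_norm.
have fE x : f x = fp x - fn x.
  rewrite /fp /fn; have [h|] := boolP (0 <= f x).
    by rewrite max_l// max_r ?oppr_le0// subr0.
  rewrite -ltNge => /ltW h.
  by rewrite max_r// max_l ?oppr_ge0// add0r opprK.
transitivity (\int[esd B]_x (fp x - fn x)).
  by apply: eq_Rintegral => x _; exact: fE.
rewrite RintegralB//; try exact: ip.
rewrite /Rintegral !ge0_integral_esd//= /spectral_mean -mulrBr -sumrB.
by congr (_ * _); apply: eq_bigr => i _; rewrite fE.
Qed.

Lemma sum_eigenvalues B (f : R -> R) :
  \sum_(i < n) f (eigenvalues B)`_i =
  \sum_(i < n) f (complex.Re (spectral_diag (map_mx (real_complex R) B) 0 i)).
Proof.
have sz : size (eigenvalues B) = n by rewrite size_map size_enum_ord.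
rewrite -[LHS](big_mkord xpredT (fun i => f (eigenvalues B)`_i)).
rewrite -{1}sz -(big_nth 0 xpredT f) /eigenvalues big_map big_enum.
by [].
Qed.

Lemma sum_eigenvalues_pow B k : B^T = B ->
  \sum_(i < n) (eigenvalues B)`_i ^+ k = \tr (B ^+ k).
Proof.
move=> symB; rewrite (sum_eigenvalues B (fun x => x ^+ k)).
set A := map_mx (real_complex R) B; set D := spectral_diag A.
have hA : A \is hermsymmx.
  apply: realsym_hermsym.
    by rewrite qualifE /= expr0 scale1r map_mx_id // /A map_trmx symB.
  by apply/mxOverP => i j; rewrite mxE; rewrite /= complex.complex_real.
have /mxOverP rD := hermitian_spectral_diag_real hA.
have /orthomx_spectralP eA := hermitian_normalmx hA.
rewrite -/D in eA; set P := spectralmx A in eA.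
have uP : P \in unitmx by exact: spectral_unit.
apply: (@complexI R).
have -> : complex.real_complex R (\tr (B ^+ k)) = \tr (A ^+ k).
  have -> : A ^+ k = map_mx (real_complex R) (B ^+ k).
    elim: k => [|k IH]; first by rewrite !expr0 map_mx1.
    by rewrite !exprS IH -!mulmxE map_mxM.
  by rewrite rmorph_sum /=; apply: eq_bigr => i _; rewrite mxE.
have AE : A ^+ k = invmx P *m diag_mx (\row_i D 0 i ^+ k) *m P.
  elim: k => [|k IH].
    rewrite (_ : \row_i _ = const_mx 1); last by apply/rowP => i; rewrite !mxE.
    by rewrite diag_const_mx mulmx1 mulVmx.
  rewrite exprSr IH -mulmxE {1}eA !mulmxA (mulmxK uP); congr (_ *m _).
  rewrite -mulmxA mulmx_diag; congr (_ *m diag_mx _).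
  by apply/rowP => i; rewrite !mxE exprSr.
rewrite AE mxtrace_mulC mulmxA mulmxV// mul1mx mxtrace_diag rmorph_sum /=.
by apply: eq_bigr => i _; rewrite mxE rmorphXn/= RRe_real// rD.
Qed.

Lemma mxtrace_scaleX (c : R) B k : \tr ((c *: B) ^+ k) = c ^+ k * \tr (B ^+ k).
Proof.
rewrite (_ : (c *: B) ^+ k = c ^+ k *: (B ^+ k)) ?mxtraceZ//.
elim: k => [|k IH]; first by rewrite !expr0 scale1r.
by rewrite !exprS IH -!mulmxE -scalemxAl -scalemxAr scalerA.
Qed.

Lemma spectral_mean_pow B k : B^T = B ->
  spectral_mean B (fun x => x ^+ k) = n%:R^-1 * \tr (B ^+ k).
Proof. by move=> symB; rewrite /spectral_mean sum_eigenvalues_pow. Qed.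

End EmpiricalSpectrum.

(** * Polynomial approximation *)

Section Weierstrass.
Context {R : realType}.

(** Compactness of the segment, in the form of a near-covering with respect to eta tending to 0 from
    the right; z may leave the segment. *)
Lemma continuous_modulus (g : R -> R) (delta : R) : continuous g -> 0 < delta ->
  exists2 eta, 0 < eta & forall x z, 0 <= x <= 1 -> `|x - z| < eta -> `|g x - g z| < delta.
Proof.
move=> cg d0.
have cK : near_covering `[0, 1 : R]%classic.
  by apply/compact_near_coveringP; exact: segment_compact.
have /(_ _ _)[] := cK R (0^'+) (fun eta x => forall z, `|x - z| < eta -> `|g x - g z| < delta) _.
  move=> x _; have d20 : 0 < delta / 2 by rewrite divr_gt0.
  have /cvgrPdist_lt /(_ _ d20) /nbhs_ballP [r /= r0 xr] := cg x.
  have r20 : 0 < r / 2 by rewrite divr_gt0.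
  near=> x' eta => z /= x'z.
  have xx' : `|x - x'| < r / 2 by near: x'; exact: (nbhsx_ballx x _ r20).
  have er : eta < r / 2 by near: eta; exact: nbhs_right_lt.
  have h1 : `|g x - g x'| < delta / 2 by apply: xr; rewrite -ball_normE /=; lra.
  have h2 : `|g x - g z| < delta / 2.
    apply: xr; rewrite -ball_normE /=.
    by have := ler_distD x' x z; lra.
  by have := ler_distD (g x) (g x') (g z); rewrite (distrC (g x') (g x)); lra.
move=> e /= e0 He; exists (e / 2); first by rewrite divr_gt0.
move=> x z x01 xz; apply: (He (e / 2)) => //=.
- by rewrite sub0r normrN gtr0_norm ?divr_gt0//; lra.
- by rewrite divr_gt0.
Unshelve. all: by end_near.
Qed.

(* The Bernstein polynomial of degree N with nodes h 0, ..., h N: its value at y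
   is the mean of h at a binomial(N, y) variable, computed by conditioning on the
   first trial. *)
Fixpoint bernstein (N : nat) (h : nat -> R) : {poly R} :=
  if N is N'.+1 then 'X * bernstein N' (h \o S) + (1 - 'X) * bernstein N' h
  else (h 0%N)%:P.

Lemma bernsteinS N h y : (bernstein N.+1 h).[y] =
  y * (bernstein N (h \o S)).[y] + (1 - y) * (bernstein N h).[y].
Proof. by rewrite /= !hornerE. Qed.

Lemma bernstein_le N h1 h2 y : 0 <= y <= 1 -> (forall k, h1 k <= h2 k) ->
  (bernstein N h1).[y] <= (bernstein N h2).[y].
Proof.
move=> /andP[y0 y1]; elim: N h1 h2 => [|N IH] h1 h2 h12; first by rewrite !hornerC.
by rewrite !bernsteinS lerD// ler_wpM2l ?subr_ge0// IH// => k /=.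
Qed.

(** The second moment of a shifted binomial variable, with variance N y (1 - y). The shift b is kept
    general because conditioning on a successful first trial increases it by 1. *)
Lemma bernstein_quadratic N (a b c : R) y :
  (bernstein N (fun k => a * (k%:R + b) ^+ 2 + c)).[y] =
  a * ((N%:R * y + b) ^+ 2 + N%:R * y * (1 - y)) + c.
Proof.
elim: N b => [|N IH] b; first by rewrite hornerC; ring.
rewrite bernsteinS IH.
have -> : (fun k => a * (k%:R + b) ^+ 2 + c) \o S =
    (fun k => a * (k%:R + (b + 1)) ^+ 2 + c).
  by apply/funext => k /=; rewrite -natr1; ring.
by rewrite IH -natr1; ring.
Qed.

(** Chebyshev's argument: |g z - g y| <= delta / 2 + C (z - y)^2 for all z, by continuity near y and
    by boundedness elsewhere. Under the binomial mean the quadratic term becomes C y (1 - y) / N. *)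
Lemma weierstrass01 (g : R -> R) (M delta : R) : continuous g ->
  (forall x, `|g x| <= M) -> 0 < delta ->
  exists q : {poly R}, forall y, 0 <= y <= 1 -> `|g y - q.[y]| <= delta.
Proof.
move=> cg gM d0.
have M0 : 0 <= M by apply: le_trans (gM 0).
have d20 : 0 < delta / 2 by rewrite divr_gt0.
have [eta e0 He] := continuous_modulus cg d20.
pose C := 2 * M / eta ^+ 2.
have C0 : 0 <= C by rewrite divr_ge0 ?sqr_ge0 ?mulr_ge0.
pose N := (Num.truncn (C / delta)).+1.
have N0 : 0 < N%:R :> R by rewrite ltr0n.
have CN : C / N%:R <= delta.
  by rewrite ler_pdivrMr// mulrC -ler_pdivrMr//; exact: ltW (truncnS_gt _).
exists (bernstein N (fun k => g (k%:R / N%:R))) => y y01.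
have /andP[y0 y1] := y01.
have bnd z : `|g z - g y| <= delta / 2 + C * (z - y) ^+ 2.
  have [zy|zy] := ltrP `|y - z| eta.
    rewrite distrC; apply: (le_trans (ltW (He _ _ y01 zy))).
    by rewrite lerDl mulr_ge0// sqr_ge0.
  apply: (@le_trans _ _ (2 * M)).
    by rewrite (le_trans (ler_normB _ _))//; have := gM z; have := gM y; lra.
  apply: ler_wpDl; first exact: ltW.
  rewrite /C mulrAC ler_pdivlMr ?exprn_gt0// ler_wpM2l ?mulr_ge0//.
  rewrite -(real_normK (num_real (z - y))) distrC ler_pXn2r ?nnegrE//; exact: ltW.
have node k : C * (k%:R / N%:R - y) ^+ 2 = C / N%:R ^+ 2 * (k%:R + (- (N%:R * y))) ^+ 2.
  by field; rewrite gt_eqF.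
have var : C / N%:R ^+ 2 * ((N%:R * y + - (N%:R * y)) ^+ 2 + N%:R * y * (1 - y)) <= delta / 2.
  have -> : C / N%:R ^+ 2 * ((N%:R * y + - (N%:R * y)) ^+ 2 + N%:R * y * (1 - y)) =
      C / N%:R * (y * (1 - y)) by field; rewrite gt_eqF.
  have yy : y * (1 - y) <= 1 / 2 by have := sqr_ge0 (y - 1 / 2); nra.
  have yy0 : 0 <= y * (1 - y) by rewrite mulr_ge0// subr_ge0.
  have c0 : 0 <= C / N%:R by rewrite divr_ge0// ltW.
  by nra.
have up : (bernstein N (fun k => g (k%:R / N%:R))).[y] <= g y + delta.
  apply: le_trans (bernstein_le N y01 (h2 := fun k => C / N%:R ^+ 2 *
    (k%:R + (- (N%:R * y))) ^+ 2 + (g y + delta / 2)) _) _.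
    by move=> k; have := bnd (k%:R / N%:R); rewrite node ler_norml; lra.
  by rewrite bernstein_quadratic; lra.
have low : g y - delta <= (bernstein N (fun k => g (k%:R / N%:R))).[y].
  apply: le_trans (bernstein_le N y01 (h1 := fun k => - (C / N%:R ^+ 2) *
    (k%:R + (- (N%:R * y))) ^+ 2 + (g y - delta / 2)) _).
    by rewrite bernstein_quadratic; lra.
  by move=> k; have := bnd (k%:R / N%:R); rewrite node ler_norml; lra.
by rewrite ler_norml; lra.
Qed.

Lemma weierstrass (g : R -> R) (M delta : R) : continuous g ->
  (forall x, `|g x| <= M) -> 0 < delta ->
  exists q : {poly R}, forall y, -1 <= y <= 1 -> `|g y - q.[y]| <= delta.
Proof.
move=> cg gM d0; pose h x : R := g (2 * x - 1).
have ch : continuous h.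
  move=> x.
  have cl : (2 * y - 1) @[y --> x] --> 2 * x - 1.
    by apply: cvgB; [apply: cvgM; [exact: cvg_cst|exact: cvg_id]|exact: cvg_cst].
  exact: (cvg_comp _ _ cl (cg (2 * x - 1))).
have [q Hq] := weierstrass01 ch (fun x => gM _) d0.
exists (q \Po (2^-1 *: ('X + 1))) => y /andP[y1 y2].
rewrite horner_comp !hornerE.
have := Hq (2^-1 * (y + 1)); rewrite /h (_ : 2 * (2^-1 * (y + 1)) - 1 = y); last by field.
by apply; lra.
Qed.

End Weierstrass.

Section PolyApprox.
Context {R : realType}.
Implicit Types phi psi : R -> R.

Definition bounded_by phi (C : R) := forall x, `|phi x| <= C.

(** The rate t may not depend on delta: exponential moments bounded for this t then make the error
    small in mean square. Boundedness is included both for stability under products and to apply the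
    Erdos-Renyi hypothesis. *)
Definition poly_approx phi : Prop :=
  (exists C, bounded_by phi C) /\
  exists2 t, 0 <= t & forall delta, 0 < delta ->
    exists q : {poly R}, forall x, `|phi x - q.[x]| <= delta * expR (t * `|x|).

Lemma expR_normM_le (s t x : R) : s <= t -> expR (s * `|x|) <= expR (t * `|x|).
Proof. by move=> st; rewrite ler_expR ler_wpM2r. Qed.

Lemma expR_norm_ge1 (t x : R) : 0 <= t -> 1 <= expR (t * `|x|).
Proof. by move=> t0; rewrite -[leLHS]expR0 ler_expR mulr_ge0. Qed.

Lemma poly_approx_cst c : poly_approx (fun=> c).
Proof.
split; first by exists `|c|.
exists 0 => // delta d0; exists c%:P => x.
by rewrite hornerC subrr normr0 mulr_ge0// ?ltW// expR_gt0.
Qed.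

Lemma poly_approxD phi psi : poly_approx phi -> poly_approx psi ->
  poly_approx (fun x => phi x + psi x).
Proof.
move=> [[C hC] [s s0 hs]] [[D hD] [t t0 ht]]; split.
  by exists (C + D) => x; rewrite (le_trans (ler_normD _ _))// lerD.
exists (s + t); first exact: addr_ge0.
move=> delta d0; have d20 : 0 < delta / 2 by rewrite divr_gt0.
have [q hq] := hs _ d20; have [r hr] := ht _ d20.
exists (q + r) => x; rewrite hornerD.
have -> : phi x + psi x - (q.[x] + r.[x]) = (phi x - q.[x]) + (psi x - r.[x]) by ring.
have h1 : delta / 2 * expR (s * `|x|) <= delta / 2 * expR ((s + t) * `|x|).
  by rewrite ler_pM2l// expR_normM_le// lerDl.
have h2 : delta / 2 * expR (t * `|x|) <= delta / 2 * expR ((s + t) * `|x|).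
  by rewrite ler_pM2l// expR_normM_le// lerDr.
have := ler_normD (phi x - q.[x]) (psi x - r.[x]).
by have := hq x; have := hr x; lra.
Qed.

Lemma poly_approxM phi psi : poly_approx phi -> poly_approx psi ->
  poly_approx (fun x => phi x * psi x).
Proof.
move=> [[C hC] [s s0 hs]] [[D hD] [t t0 ht]]; split.
  by exists (C * D) => x; rewrite normrM ler_pM.
have C0 : 0 <= C by exact: le_trans (hC 0).
have D0 : 0 <= D by exact: le_trans (hD 0).
exists (s + t); first exact: addr_ge0.
move=> delta d0.
(* [d2] comes first: the error of q gets multiplied by r, whose size (D + d2) exp (t |x|) depends on
   [d2]. *)
pose d2 := delta / (2 * (C + 1)); pose d1 := delta / (2 * (D + d2 + 1)).
have d20 : 0 < d2 by rewrite divr_gt0//; lra.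
have d10 : 0 < d1 by rewrite divr_gt0//; lra.
have [q hq] := hs _ d10; have [r hr] := ht _ d20.
exists (q * r) => x; rewrite hornerM.
have -> : phi x * psi x - q.[x] * r.[x] =
    phi x * (psi x - r.[x]) + r.[x] * (phi x - q.[x]) by ring.
set e := expR ((s + t) * `|x|).
have es : expR (s * `|x|) * expR (t * `|x|) = e by rewrite -expRD -mulrDl.
have s1 := expR_norm_ge1 x s0; have t1 := expR_norm_ge1 x t0.
have et : expR (t * `|x|) <= e by rewrite expR_normM_le// lerDr.
have r_le : `|r.[x]| <= (D + d2) * expR (t * `|x|).
  have -> : r.[x] = psi x - (psi x - r.[x]) by ring.
  apply: (le_trans (ler_normB _ _)).
  rewrite mulrDl; apply: lerD => //.
  by rewrite (le_trans (hD x))// ler_peMr.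
apply: (le_trans (ler_normD _ _)); rewrite !normrM.
have h1 : `|phi x| * `|psi x - r.[x]| <= C * (d2 * e).
  apply: ler_pM => //; apply: (le_trans (hr x)); by rewrite ler_pM2l.
have h2 : `|r.[x]| * `|phi x - q.[x]| <= (D + d2) * d1 * e.
  rewrite -es (_ : _ * (_ * _) = (D + d2) * expR (t * `|x|) * (d1 * expR (s * `|x|))); last by ring.
  by apply: ler_pM.
have e0 : 0 < e by exact: expR_gt0.
have h3 : C * d2 <= delta / 2.
  rewrite /d2 mulrA ler_pdivrMr; last by lra.
  have : 0 <= delta by exact: ltW.
  by nra.
have h4 : (D + d2) * d1 <= delta / 2.
  rewrite /d1 mulrA ler_pdivrMr; last by lra.
  have : 0 <= delta by exact: ltW.
  by nra.
have h5 : C * d2 * e <= delta / 2 * e by rewrite ler_pM2r.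
have h6 : (D + d2) * d1 * e <= delta / 2 * e by rewrite ler_pM2r.
by rewrite mulrA in h1; lra.
Qed.

Lemma poly_approx_horner phi (q : {poly R}) : poly_approx phi ->
  poly_approx (fun x => q.[phi x]).
Proof.
move=> aphi; elim/poly_ind: q => [|q c IH].
  by under eq_fun do rewrite horner0; exact: poly_approx_cst.
under eq_fun do rewrite hornerMXaddC.
by apply: poly_approxD; [exact: poly_approxM|exact: poly_approx_cst].
Qed.

(** For k >= N, |y|^k / k! is at most 2^-N (2 |y|)^k / k!. Doubling the rate of the exponential thus
    buys a factor that is small uniformly in y. *)
Lemma sin_coeff_tail_le (y : R) N m :
  `|\sum_(N <= k < m) sin_coeff y k| <= 2^-1 ^+ N * expR (2 * `|y|).
Proof.
apply: (le_trans (ler_norm_sum _ _ _)).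
apply: (@le_trans _ _ (2^-1 ^+ N * \sum_(N <= k < m) (2 * `|y|) ^+ k / k`!%:R)).
  rewrite mulr_sumr big_nat_cond [leRHS]big_nat_cond; apply: ler_sum => k /andP[/andP[Nk _] _].
  rewrite /sin_coeff /= normrM normfV (ger0_norm (ler0n _ _)) mulrA.
  rewrite ler_wpM2r ?invr_ge0//.
  apply: (@le_trans _ _ (`|y| ^+ k)).
    rewrite !normrM normrX normrN1 expr1n mulr1 normrX ler_piMl ?exprn_ge0//.
    by rewrite ger0_norm// lern1; case: odd.
  rewrite exprMn mulrA ler_peMl ?exprn_ge0// -(subnK Nk) exprD mulrCA -exprMn mulVf//.
  by rewrite expr1n mulr1 exprn_ege1// ler1n.
rewrite ler_wpM2l ?exprn_ge0//.
have [mN|Nm] := leqP m N; first by rewrite big_geq// expR_ge0.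
apply: le_trans (sum_exp_coeff_le (z := 2 * `|y|) m _); last by rewrite mulr_ge0.
rewrite -(big_mkord xpredT (fun k => (2 * `|y|) ^+ k / k`!%:R)).
rewrite (big_cat_nat (leq0n N) (ltnW Nm))/= lerDr.
by apply: sumr_ge0 => k _; rewrite divr_ge0// exprn_ge0// mulr_ge0.
Qed.

Lemma sin_poly_le (y : R) N :
  `|sin y - \sum_(k < N) sin_coeff y k| <= 2^-1 ^+ N * expR (2 * `|y|).
Proof.
have cv : series (sin_coeff y) @ \oo --> sin y.
  by rewrite unlock; exact: is_cvg_series_sin_coeff.
have cv2 : (fun m => `|series (sin_coeff y) m - \sum_(k < N) sin_coeff y k|) @ \oo -->
    `|sin y - \sum_(k < N) sin_coeff y k|.
  by apply: cvg_norm; apply: cvgB => //; exact: cvg_cst.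
rewrite -(cvg_lim _ cv2)//; apply: limr_le.
  by apply/cvg_ex; eexists; exact: cv2.
near=> m.
have Nm : (N <= m)%N by near: m; exact: nbhs_infty_ge.
rewrite /series /= -(big_mkord xpredT) (big_cat_nat (leq0n N) Nm)/=.
by rewrite addrAC subrr add0r; exact: sin_coeff_tail_le.
Unshelve. all: by end_near.
Qed.

Lemma poly_approx_sin (s : R) : poly_approx (fun x => sin (s * x)).
Proof.
split.
  by exists 1 => x; rewrite ler_norml sin_geN1 sin_le1.
exists (2 * `|s|); first by rewrite mulr_ge0.
move=> delta d0.
pose N := (Num.truncn (delta^-1)).+1.
have Nd : 2^-1 ^+ N <= delta.
  rewrite exprVn invf_ple ?posrE ?exprn_gt0//.
  rewrite (le_trans (ltW (truncnS_gt _)))// -natrX ler_nat ltnW//.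
  exact: ltn_expl.
exists (\poly_(k < N) (sin_coeff s k)) => x.
have -> : (\poly_(k < N) (sin_coeff s k)).[x] = \sum_(k < N) sin_coeff (s * x) k.
  rewrite horner_poly; apply: eq_bigr => k _.
  by rewrite /sin_coeff /= exprMn; ring.
apply: (le_trans (sin_poly_le _ _)); rewrite normrM mulrA ler_wpM2r// ?expR_ge0//.
Qed.

(** With s = 1 / (2K), a point |x| <= K has |s x| <= 1/2 and is recovered as 2K asin (sin (s x)). So
    f is there a continuous function of sin (s x), which is replaced by a polynomial q. As q is
    controlled on all of [-1, 1], the function q (sin (s x)) stays bounded off the segment too. *)
Lemma approx_on_segment (f : R -> R) (C K delta : R) : continuous f ->
  bounded_by f C -> 0 < K -> 0 < delta ->
  exists phi, [/\ continuous phi, poly_approx phi, bounded_by phi (C + delta) &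
    forall x, `|x| <= K -> `|f x - phi x| <= delta].
Proof.
move=> cf fC K0 d0.
pose a : R := sin (1 / 2).
have pih := @pihalf_ge1 R.
have in_pih (x : R) : `|x| <= 1 -> x \in `[- (pi / 2), pi / 2].
  by rewrite ler_norml in_itv/= => /andP[x1 x2]; apply/andP; split; lra.
have half1 : `|1 / 2| <= 1 :> R by rewrite ger0_norm//; lra.
have a1 : a < 1.
  rewrite -sin_pihalf /a ltr_sin; [lra|exact: in_pih|].
  by rewrite in_itv/= lexx andbT; lra.
have a0 : 0 < a.
  by rewrite -sin0 /a ltr_sin; [lra|apply: in_pih; rewrite normr0|exact: in_pih].
(* Truncation to [-a, a], which keeps the argument of [asin] inside (-1, 1), where it is
   continuous. *)
pose clamp (y : R) := (`|y + a| - `|y - a|) / 2.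
have clampE y : `|y| <= a -> clamp y = y.
  rewrite ler_norml => /andP[y1 y2]; rewrite /clamp.
  rewrite (ger0_norm (x := y + a)); last by lra.
  by rewrite (ler0_norm (x := y - a)); lra.
have clamp_le y : - a <= clamp y <= a.
  rewrite /clamp.
  have := ler_normD (y + a) (- (2 * a)); have := ler_normD (y - a) (2 * a).
  rewrite normrN (ger0_norm (x := 2 * a)); last by lra.
  rewrite (_ : y + a - 2 * a = y - a); last by ring.
  by rewrite (_ : y - a + 2 * a = y + a); [lra|ring].
have clamp_cts : continuous clamp.
  move=> y; apply: cvgM; last exact: cvg_cst.
  apply: cvgB; apply: cvg_norm.
    by apply: cvgD; [exact: cvg_id|exact: cvg_cst].
  by apply: cvgB; [exact: cvg_id|exact: cvg_cst].
pose s := (2 * K)^-1.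
pose g (y : R) := f (2 * K * asin (clamp y)).
have cg : continuous g.
  move=> y; have /andP[c1 c2] := clamp_le y.
  have c3 : -1 < clamp y < 1 by apply/andP; split; lra.
  have ca : (2 * K * asin (clamp z)) @[z --> y] --> 2 * K * asin (clamp y).
    apply: cvgM; first exact: cvg_cst.
    exact: (cvg_comp _ _ (clamp_cts y) (continuous_asin c3)).
  exact: (cvg_comp _ _ ca (cf _)).
have gC y : `|g y| <= C by exact: fC.
have [q hq] := weierstrass cg gC d0.
exists (fun x => q.[sin (s * x)]); split.
- move=> x.
  have cs : sin (s * z) @[z --> x] --> sin (s * x).
    have cl : (s * z) @[z --> x] --> s * x.
      by apply: cvgM; [exact: cvg_cst|exact: cvg_id].
    exact: (cvg_comp _ _ cl (@continuous_sin R (s * x))).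
  exact: (cvg_comp _ _ cs (@continuous_horner R q _)).
- exact/poly_approx_horner/poly_approx_sin.
- move=> x; have := hq (sin (s * x)); rewrite sin_geN1 sin_le1 => /(_ isT) h.
  set z := sin _ in h *.
  have -> : q.[z] = g z - (g z - q.[z]) by ring.
  by rewrite (le_trans (ler_normB _ _))// lerD.
- move=> x xK; have := hq (sin (s * x)); rewrite sin_geN1 sin_le1 => /(_ isT).
  have sx : `|s * x| <= 1 / 2.
    rewrite normrM gtr0_norm ?invr_gt0 ?mulr_gt0// /s invfM -mulrA.
    by rewrite div1r ler_piMr// mulrC ler_pdivrMr// mul1r.
  rewrite ler_norml in sx; have /andP[sx1 sx2] := sx.
  have sx3 : `|s * x| <= 1 by rewrite ler_norml; lra.
  have sin_a : `|sin (s * x)| <= a.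
    rewrite ler_norml /a -sinN !leNgt !ltr_sin -?leNgt ?sx1 ?sx2//;
      do ?[exact: in_pih]; by rewrite in_pih ?normrN.
  rewrite /g clampE// sinK ?in_pih//.
  by rewrite /s mulrA divff ?mul1r// mulf_neq0// gt_eqF.
Qed.

End PolyApprox.

(** * Comparison of the two models *)

Section SpectralMean.
Context {R : realType} (n : nat).
Hypothesis n0 : (0 < n)%N.
Implicit Types (B : 'M[R]_n) (f g : R -> R).

Let nR : n%:R != 0 :> R. Proof. by rewrite pnatr_eq0 -lt0n. Qed.

Lemma spectral_mean_cst B c : spectral_mean B (fun=> c) = c.
Proof. by rewrite /spectral_mean sumr_const card_ord -[c *+ n]mulr_natl mulKf. Qed.

Lemma spectral_meanD B f g :
  spectral_mean B (fun x => f x + g x) = spectral_mean B f + spectral_mean B g.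
Proof. by rewrite /spectral_mean big_split mulrDr. Qed.

Lemma spectral_meanZ B c f : spectral_mean B (fun x => c * f x) = c * spectral_mean B f.
Proof. by rewrite /spectral_mean -mulr_sumr mulrCA. Qed.

Lemma spectral_mean_le B f g : (forall x, f x <= g x) ->
  spectral_mean B f <= spectral_mean B g.
Proof.
by move=> fg; rewrite /spectral_mean ler_wpM2l ?invr_ge0//; apply: ler_sum => i _.
Qed.

Lemma spectral_mean_norm B f : `|spectral_mean B f| <= spectral_mean B (fun x => `|f x|).
Proof.
rewrite /spectral_mean normrM ger0_norm ?invr_ge0// ler_wpM2l ?invr_ge0//.
exact: ler_norm_sum.
Qed.

Lemma spectral_mean_sum B K (F : 'I_K -> R -> R) :
  spectral_mean B (fun x => \sum_k F k x) = \sum_k spectral_mean B (F k).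
Proof. by rewrite /spectral_mean exchange_big -mulr_sumr. Qed.

Lemma spectral_mean_sqr_le B f : spectral_mean B f ^+ 2 <= spectral_mean B (fun x => f x ^+ 2).
Proof.
set m := spectral_mean B f.
have : 0 <= spectral_mean B (fun x => f x ^+ 2 + ((- 2 * m) * f x + m ^+ 2)).
  rewrite -[leLHS](spectral_mean_cst B 0); apply: spectral_mean_le => x.
  have -> : f x ^+ 2 + ((- 2 * m) * f x + m ^+ 2) = (f x - m) ^+ 2 by ring.
  exact: sqr_ge0.
rewrite !spectral_meanD spectral_meanZ spectral_mean_cst -/m; nra.
Qed.

End SpectralMean.

Section GraphMean.
Context {R : realType} (n : nat).
Implicit Types u f g : {set 'I_n * 'I_n} -> R.

Lemma graph_meanD u f g : graph_mean u (fun E => f E + g E) = graph_mean u f + graph_mean u g.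
Proof. by rewrite /graph_mean -big_split; apply: eq_bigr => E _; rewrite mulrDr. Qed.

Lemma graph_meanZ u c f : graph_mean u (fun E => c * f E) = c * graph_mean u f.
Proof. by rewrite /graph_mean mulr_sumr; apply: eq_bigr => E _; rewrite mulrCA. Qed.

Lemma graph_mean_sum u I (r : seq I) (F : I -> {set 'I_n * 'I_n} -> R) :
  graph_mean u (fun E => \sum_(i <- r) F i E) = \sum_(i <- r) graph_mean u (F i).
Proof. by rewrite /graph_mean exchange_big; apply: eq_bigr => E _; rewrite mulr_sumr. Qed.

Lemma graph_mean_le u f g : (forall E, 0 <= u E) -> (forall E, f E <= g E) ->
  graph_mean u f <= graph_mean u g.
Proof. by move=> u0 fg; apply: ler_sum => E _; rewrite ler_wpM2l. Qed.

Lemma er_adjacency_sym (E : {set 'I_n * 'I_n}) : (er_adjacency E : 'M[R]_n)^T = er_adjacency E.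
Proof. by apply/matrixP => i j; rewrite !mxE orbC. Qed.

Definition scaled_adj (c : R) (E : {set 'I_n * 'I_n}) : 'M[R]_n := c *: er_adjacency E.

Lemma spectral_mean_pow_adj c E k :
  spectral_mean (scaled_adj c E) (fun x => x ^+ k) =
  n%:R^-1 * (c ^+ k * \tr (er_adjacency E ^+ k)).
Proof.
rewrite spectral_mean_pow ?mxtrace_scaleX//.
by rewrite /scaled_adj linearZ/= er_adjacency_sym.
Qed.

Lemma spectral_mean_horner c E (q : {poly R}) :
  spectral_mean (scaled_adj c E) (fun x => q.[x]) =
  \sum_(k < size q) q`_k * c ^+ k * (n%:R^-1 * \tr (er_adjacency E ^+ k)).
Proof.
rewrite (_ : (fun x => q.[x]) = fun x => \sum_(k < size q) q`_k * x ^+ k); last first.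
  by apply/funext => x; rewrite horner_coef.
rewrite spectral_mean_sum; apply: eq_bigr => k _.
by rewrite spectral_meanZ spectral_mean_pow_adj; ring.
Qed.

Definition poly_const (a c : R) (q : {poly R}) : R :=
  \sum_(k < size q) \sum_(l < size q) `|q`_k * c ^+ k * (q`_l * c ^+ l)| *
    walk_const a (behead (trace_walk k ++ trace_walk l)) 1.

Lemma mean_horner2_diff_le (p eps c : R) u1 u2 (q : {poly R}) :
  tree_like p eps (graph_pi u1) -> tree_like p eps (graph_pi u2) ->
  0 <= p -> 0 <= eps -> (0 < n)%N ->
  `|graph_mean u1 (fun E => spectral_mean (scaled_adj c E) (fun x => q.[x]) ^+ 2) -
    graph_mean u2 (fun E => spectral_mean (scaled_adj c E) (fun x => q.[x]) ^+ 2)|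
  <= eps * poly_const (n%:R * p) c q.
Proof.
move=> tl1 tl2 p0 eps0 n0.
have nR : 0 < n%:R :> R by rewrite ltr0n.
have expand u : graph_mean u (fun E => spectral_mean (scaled_adj c E) (fun x => q.[x]) ^+ 2) =
    \sum_(k < size q) \sum_(l < size q) (q`_k * c ^+ k * (q`_l * c ^+ l)) *
      (n%:R ^- 2 * graph_mean u (fun E => \tr (er_adjacency E ^+ k) * \tr (er_adjacency E ^+ l))).
  under [in LHS]eq_fun do rewrite spectral_mean_horner expr2 mulr_suml.
  rewrite graph_mean_sum; apply: eq_bigr => k _.
  under [in LHS]eq_fun do rewrite mulr_sumr.
  rewrite graph_mean_sum; apply: eq_bigr => l _.
  rewrite -!graph_meanZ; congr graph_mean; apply/funext => E.
  by field; rewrite gt_eqF.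
rewrite !expand -sumrB; apply: (le_trans (ler_norm_sum _ _ _)).
rewrite /poly_const mulr_sumr; apply: ler_sum => k _.
rewrite -sumrB; apply: (le_trans (ler_norm_sum _ _ _)).
rewrite mulr_sumr; apply: ler_sum => l _.
rewrite -!mulrBr normrM [leRHS]mulrCA ler_wpM2l// normrM ger0_norm ?invr_ge0 ?exprn_ge0//.
rewrite mulrC ler_pdivrMr ?exprn_gt0//.
apply: (le_trans (mean_trace2_diff_le k l tl1 tl2 p0 eps0 n0)).
by rewrite le_eqVlt; apply/orP; left; apply/eqP; ring.
Qed.

(** A walk sum of values of [graph_pi u], which are nonnegative by [tl_ge0]; a second trace of order
    0 only contributes a factor n. *)
Lemma mean_trace_ge0 (p eps : R) u k : tree_like p eps (graph_pi u) -> (0 < n)%N ->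
  0 <= graph_mean u (fun E => \tr (er_adjacency E ^+ k)).
Proof.
move=> tl n0; have := walk_sum_trace2 u k 0 (Ordinal n0).
have -> : graph_mean u (fun E => \tr (er_adjacency E ^+ k) * \tr (er_adjacency E ^+ 0)) =
    n%:R * graph_mean u (fun E => \tr (er_adjacency E ^+ k)).
  rewrite -graph_meanZ; congr graph_mean; apply/funext => E.
  by rewrite expr0 mxtrace1 mulrC.
move=> e; have := walk_sum_ge0 tl (trace_walk k ++ trace_walk 0) (Ordinal n0) (Ordinal n0) [::].
by rewrite e pmulr_rge0// ltr0n.
Qed.

(** Nonnegative mean traces allow s c to be replaced by |s c| in every term, so [mean_trace_exp_le]
    bounds all the partial sums. The bound passes to the limit because the means are finite sums; it
    does not involve eps. *)
Lemma mean_expR_le (p eps c s : R) u : tree_like p eps (graph_pi u) ->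
  (forall E, 0 <= u E) -> 0 <= p -> p <= 1 -> (0 < n)%N ->
  graph_mean u (fun E => spectral_mean (scaled_adj c E) (fun x => expR (s * x))) <=
  expR (`|s * c| + n%:R * p * expR `|s * c|).
Proof.
move=> tl u0 p0 p1 n0.
have nR : 0 < n%:R :> R by rewrite ltr0n.
pose S K := graph_mean u (fun E => spectral_mean (scaled_adj c E)
  (fun x => \sum_(k < K) (s * x) ^+ k / k`!%:R)).
have SK K : S K <= expR (`|s * c| + n%:R * p * expR `|s * c|).
  have -> : S K = \sum_(k < K) (s * c) ^+ k / k`!%:R *
      (n%:R^-1 * graph_mean u (fun E => \tr (er_adjacency E ^+ k))).
    rewrite /S; under eq_fun do rewrite spectral_mean_sum.
    rewrite graph_mean_sum; apply: eq_bigr => k _.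
    rewrite -!graph_meanZ; congr graph_mean; apply/funext => E.
    under eq_fun do rewrite exprMn mulrAC.
    by rewrite spectral_meanZ spectral_mean_pow_adj exprMn; ring.
  have tl_le := mean_trace_exp_le K tl p0 p1 (normr_ge0 (s * c)).
  rewrite -(ler_pM2l nR); apply: le_trans tl_le.
  rewrite mulr_sumr; apply: ler_sum => k _.
  rewrite (_ : n%:R * _ = (s * c) ^+ k / k`!%:R *
    graph_mean u (fun E => \tr (er_adjacency E ^+ k))); last first.
    by field; rewrite !pnatr_eq0 -!lt0n fact_gt0 n0.
  rewrite ler_wpM2r ?(mean_trace_ge0 k tl)// ler_wpM2r ?invr_ge0//.
  by rewrite (le_trans (ler_norm _))// normrX.
have cvS : S @ \oo --> graph_mean u
    (fun E => spectral_mean (scaled_adj c E) (fun x => expR (s * x))).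
  apply: cvg_big => [|E _]; first exact: add_continuous.
  apply: cvgM; first exact: cvg_cst.
  apply: cvgM; first exact: cvg_cst.
  apply: cvg_big => [|i _]; first exact: add_continuous.
  have := is_cvg_series_exp_coeff (s * (eigenvalues (scaled_adj c E))`_i).
  rewrite /expR /series /=.
  by under eq_fun do rewrite big_mkord.
rewrite -(cvg_lim _ cvS)//; apply: limr_le; first by apply/cvg_ex; eexists; exact: cvS.
exact: nearW.
Qed.

Lemma mean_expR_norm_le (p eps c t : R) u : tree_like p eps (graph_pi u) ->
  (forall E, 0 <= u E) -> 0 <= p -> p <= 1 -> (0 < n)%N ->
  graph_mean u (fun E => spectral_mean (scaled_adj c E) (fun x => expR (t * `|x|))) <=
  2 * expR (`|t * c| + n%:R * p * expR `|t * c|).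
Proof.
move=> tl u0 p0 p1 n0.
apply: (@le_trans _ _ (graph_mean u (fun E => spectral_mean (scaled_adj c E)
    (fun x => expR (t * x)) + spectral_mean (scaled_adj c E) (fun x => expR (- t * x))))).
  apply: graph_mean_le => // E; rewrite -spectral_meanD; apply: spectral_mean_le => // x /=.
  have [x0|x0] := lerP 0 x; rewrite ?(ger0_norm x0) ?(ltr0_norm x0).
    by rewrite lerDl expR_ge0.
  by rewrite mulrN -mulNr lerDr expR_ge0.
rewrite graph_meanD mulr_natl mulr2n; apply: lerD; first exact: mean_expR_le tl u0 p0 p1 n0.
have := mean_expR_le c (- t) tl u0 p0 p1 n0.
by rewrite mulNr normrN.
Qed.

End GraphMean.

Section Transfer.
Context {R : realType} (n : nat).
Local Notation sm c E phi := (spectral_mean (@scaled_adj R n c E) phi).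

Lemma graph_mean_sqr_le (u : {set 'I_n * 'I_n} -> R) (f g h : {set 'I_n * 'I_n} -> R) :
  (forall E, 0 <= u E) -> (forall E, f E = g E + h E) ->
  graph_mean u (fun E => f E ^+ 2) <=
  2 * graph_mean u (fun E => g E ^+ 2) + 2 * graph_mean u (fun E => h E ^+ 2).
Proof.
move=> u0 fE; rewrite -!graph_meanZ -graph_meanD; apply: graph_mean_le => // E.
by rewrite fE; have := sqr_ge0 (g E - h E); nra.
Qed.

(** From phi to q under [u1], from [u1] to [u2] for the polynomial q - b, and from q back to phi
    under [u2]. Each exchange of phi and q costs a factor 2 by (g + h)^2 <= 2 g^2 + 2 h^2, whence 4
    + 8 = 12, 2 and 4. Jensen's inequality squares the weight, which doubles t. *)
Lemma mean_sqr_transfer (p eps c b t delta : R) u1 u2 (phi : R -> R) (q : {poly R}) :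
  tree_like p eps (graph_pi u1) -> tree_like p eps (graph_pi u2) ->
  (forall E, 0 <= u1 E) -> (forall E, 0 <= u2 E) ->
  0 <= p -> p <= 1 -> 0 <= eps -> 0 <= delta -> (0 < n)%N ->
  (forall x, `|phi x - q.[x]| <= delta * expR (t * `|x|)) ->
  graph_mean u1 (fun E => (sm c E phi - b) ^+ 2) <=
  12 * (delta ^+ 2 * expR (`|2 * t * c| + n%:R * p * expR `|2 * t * c|)) +
  2 * (eps * poly_const (n%:R * p) c (q - b%:P)) +
  4 * graph_mean u2 (fun E => (sm c E phi - b) ^+ 2).
Proof.
move=> tl1 tl2 u10 u20 p0 p1 e0 d0 n0 hq.
set D := expR (_ + _).
have close u : tree_like p eps (graph_pi u) -> (forall E, 0 <= u E) ->
    graph_mean u (fun E => (sm c E phi - sm c E (fun x => q.[x])) ^+ 2) <=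
    delta ^+ 2 * (2 * D).
  move=> tl u0.
  apply: (@le_trans _ _ (graph_mean u (fun E =>
      delta ^+ 2 * sm c E (fun x => expR (2 * t * `|x|))))).
    apply: graph_mean_le => // E.
    have -> : sm c E phi - sm c E (fun x => q.[x]) = sm c E (fun x => phi x - q.[x]).
      rewrite -mulN1r -(spectral_meanZ (scaled_adj c E)) -spectral_meanD.
      by congr spectral_mean; apply/funext => x; rewrite mulN1r.
    apply: (le_trans (spectral_mean_sqr_le n0 _ _)).
    rewrite -spectral_meanZ; apply: spectral_mean_le => x.
    have -> : expR (2 * t * `|x|) = expR (t * `|x|) ^+ 2.
      by rewrite expr2 -expRD; congr expR; ring.
    rewrite -exprMn -(real_normK (num_real (phi x - _))).
    by rewrite ler_pXn2r// nnegrE// mulr_ge0// expR_ge0.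
  rewrite graph_meanZ ler_wpM2l ?exprn_ge0//.
  exact: (mean_expR_norm_le c (2 * t) tl u0 p0 p1 n0).
have shift (E : {set 'I_n * 'I_n}) : sm c E (fun x => (q - b%:P).[x]) = sm c E (fun x => q.[x]) - b.
  rewrite -[in RHS](spectral_mean_cst n0 (scaled_adj c E) (- b)) -spectral_meanD.
  by congr spectral_mean; apply/funext => x; rewrite !hornerE.
have d1 (E : {set 'I_n * 'I_n}) : sm c E phi - b =
    (sm c E phi - sm c E (fun x => q.[x])) + (sm c E (fun x => q.[x]) - b) by ring.
have d2 (E : {set 'I_n * 'I_n}) : sm c E (fun x => q.[x]) - b =
    (sm c E (fun x => q.[x]) - sm c E phi) + (sm c E phi - b) by ring.
have h1 := graph_mean_sqr_le u10 d1.
have h2 := graph_mean_sqr_le u20 d2.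
have h3 := mean_horner2_diff_le c (q - b%:P) tl1 tl2 p0 e0 n0.
have c1 := close u1 tl1 u10; have c2 := close u2 tl2 u20.
have e2 : graph_mean u2 (fun E => (sm c E (fun x => q.[x]) - sm c E phi) ^+ 2) =
  graph_mean u2 (fun E => (sm c E phi - sm c E (fun x => q.[x])) ^+ 2).
  by congr graph_mean; apply/funext => E; ring.
rewrite e2 in h2.
have s1 u : graph_mean u (fun E => sm c E (fun x => (q - b%:P).[x]) ^+ 2) =
    graph_mean u (fun E => (sm c E (fun x => q.[x]) - b) ^+ 2).
  by congr graph_mean; apply/funext => E; rewrite shift.
rewrite !s1 ler_norml in h3.
by lra.
Qed.

End Transfer.

(** * Convergence in mean square *)

Section Limits.
Context {R : realType}.
Local Notation sm c E phi := (spectral_mean (scaled_adj c E) phi).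

Lemma bounded_continuous_integrable (nu : probability R R) (f : R -> R) C :
  continuous f -> bounded_by f C -> nu.-integrable setT (EFin \o f).
Proof.
move=> cf fC; apply: measurable_bounded_integrable => //.
- by rewrite (le_lt_trans (probability_le1 nu measurableT))// ltry.
- exact: continuous_measurable_fun.
- exists C; split; first exact: num_real.
  by move=> y My z _; exact: le_trans (fC z) (ltW My).
Qed.

Lemma measurable_norm_gt (K : R) : measurable [set x : R | K < `|x|].
Proof.
have -> : [set x : R | K < `|x|] = setT `&` (fun x : R => `|x|) @^-1` `]K, +oo[.
  by rewrite setTI; apply/seteqP; split => x /=; rewrite in_itv/= andbT.
exact: (@normr_measurable R setT).
Qed.

Lemma probability_tail (nu : probability R R) (eta : R) : 0 < eta ->
  \forall k \near \oo, fine (nu [set x | k%:R < `|x|]) < eta.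
Proof.
move=> eta0; pose F (k : nat) := [set x : R | k%:R < `|x|].
have mF k : measurable (F k) by exact: measurable_norm_gt.
have F0 : \bigcap_k F k = set0.
  apply/seteqP; split => x //= Fx.
  have : ((Num.truncn `|x|).+1%:R : R) < `|x| := Fx (Num.truncn `|x|).+1 I.
  by rewrite ltNge (ltW (truncnS_gt _)).
have cF : (nu \o F) @ \oo --> nu (\bigcap_k F k).
  apply: nonincreasing_cvg_mu => //.
  - by rewrite (le_lt_trans (probability_le1 nu (mF 0%N)))// ltry.
  - by rewrite F0.
  - move=> k l kl; apply/subsetPset => x /=; apply: le_lt_trans.
    by rewrite ler_nat.
rewrite F0 measure0 in cF.
have /fine_cvgP[_ /cvgrPdist_lt/(_ _ eta0)] := cF.
apply: filterS => k /=; rewrite sub0r normrN; apply: le_lt_trans.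
exact: ler_norm.
Qed.

Lemma Rintegral_dist_le (nu : probability R R) (f phi : R -> R) (C B delta K : R) :
  continuous f -> continuous phi -> bounded_by f C -> bounded_by phi C ->
  (forall x, `|f x - phi x| <= B) -> 0 <= delta ->
  (forall x, `|x| <= K -> `|f x - phi x| <= delta) ->
  `|\int[nu]_x phi x - \int[nu]_x f x| <= delta + B * fine (nu [set x | K < `|x|]).
Proof.
move=> cf cphi fC phiC fB d0 fd.
have mF := measurable_norm_gt K.
have i1 := bounded_continuous_integrable nu cf fC.
have i2 := bounded_continuous_integrable nu cphi phiC.
have B0 : 0 <= B by exact: le_trans (fB 0).
have cd : continuous (fun x => phi x - f x) by move=> x; apply: cvgB; [exact: cphi|exact: cf].
have dC : bounded_by (fun x => phi x - f x) (C + C).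
  by move=> x; rewrite (le_trans (ler_normB _ _))// lerD.
have i3 := bounded_continuous_integrable nu cd dC.
rewrite -RintegralB//; apply: (le_trans (le_normr_Rintegral _ i3)) => //.
have i4 : nu.-integrable setT (EFin \o (fun x => delta + B * \1_[set x : R | K < `|x|] x)).
  apply: measurable_bounded_integrable => //.
  - by rewrite (le_lt_trans (probability_le1 nu measurableT))// ltry.
  - by apply: measurable_funD => //; apply: measurable_funM => //; exact: measurable_indic.
  - exists (delta + B); split; first exact: num_real.
    move=> y My z _; apply: le_trans (ltW My).
    rewrite ger0_norm ?addr_ge0 ?mulr_ge0 ?indicE//.
    by rewrite lerD2l ler_piMr// lern1; case: (_ \in _).
have i5 : nu.-integrable setT (EFin \o (fun=> delta)).
  by apply: (@bounded_continuous_integrable _ _ `|delta|) => // x; exact: cvg_cst.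
have i6 : nu.-integrable setT (EFin \o (\1_[set x : R | K < `|x|])).
  exact: integrable_indic.
apply: (@le_trans _ _ (\int[nu]_x (delta + B * \1_[set x : R | K < `|x|] x))).
  apply: le_Rintegral => //; first exact: integrable_norm.
  move=> x _; rewrite distrC indicE; have [Kx|Kx] := ltrP K `|x|.
    by rewrite mem_set// mulr1 ler_wpDl.
  by rewrite ler_wpDr ?mulr_ge0// fd.
rewrite RintegralD//; last first.
  have := integrableZl measurableT B i6.
  by apply: eq_integrable => // x _ /=; rewrite EFinM.
rewrite RintegralZl// Rintegral_cst// [X in delta * fine X]probability_setT mulr1.
by rewrite /Rintegral integral_indic// setIT.
Qed.

(** For bounded phi, convergence in probability implies convergence in mean square: deviations below
    e contribute e^2 = eta / 2, the others at most M times their probability. The known Erdos-Renyi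
    convergence enters here. *)
Lemma er_mean_sqr_near (alpha : R) (nu : probability R R) (phi : R -> R) C eta :
  0 < alpha -> is_er_limit alpha nu -> continuous phi -> bounded_by phi C -> 0 < eta ->
  \forall n \near \oo,
    graph_mean (@er_mass R n (alpha / n%:R)) (fun E =>
      (sm (Num.sqrt alpha)^-1 E phi - \int[nu]_x phi x) ^+ 2) <= eta.
Proof.
move=> a0 hnu cphi phiC eta0.
set b := \int[nu]_x phi x; set c := (Num.sqrt alpha)^-1.
pose M := (C + `|b|) ^+ 2.
have M0 : 0 <= M by exact: sqr_ge0.
pose e := Num.sqrt (eta / 2).
have e0 : 0 < e by rewrite sqrtr_gt0 divr_gt0.
have ee : e ^+ 2 = eta / 2 by rewrite sqr_sqrtr// divr_ge0// ltW.
have g0 : 0 < eta / (2 * (M + 1)) by rewrite divr_gt0//; lra.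
have := hnu phi cphi (ex_intro _ C phiC) e e0.
move=> /fine_cvgP[_ /cvgrPdist_lt/(_ _ g0)] H.
near=> n.
have n0 : (0 < n)%N by near: n; exact: nbhs_infty_gt.
have nR : 0 < n%:R :> R by rewrite ltr0n.
have p0 : 0 <= alpha / n%:R by rewrite divr_ge0// ltW.
have p1 : alpha / n%:R <= 1.
  by rewrite ler_pdivrMr// mul1r; near: n; exact: nbhs_infty_ger.
have : `|0 - fine (@er_law R n (alpha / n%:R)
      [set E | e <= `|\int[esd (scaled_adj c E)]_x phi x - b|])|
    < eta / (2 * (M + 1)) by near: n.
rewrite sub0r normrN er_lawE /= => /(le_lt_trans (ler_norm _)).
set Pr := \sum_E _ => PrE.
apply: (@le_trans _ _ (e ^+ 2 + M * Pr)); last first.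
  have : M * Pr <= M * (eta / (2 * (M + 1))) by rewrite ler_wpM2l// ltW.
  have : M * (eta / (2 * (M + 1))) <= eta / 2.
    by rewrite mulrA ler_pdivrMr; [nra|lra].
  by rewrite ee; lra.
have -> : e ^+ 2 + M * Pr = graph_mean (@er_mass R n (alpha / n%:R))
    (fun E => e ^+ 2 + M * `[< e <= `|\int[esd (scaled_adj c E)]_x phi x - b| >]%:R).
  rewrite graph_meanD graph_meanZ; congr (_ + _).
  by rewrite /graph_mean -mulr_suml er_mass_sum1 mul1r.
apply: graph_mean_le => [E|E]; first exact: er_mass_ge0.
rewrite Rintegral_esd; last exact: continuous_measurable_fun.
set Y := spectral_mean _ _.
have YM : `|Y - b| <= C + `|b|.
  apply: (le_trans (ler_normB _ _)); rewrite lerD2r.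
  apply: (le_trans (spectral_mean_norm _ _)).
  rewrite -[leRHS](spectral_mean_cst n0 (scaled_adj c E)).
  exact: spectral_mean_le.
rewrite -(real_normK (num_real (Y - b))).
case: asboolP => [_|/negP]; rewrite ?mulr1 ?mulr0 ?addr0.
  rewrite ler_wpDl ?sqr_ge0// /M ler_pXn2r ?nnegrE//.
  exact: le_trans YM.
by rewrite -ltNge => /ltW h; rewrite ler_pXn2r ?nnegrE// ltW.
Unshelve. all: by end_near.
Qed.

Lemma rgg_mean_sqr_near (alpha : R) (halpha : 0 < alpha)
    (p : nat -> R) (hp : forall n, p n = alpha / n%:R)
    (d : nat -> nat) (hd : forall n, (0 < d n)%N)
    (hdlog : (d n)%:R / ln n%:R @[n --> \oo] --> (+oo : set_system R))
    (disp : nat -> measure_display) (T : forall n, measurableType (disp n))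
    (P : forall n, probability (T n) R)
    (X : forall n, 'I_n -> {RV P n >-> @borel_rV R (d n)})
    (hX : forall n, iid_uniform_on_sphere (X n))
    (tau : nat -> R)
    (htau : \forall n \near \oo, is_threshold (X n) (p n) (tau n))
    (nu : probability R R) (hnu : is_er_limit alpha nu)
    (phi : R -> R) (C eta : R) :
  continuous phi -> poly_approx phi -> bounded_by phi C -> 0 < eta ->
  \forall n \near \oo,
    graph_mean (rgg_mass (X n) (tau n)) (fun E =>
      (sm (Num.sqrt alpha)^-1 E phi - \int[nu]_x phi x) ^+ 2) <= eta.
Proof.
move=> cphi [_ [t t0 ht]] phiC eta0.
set b := \int[nu]_x phi x; set c := (Num.sqrt alpha)^-1.
pose D := expR (`|2 * t * c| + alpha * expR `|2 * t * c|).
have D0 : 0 < D by exact: expR_gt0.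
(* The three terms of [mean_sqr_transfer] get eta / 3 each. The order matters: delta determines q,
   and eps must be small relative to the constant W of q before n is taken large. *)
pose delta := Num.sqrt (eta / (36 * D)).
have dd : delta ^+ 2 = eta / (36 * D) by rewrite sqr_sqrtr// divr_ge0 ?mulr_ge0// ltW.
have delta0 : 0 < delta by rewrite sqrtr_gt0 divr_gt0// mulr_gt0.
have [q hq] := ht _ delta0.
pose W := `|poly_const alpha c (q - b%:P)|.
have W0 : 0 <= W by rewrite /W normr_ge0.
pose eps := eta / (6 * (W + 1)).
have eps0 : 0 < eps by rewrite divr_gt0//; lra.
have eta12 : 0 < eta / 12 by rewrite divr_gt0.
near=> n.
have n0 : (0 < n)%N by near: n; exact: nbhs_infty_gt.
have nR : 0 < n%:R :> R by rewrite ltr0n.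
have p0 : 0 <= p n by rewrite hp divr_ge0// ltW.
have p1 : p n <= 1.
  by rewrite hp ler_pdivrMr// mul1r; near: n; exact: nbhs_infty_ger.
have pe : p n <= eps.
  rewrite hp ler_pdivrMr// mulrC -ler_pdivrMr//.
  by near: n; exact: nbhs_infty_ger.
have tl1 : tree_like (p n) eps (graph_pi (rgg_mass (X n) (tau n))).
  by near: n; exact: (rgg_tree_like_near halpha hp hd hdlog hX htau eps0).
have tl2 : tree_like (p n) eps (graph_pi (@er_mass R n (p n))).
  exact: er_tree_like.
have u10 E : 0 <= rgg_mass (X n) (tau n) E by exact: fine_ge0.
have u20 E : 0 <= @er_mass R n (p n) E by exact: er_mass_ge0.
have H := mean_sqr_transfer c b tl1 tl2 u10 u20 p0 p1 (ltW eps0) (ltW delta0) n0 hq.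
have npa : n%:R * p n = alpha by rewrite hp mulrC mulfVK// gt_eqF.
rewrite npa -/D in H; apply: (le_trans H).
have h2 : graph_mean (@er_mass R n (p n)) (fun E => (sm c E phi - b) ^+ 2) <= eta / 12.
  by rewrite hp; near: n; exact: (er_mean_sqr_near halpha hnu cphi phiC eta12).
have h1 : 12 * (delta ^+ 2 * D) = eta / 3.
  by rewrite dd; field; rewrite gt_eqF.
have h3 : eps * poly_const alpha c (q - b%:P) <= eta / 6.
  apply: (@le_trans _ _ (eps * W)).
    by rewrite ler_wpM2l ?(ltW eps0)// ler_norm.
  rewrite /eps mulrAC ler_pdivrMr; [nra|lra].
by rewrite h1; lra.
Unshelve. all: by end_near.
Qed.

End Limits.

Lemma sqr_le_expR_norm (R : realType) (x : R) : x ^+ 2 <= 4 * expR (1 * `|x|).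
Proof.
have h := expR_ge1Dx (`|x| / 2).
have -> : expR (1 * `|x|) = expR (`|x| / 2) ^+ 2.
  by rewrite expr2 -expRD; congr expR; field.
rewrite -(real_normK (num_real x)).
have x0 : 0 <= `|x| by [].
have : (1 + `|x| / 2) ^+ 2 <= expR (`|x| / 2) ^+ 2.
  by rewrite ler_pXn2r ?nnegrE ?expR_ge0//; lra.
by nra.
Qed.

(** If X >= eps, then W + V >= 5 eps / 8, so W or V is at least eps / 4. The right side is the
    pointwise form of Markov's inequality for W and Chebyshev's for V. *)
Lemma indicator_le_markov (R : realType) (eps W V X : R) : 0 < eps -> 0 <= W -> 0 <= V ->
  X <= 3 / 8 * eps + W + V ->
  (eps <= X)%R%:R <= 4 / eps * W + 16 / eps ^+ 2 * V ^+ 2.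
Proof.
move=> e0 W0 V0 XWV.
have a0 : 0 <= 4 / eps by rewrite divr_ge0// ltW.
have b0 : 0 <= 16 / eps ^+ 2 by rewrite divr_ge0// sqr_ge0.
have aW : 0 <= 4 / eps * W by rewrite mulr_ge0.
have bV : 0 <= 16 / eps ^+ 2 * V ^+ 2 by rewrite mulr_ge0// sqr_ge0.
have [eX|eX] := boolP (eps <= X); last by rewrite addr_ge0.
have [V4|V4] := lerP (eps / 4) V.
  apply: ler_wpDl => //; rewrite mulrAC ler_pdivlMr ?exprn_gt0// mul1r.
  have : (eps / 4) ^+ 2 <= V ^+ 2 by rewrite ler_pXn2r ?nnegrE// divr_ge0// ltW.
  by lra.
apply: ler_wpDr => //; rewrite mulrAC ler_pdivlMr// mul1r; lra.
Qed.

Theorem theorem2 (R : realType) (alpha : R) (halpha : 0 < alpha)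
    (p : nat -> R) (hp : forall n, p n = alpha / n%:R)
    (d : nat -> nat) (hd : forall n, (0 < d n)%N)
    (hdlog : (d n)%:R / ln n%:R @[n --> \oo] --> (+oo : set_system R))
    (disp : nat -> measure_display) (T : forall n, measurableType (disp n))
    (P : forall n, probability (T n) R)
    (X : forall n, 'I_n -> {RV P n >-> @borel_rV R (d n)})
    (hX : forall n, iid_uniform_on_sphere (X n))
    (tau : nat -> R)
    (htau : \forall n \near \oo, is_threshold (X n) (p n) (tau n))
    (nu : probability R R) (hnu : is_er_limit alpha nu) :
  esd_cvg_in_probability
    (fun n => P n)
    (fun n w => (Num.sqrt (n%:R * p n))^-1 *:
                rgg_adjacency (tau n) (fun i => X n i w))
    nu.
Proof.
move=> f cf [C fC] eps eps0.
set b := \int[nu]_x f x; pose c := (Num.sqrt alpha)^-1.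
have mf : measurable_fun setT f by exact: continuous_measurable_fun.
pose dev n (E : {set 'I_n * 'I_n}) := `|spectral_mean (scaled_adj c E) f - b|.
(* The deviation depends on the sample only through the graph, so the probability is a finite sum
   over graphs. *)
pose val n := graph_mean (rgg_mass (X n) (tau n)) (fun E => (eps <= dev n E)%R%:R : R).
have npa n : (0 < n)%N -> n%:R * p n = alpha.
  by move=> n0; rewrite hp mulrC mulfVK// pnatr_eq0 -lt0n.
have valE n : (0 < n)%N -> P n [set w | eps <= `|\int[esd ((Num.sqrt (n%:R * p n))^-1 *:
    rgg_adjacency (tau n) (fun i => X n i w))]_x f x - b|] = (val n)%:E.
  move=> n0; rewrite (npa n n0).
  have := probability_partition (P n) (fun E => is_true (eps <= dev n E))
    (@measurable_rgg R _ _ (P n) _ _ (X n) (tau n)).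
  have -> : [set w | eps <= dev n (rgg (X n) (tau n) w)] =
      [set w | eps <= `|\int[esd ((Num.sqrt alpha)^-1 *:
         rgg_adjacency (tau n) (fun i => X n i w))]_x f x - b|].
    apply/seteqP; split => w /=;
      by rewrite (rgg_adjacencyE (X n) (tau n)) Rintegral_esd.
  move=> ->; congr EFin; apply: eq_bigr => E _.
  by rewrite asboolb.
have C0 : 0 <= C by exact: le_trans (fC 0).
(* Replacing f by phi costs delta under the empirical measure, apart from its tail, and 2 delta
   under [nu]: together the 3 eps / 8 of [indicator_le_markov]. *)
pose delta := eps / 8.
have delta0 : 0 < delta by rewrite divr_gt0.
pose B := 2 * C + delta.
have B0 : 0 < B by rewrite /B; lra.
pose D := 2 * expR (`|1 * c| + alpha * expR `|1 * c|).
have D0 : 0 < D by rewrite mulr_gt0// expR_gt0.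
apply/fine_cvgP; split.
  near=> n; rewrite valE//; near: n; exact: nbhs_infty_gt.
apply/cvgrPdist_le => eta eta0.
have tail0 : 0 < delta / B by rewrite divr_gt0.
(* The radius k must make the tail of [nu] cost at most delta, and the empirical tail, controlled by
   a second moment of at most 4 D, cost at most 16 B D / (eps k) <= eta / 2. *)
have [k [k0 ktail kbig]] : exists k : nat, [/\ (0 < k)%N,
    fine (nu [set x | k%:R < `|x|]) < delta / B &
    32 * B * D / (eps * eta) <= k%:R].
  near \oo => k; exists k; split; near: k.
  - exact: nbhs_infty_gt.
  - exact: probability_tail.
  - exact: nbhs_infty_ger.
have k1 : 1 <= k%:R :> R by rewrite ler1n.
have kR : 0 < k%:R :> R by rewrite ltr0n.
have [phi [cphi aphi phiC fphi]] := approx_on_segment cf fC kR delta0.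
have fB x : `|f x - phi x| <= B.
  by rewrite (le_trans (ler_normB _ _))//; have := fC x; have := phiC x; rewrite /B; lra.
set bphi := \int[nu]_x phi x.
have fC' : bounded_by f (C + delta) by move=> x; have := fC x; lra.
have bb : `|bphi - b| <= 2 * delta.
  apply: (le_trans (Rintegral_dist_le nu cf cphi fC' phiC fB (ltW delta0) fphi)).
  rewrite mulr_natl mulr2n lerD2l mulrC -ler_pdivlMr//; exact: ltW.
have eta2 : 0 < eta * eps ^+ 2 / 32 by rewrite divr_gt0// mulr_gt0// exprn_gt0.
near=> n.
have n0 : (0 < n)%N by near: n; exact: nbhs_infty_gt.
have nR : 0 < n%:R :> R by rewrite ltr0n.
have u0 E : 0 <= rgg_mass (X n) (tau n) E by exact: fine_ge0.
have val0 : 0 <= val n by apply: sumr_ge0 => E _; rewrite mulr_ge0.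
rewrite /= valE//= sub0r normrN ger0_norm//.
have p0 : 0 <= p n by rewrite hp divr_ge0// ltW.
have p1 : p n <= 1.
  by rewrite hp ler_pdivrMr// mul1r; near: n; exact: nbhs_infty_ger.
(* Any eps would do here, since the exponential moment bound does not depend on it. *)
have tl : tree_like (p n) 1 (graph_pi (rgg_mass (X n) (tau n))).
  by near: n; exact: (rgg_tree_like_near halpha hp hd hdlog hX htau ltr01).
have mean2 : graph_mean (rgg_mass (X n) (tau n)) (fun E =>
    (spectral_mean (scaled_adj c E) phi - bphi) ^+ 2) <= eta * eps ^+ 2 / 32.
  by near: n; exact: (rgg_mean_sqr_near halpha hp hd hdlog hX htau hnu cphi aphi phiC eta2).
pose s2 (E : {set 'I_n * 'I_n}) := spectral_mean (scaled_adj c E) (fun x => x ^+ 2).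
have s20 E : 0 <= s2 E.
  rewrite -[leLHS](spectral_mean_cst n0 (scaled_adj c E)).
  by apply: spectral_mean_le => x; exact: sqr_ge0.
have mean_s2 : graph_mean (rgg_mass (X n) (tau n)) s2 <= 4 * D.
  have := mean_expR_norm_le c 1 tl u0 p0 p1 n0; rewrite (npa n n0) -/D => H.
  apply: le_trans (_ : 4 * graph_mean (rgg_mass (X n) (tau n)) (fun E =>
    spectral_mean (scaled_adj c E) (fun x => expR (1 * `|x|))) <= _); last first.
    by rewrite ler_pM2l.
  rewrite -graph_meanZ; apply: graph_mean_le => // E.
  rewrite -spectral_meanZ; apply: spectral_mean_le => x; exact: sqr_le_expR_norm.
have pointwise E : (eps <= dev n E)%R%:R <= 4 / eps * (B / k%:R ^+ 2 * s2 E) +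
    16 / eps ^+ 2 * (spectral_mean (scaled_adj c E) phi - bphi) ^+ 2.
  rewrite -(real_normK (num_real (_ - bphi))).
  apply: indicator_le_markov => //; first by rewrite mulr_ge0// divr_ge0 ?sqr_ge0// ltW.
  rewrite /dev; set Y := spectral_mean _ f; set Z := spectral_mean _ phi.
  have YZ : `|Y - Z| <= delta + B / k%:R ^+ 2 * s2 E.
    have -> : Y - Z = spectral_mean (scaled_adj c E) (fun x => f x - phi x).
      rewrite -mulN1r -(spectral_meanZ (scaled_adj c E)) -spectral_meanD.
      by congr spectral_mean; apply/funext => x; rewrite mulN1r.
    apply: (le_trans (spectral_mean_norm _ _)).
    rewrite -[X in X + _](spectral_mean_cst n0 (scaled_adj c E)) -spectral_meanZ -spectral_meanD.
    apply: spectral_mean_le => x.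
    have kx0 : 0 <= B / k%:R ^+ 2 * x ^+ 2.
      by rewrite mulr_ge0 ?sqr_ge0// divr_ge0 ?sqr_ge0// ltW.
    (* Beyond k, where phi is unrelated to f, the crude bound B is at most B x^2 / k^2. *)
    have [xk|xk] := lerP `|x| k%:R; first by rewrite ler_wpDr// fphi.
    apply: ler_wpDl; first exact: ltW.
    apply: (le_trans (fB x)); rewrite mulrAC ler_pdivlMr ?exprn_gt0//.
    rewrite ler_pM2l// -(real_normK (num_real x)) ler_pXn2r ?nnegrE//; exact: ltW.
  have -> : Y - b = (Y - Z) + ((Z - bphi) + (bphi - b)) by ring.
  have t1 := ler_normD (Y - Z) ((Z - bphi) + (bphi - b)).
  have t2 := ler_normD (Z - bphi) (bphi - b).
  by rewrite /delta in YZ bb; lra.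
have := graph_mean_le u0 pointwise; rewrite -/(val n) => /le_trans; apply.
rewrite graph_meanD (graph_meanZ _ (4 / eps)) (graph_meanZ _ (B / k%:R ^+ 2)).
rewrite (graph_meanZ _ (16 / eps ^+ 2)).
have h1 : 16 / eps ^+ 2 * graph_mean (rgg_mass (X n) (tau n)) (fun E =>
    (spectral_mean (scaled_adj c E) phi - bphi) ^+ 2) <= eta / 2.
  apply: (@le_trans _ _ (16 / eps ^+ 2 * (eta * eps ^+ 2 / 32))).
    by rewrite ler_wpM2l// divr_ge0// sqr_ge0.
  by rewrite le_eqVlt; apply/orP; left; apply/eqP; field; rewrite gt_eqF.
have h2 : 4 / eps * (B / k%:R ^+ 2 * graph_mean (rgg_mass (X n) (tau n)) s2) <= eta / 2.
  have kk : B / k%:R ^+ 2 <= B / k%:R.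
    by rewrite ler_pM2l// lef_pV2 ?posrE ?exprn_gt0// expr2 ler_peMr// ltW.
  have Bk0 : 0 <= B / k%:R ^+ 2 by rewrite divr_ge0 ?sqr_ge0// ltW.
  apply: (@le_trans _ _ (4 / eps * (B / k%:R * (4 * D)))).
    rewrite ler_wpM2l ?divr_ge0 ?(ltW eps0)//.
    apply: ler_pM => //; by apply: sumr_ge0 => E _; rewrite mulr_ge0.
  have -> : 4 / eps * (B / k%:R * (4 * D)) = 16 * B * D / eps / k%:R.
    by field; rewrite !gt_eqF.
  rewrite ler_pdivrMr// ler_pdivrMr//.
  by rewrite ler_pdivrMr ?mulr_gt0// in kbig; lra.
by lra.
Unshelve. all: by end_near.
Qed.
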